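(* Let $X$ be a real-valued random variable with density $p$ satisfying the standing assumptions on $p$, $g$, $h$, $q$ listed in the context; in particular $p(x)=\exp(-(g(x)-q(x)))$ on $\mathbb{R}_+$ and $h=g'$ belongs to $\mathcal{R}$. Let $m(t)=\frac{d}{dt}\log\Phi(t)$ and $s^2(t)=\frac{d^2}{dt^2}\log\Phi(t)$ (with $s(t)>0$), which are the mean and the variance of the tilted density $\pi_t$, and for integers $j\ge 3$ let $\mu_j(t)=\int_{\mathbb{R}}(x-m(t))^j\pi_t(x)\,dx$ be the $j$-th centered moment of $\pi_t$. Then, as $t\to\infty$, $$m(t)=\psi(t)(1+o(1)),\qquad s^2(t)=\psi'(t)(1+o(1)),\qquad \mu_3(t)=\psi^{(2)}(t)(1+o(1)),$$ and $$\mu_j(t)=\begin{cases} M_j\,s^j(t)(1+o(1)) & \text{for even } j>3,\\[4pt] \dfrac{(M_{j+3}-3jM_{j-1})\,\mu_3(t)\,s^{j-3}(t)}{6}(1+o(1)) & \text{for odd } j>3,\end{cases}$$ where $M_i$, $i>0$, denotes the $i$-th order moment of the standard normal distribution.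
   Context: Setting. $X$ is a real-valued random variable with support $\mathbb{R}$ and density $p$. Its moment generating function $\Phi(t)=\mathbb{E}[\exp(tX)]$ is finite in a non-void neighborhood of $0$; under the assumptions below it is finite for all large $t>0$. The tilted density (Esscher transform) with parameter $t$ is $\pi_t(x)=\frac{e^{tx}}{\Phi(t)}p(x)$, $x\in\mathbb{R}$. Form of the density. For $x\in\mathbb{R}_+$, $p(x)=\exp(-(g(x)-q(x)))$ (nothing else is assumed on the form of $p$ on the negative half-line). The function $g$ is positive, convex, four times differentiable and $g(x)/x\to\infty$ as $x\to\infty$. Put $h(x)=g'(x)$; $h$ is a positive monotone function on $\mathbb{R}_+$ and $h(x)\to\infty$ as $x\to\infty$. Let $\psi(t)=h^{\leftarrow}(t)$ be the inverse function of $h$ (considered for large $t$); $\psi(t)\to\infty$ as $t\to\infty$. $RV(\alpha)$ denotes the class of regularly varying functions (at infinity) of index $\alpha\in\mathbb{R}$ on $\mathbb{R}_+$, i.e. $f(\lambda x)/f(x)\to\lambda^\alpha$ as $x\to\infty$ for every $\lambda>0$. The class $\mathcal{R}$: $h\in\mathcal{R}$ means that one of the following two cases holds. Case 1 (regularly varying case): $h(x)=x^\beta l(x)$ with $\beta>0$ and $l(x)=c\exp\int_1^x\frac{\epsilon(u)}{u}du$ for $x\ge 1$ and some $c>0$, where $\epsilon$ is twice differentiable and, as $x\to\infty$, $\epsilon(x)=o(1)$, $x|\epsilon'(x)|=O(1)$, $x^2|\epsilon^{(2)}(x)|=O(1)$. Moreover $|h^{(2)}(x)|\in RV(\theta)$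 for a real number $\theta\le\beta-2$. Case 2 (rapidly varying case): $\psi\in RV(0)$ and $\psi(t)=c\exp\int_1^t\frac{\epsilon(u)}{u}du$ for $t\ge 1$ and some $c>0$, where $\epsilon$ is twice differentiable and, as $t\to\infty$, $\epsilon(t)=o(1)$, $\frac{t\epsilon'(t)}{\epsilon(t)}\to0$, $\frac{t^2\epsilon^{(2)}(t)}{\epsilon(t)}\to0$. In this case $h$ is called rapidly varying. Assumption on $q$: $q$ is bounded, and in Case 1, $|q(x)|\in RV(\eta)$ for some $\eta<\theta-\frac{3\beta}{2}-\frac32$; in Case 2, $|q(\psi(t))|\in RV(\eta)$ for some $\eta<-\frac12$. *)

(* Defs.v *)
From HB Require Import structures.
From mathcomp Require Export all_boot all_order all_algebra.
From mathcomp Require Export all_classical all_reals all_analysis.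
Export Order.TTheory GRing.Theory Num.Theory.
Export numFieldNormedType.Exports.

Set Implicit Arguments.
Unset Strict Implicit.
Unset Printing Implicit Defensive.

Local Open Scope ring_scope.
Local Open Scope classical_set_scope.

(* The half-line of the density representation is taken open, ]0, +oo[: since
   nothing is then required at (or, by one-sided derivatives, up to) the
   endpoint 0, hypotheses stated on it are weaker than on [0, +oo[. *)
Definition Rplus {R : realType} : set R := `]0, +oo[%classic.

(* The neighborhood filter of +oo, in the form expected by the Landau
   notations. *)
Definition at_pinfty (R : realType) : filter_on R :=
  FilterType (pinfty_nbhs R) _.

Definition support_of (R : realType) (mu : set R -> \bar R) : set R :=
  [set x | forall U : set R, open U -> U x -> (0 < mu U)%E].

Definition has_density (R : realType) (d : measure_display)
    (T : measurableType d) (P : probability T R) (X : {RV P >-> R})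
    (p : R -> R) : Prop :=
  [/\ measurable_fun [set: R] p,
      forall x, 0 <= p x &
      forall A : set R, measurable A ->
        distribution P X A = (\int[lebesgue_measure]_(x in A) (p x)%:E)%E].

(* Division by zero gives 0, so a nonzero limit makes f eventually nonzero. *)
Definition regularly_varying (R : realType) (alpha : R) (f : R -> R) : Prop :=
  forall lambda : R, 0 < lambda ->
    f (lambda * x) / f x @[x --> +oo] --> lambda `^ alpha.

Definition times_derivable (R : realType) (n : nat) (f : R -> R) (A : set R) :
  Prop := forall k x, (k < n)%N -> A x -> derivable (f^`(k)) x 1.

(* psi is the inverse of h near +oo; its values elsewhere are irrelevant. *)
Definition inverse_at_infinity (R : realType) (h psi : R -> R) : Prop :=
  [/\ \forall t \near +oo, 0 < psi t,
      \forall t \near +oo, h (psi t) = t &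
      \forall x \near +oo, psi (h x) = x].

(* f has the Karamata form c * exp (int_1^x eps u / u du) on [1, +oo[; at the
   endpoint 1 only continuity of eps is asked, which makes the integral
   meaningful and holds if eps has a one-sided derivative there. *)
Definition karamata_form (R : realType) (c : R) (eps f : R -> R) : Prop :=
  [/\ 0 < c,
      {within `[1, +oo[, continuous eps},
      times_derivable 2 eps `]1, +oo[%classic &
      forall x, 1 <= x ->
        f x = c * expR (\int[lebesgue_measure]_(u in `[1, x]) (eps u / u))].

Definition regular_case (R : realType) (h : R -> R) (beta theta : R) : Prop :=
  exists (l eps : R -> R) (c : R),
  [/\ 0 < beta,
      {in Rplus, forall x, h x = x `^ beta * l x},
      karamata_form c eps l,
      [/\ eps x @[x --> +oo] --> 0,
          (fun x => x * `|eps^`() x|) =O_ (at_pinfty R) (cst 1 : R -> R) &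
          (fun x => x ^+ 2 * `|eps^`(2) x|)
            =O_ (at_pinfty R) (cst 1 : R -> R)] &
      theta <= beta - 2 /\
      regularly_varying theta (fun x => `|h^`(2) x|)].

Definition rapid_case (R : realType) (psi : R -> R) : Prop :=
  exists (eps : R -> R) (c : R),
  [/\ regularly_varying 0 psi,
      karamata_form c eps psi,
      eps t @[t --> +oo] --> 0,
      t * eps^`()%classic t / eps t @[t --> +oo] --> 0 &
      t ^+ 2 * eps^`(2)%classic t / eps t @[t --> +oo] --> 0].

(* h belongs to the class of the theorem and q satisfies the smallness
   condition attached to the case (beta and theta are determined by h). *)
Definition class_R_assumption (R : realType) (h psi q : R -> R) : Prop :=
  (exists beta theta eta : R,
     [/\ regular_case h beta theta,
         eta < theta - 3 * beta / 2 - 3 / 2 &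
         regularly_varying eta (fun x => `|q x|)])
  \/
  (exists eta : R,
     [/\ rapid_case psi,
         eta < - (1 / 2) &
         regularly_varying eta (fun t => `|q (psi t)|)]).

Section tilting.
Context (R : realType) (d : measure_display) (T : measurableType d).
Variables (P : probability T R) (X : {RV P >-> R}) (p : R -> R).

Definition Phi (t : R) : R := fine ('M_P X t).

Definition tilted_density (t x : R) : R := expR (t * x) / Phi t * p x.

Definition m : R -> R := (fun t => ln (Phi t))^`().

Definition s2 : R -> R := (fun t => ln (Phi t))^`(2).

Definition s (t : R) : R := Num.sqrt (s2 t).

Definition mu (j : nat) (t : R) : R :=
  \int[lebesgue_measure]_x ((x - m t) ^+ j * tilted_density t x).

End tilting.

Definition normal_moment (R : realType) (i : nat) : R :=
  \int[normal_prob (0 : R) 1]_x (x ^+ i).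

(* Main.v *)
Require Import Defs.
From mathcomp Require Import measurable_realfun ring lra zify.

(** The proof is Laplace's method carried one order beyond the leading term.

    Write h = g', let xh = psi(t) be the mode of exp(t x - g(x)), and measure
    lengths from it in units of sigma = h'(xh)^(-1/2), that is,
    u = (x - xh)/sigma. With a = h''(xh) sigma^3, the tilted density is, up to
    normalization, W = phi(u) (1 - a u^3/6 + o(a)), where phi(u) = exp(-u^2/2)
    and a tends to 0. Integration against u^k shows that the k-th moment about
    the mode is M_k - a M_(k+3)/6 + o(a) in these units (moment_bound,
    moment_ratio_cvg). The rest is algebra. The mean is xh + sigma r_1 with
    r_1 equivalent to -a/2, and the binomial formula turns moments about xh
    into centered moments. For even j the leading term M_j survives
    (centered_cvg). For odd j it vanishes, and the terms of order a coming from
    r_j and from - j r_1 r_(j-1) add up to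
    - (M_(j+3) - 3 j M_(j-1)) a/6 (centered_odd_cvg). Finally
    psi' = sigma^2 and psi'' = - a sigma^3, so that s^2, mu_3 and the other
    moments compare as stated.

    The difficulty is the precision o(a), since a may tend to 0 at any
    polynomial rate. The bound
    |u|^k |W - phi (1 - a u^3/6)| <= C delta |a| (1/(1 + u^2) + sigma p(x))
    (pointwise_bound) is proved under the conditions collected in
    local_gaussian, in three zones. In a window of U units around the mode,
    iterated mean value estimates use only that h'' is nearly constant.
    Outside it on the positive half-line, convexity of g gives
    W <= C exp(-U |u|/4), and exp(-U) = o(a) because a and sigma are of
    polynomial size while U grows like a power. On the negative half-line,
    where p is just a density, exp(t x) p(x) is so small relatively to the
    value at the mode that p itself can be the majorant.

    These conditions come from regular variation. The window is small relative
    to the range on which a regularly varying function is nearly constant, by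
    the uniform convergence theorem (slow_uniform), in its version for
    measurable functions because q need not be continuous. In the regularly
    varying case the variable is x; in the rapidly varying case it is t, and
    the functions are composed with psi. Both are instances of
    laplace_regime_of_rvU, where the mode is parametrized by an auxiliary
    variable. *)

Set Implicit Arguments.
Unset Strict Implicit.
Unset Printing Implicit Defensive.

Local Open Scope ring_scope.
Local Open Scope classical_set_scope.

Local Notation leb := lebesgue_measure.

(** * Derivatives of explicit expressions *)

Section derivatives.
Context (R : realType).
Implicit Types (f g : R -> R) (x a b : R).
(** These rules have the function body applied to its point, so that the
    derivative of an explicit expression is obtained by composing them and
    the resulting value is then adjusted by is_derive_eq. *)
Lemma derD f g x a b : is_derive x 1 f a -> is_derive x 1 g b ->
  is_derive x 1 (fun y => f y + g y) (a + b).
Proof. exact: is_deriveD. Qed.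
Lemma derN f x a : is_derive x 1 f a -> is_derive x 1 (fun y => - f y) (- a).
Proof. exact: is_deriveN. Qed.
Lemma derB f g x a b : is_derive x 1 f a -> is_derive x 1 g b ->
  is_derive x 1 (fun y => f y - g y) (a - b).
Proof. exact: is_deriveB. Qed.
Lemma derM f g x a b : is_derive x 1 f a -> is_derive x 1 g b ->
  is_derive x 1 (fun y => f y * g y) (a * g x + f x * b).
Proof.
by move=> fa gb; apply: (is_derive_eq (is_deriveM fa gb)); rewrite /GRing.scale/=; ring.
Qed.
Lemma derX f n x a : is_derive x 1 f a ->
  is_derive x 1 (fun y => f y ^+ n) (n%:R * f x ^+ n.-1 * a).
Proof.
move=> fa; rewrite (_ : (fun y => f y ^+ n) = f ^+ n); last first.
  by apply/funext => y; rewrite exprfctE.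
exact: is_deriveX.
Qed.
Lemma derV f x a : f x != 0 -> is_derive x 1 f a ->
  is_derive x 1 (fun y => (f y)^-1) (- a / f x ^+ 2).
Proof.
move=> fx0 fa; apply: (is_derive_eq (is_deriveV fx0 fa)).
by rewrite /GRing.scale/= mulrC mulNr mulrN.
Qed.
Lemma derC x (c : R) : is_derive x (1 : R) (cst c : R -> R) (0 : R).
Proof. exact: is_derive_cst. Qed.
Lemma derI x : is_derive x (1 : R) (id : R -> R) (1 : R).
Proof. exact: is_derive_id. Qed.
Lemma der_comp f g x a b : is_derive (g x) 1 f a -> is_derive x 1 g b ->
  is_derive x 1 (fun y => f (g y)) (a * b).
Proof. by move=> fa gb; exact: (is_derive1_comp fa gb). Qed.
Lemma der_expR f x a : is_derive x 1 f a ->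
  is_derive x 1 (fun y => expR (f y)) (expR (f x) * a).
Proof. by move=> fa; apply: (der_comp (f := expR)). Qed.
Lemma der_ln f x a : 0 < f x -> is_derive x 1 f a ->
  is_derive x 1 (fun y => ln (f y)) (a / f x).
Proof.
move=> f0 fa; have := der_comp (is_derive1_ln f0) fa.
by rewrite mulrC.
Qed.
End derivatives.

(** * Densities and affine changes of variable *)

(** The integral against nu is the integral against Lebesgue measure weighted
    by the Radon-Nikodym derivative of nu, and p is almost everywhere equal
    to that derivative because both have the same integral on every set. *)
Lemma ge0_integral_density (R : realType) (nu : probability (measurableTypeR R) R)
    (p : R -> R) (f : R -> \bar R) :
  measurable_fun [set: R] p -> (forall x, 0 <= p x) ->
  (forall A, measurable A ->
     nu A = (\int[leb]_(x in A) (p x)%:E)%E) ->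
  measurable_fun [set: R] f -> (forall x, (0 <= f x)%E) ->
  (\int[nu]_x f x = \int[leb]_x (f x * (p x)%:E))%E.
Proof.
move=> mp p0 nuE mf f0.
have numu : nu `<< leb.
  apply/null_content_dominatesP => A mA muA; rewrite nuE//.
  by apply: null_set_integral => //; apply/measurable_EFinP; exact: measurable_funS mp.
rewrite -(Radon_Nikodym_SigmaFinite.change_of_variables numu f0)//.
apply: ae_eq_integral => //.
- apply: emeasurable_funM => //.
  exact: measurable_int (Radon_Nikodym_SigmaFinite.f_integrable numu).
- by apply: emeasurable_funM => //; exact/measurable_EFinP.
- suff : ae_eq leb setT (Radon_Nikodym_SigmaFinite.f nu leb)
     (EFin \o p).
    by apply: filterS => x /= h _; rewrite h.
  apply: integral_ae_eq => //.
  + exact: Radon_Nikodym_SigmaFinite.f_integrable.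
  + exact/measurable_EFinP.
  + by move=> E _ mE; rewrite -Radon_Nikodym_SigmaFinite.f_integral//; exact: nuE.
Qed.

Lemma integral_density (R : realType) (nu : probability (measurableTypeR R) R)
    (p f : R -> R) :
  measurable_fun [set: R] p -> (forall x, 0 <= p x) ->
  (forall A, measurable A ->
     nu A = (\int[leb]_(x in A) (p x)%:E)%E) ->
  measurable_fun [set: R] f ->
  (\int[nu]_x (f x)%:E = \int[leb]_x (f x * p x)%:E)%E.
Proof.
move=> mp p0 nuE mf.
have mf' : measurable_fun [set: R] (EFin \o f) by exact/measurable_EFinP.
rewrite integralE [RHS]integralE.
rewrite (ge0_integral_density mp p0 nuE (measurable_funepos mf'))//.
rewrite (ge0_integral_density mp p0 nuE (measurable_funeneg mf'))//.
congr (_ - _)%E; apply: eq_integral => x _.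
- rewrite !funeposE/= -!EFin_max -EFinM; congr EFin.
  by rewrite maxr_pMl// mul0r.
- rewrite !funenegE/= -!EFin_max -EFinM; congr EFin.
  by rewrite maxr_pMl// mul0r mulNr.
Qed.

(** Both sides, divided by s, are measures that agree on intervals, and such a
    measure is unique. *)
Lemma lebesgue_measure_affine (R : realType) (c s : R) (A : set R) : 0 < s ->
  measurable A ->
  leb ((fun x => (x - c) / s) @^-1` A) =
  (s%:E * leb A)%E.
Proof.
move=> s0 mA.
pose F : measurableTypeR R -> measurableTypeR R := fun x : R => (x - c) / s.
have mF : measurable_fun [set: measurableTypeR R] F.
  have -> : F = (fun x : R => (x - c) * s^-1) by [].
  by apply: measurable_funM => //; exact: measurable_funB.
have si0 : 0 <= s^-1 by rewrite invr_ge0 ltW.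
have [mm mmE] : exists mm : {measure set (measurableTypeR R) -> \bar R},
    forall B, mm B = (s^-1%:E * leb (F @^-1` B))%E.
  by unshelve eexists (mscale (NngNum si0) (pushforward leb F)).
suff -> : leb A = mm A.
  by rewrite mmE muleA -EFinM divff ?gt_eqF// mul1e.
apply: lebesgue_measure_unique => //= _ [[a b]] _ <-.
rewrite mmE.
rewrite (_ : _ @^-1` _ = `](a * s + c), (b * s + c)]); last first.
  by apply/seteqP; split => x/=; rewrite !in_itv/= ltr_pdivlMr// ltrBrDr ler_pdivrMr// lerBlDr.
rewrite !lebesgue_measure_itv/= !lte_fin ltrD2r ltr_pM2r//.
by case: ifP => // _; rewrite ?mule0// -!EFinD -EFinM; congr EFin; field; rewrite gt_eqF.
Qed.

Lemma ge0_integral_affine (R : realType) (c s : R) (f : R -> \bar R) : 0 < s ->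
  measurable_fun [set: R] f -> (forall x, 0 <= f x)%E ->
  (\int[leb]_x f ((x - c) / s)%R =
   s%:E * \int[leb]_x f x)%E.
Proof.
move=> s0 mf f0.
pose F : measurableTypeR R -> measurableTypeR R := fun x : R => (x - c) / s.
have mF : measurable_fun [set: measurableTypeR R] F.
  have -> : F = (fun x : R => (x - c) * s^-1) by [].
  by apply: measurable_funM => //; exact: measurable_funB.
transitivity (\int[pushforward leb F]_x f x)%E.
  by rewrite ge0_integral_pushforward.
transitivity (\int[mscale (NngNum (ltW s0)) leb]_x f x)%E.
  by apply: eq_measure_integral => A mA _; exact: lebesgue_measure_affine.
by rewrite ge0_integral_mscale.
Qed.

Lemma integrable_affine (R : realType) (c s : R) (f : R -> R) : 0 < s ->
  leb.-integrable [set: R] (EFin \o f) ->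
  leb.-integrable [set: R] (fun x => (f ((x - c) / s))%:E).
Proof.
move=> s0 /integrableP[mf fi]; apply/integrableP; split.
  apply/measurable_EFinP; apply: (measurableT_comp (f := f)).
    exact/measurable_EFinP.
  by apply: measurable_funM => //; exact: measurable_funB.
rewrite (ge0_integral_affine c s0 (f := fun x => `|(f x)%:E|%E))//.
  by rewrite lte_mul_pinfty// lee_fin ltW.
exact: measurableT_comp.
Qed.

Lemma Rintegral_affine (R : realType) (c s : R) (f : R -> R) : 0 < s ->
  leb.-integrable [set: R] (EFin \o f) ->
  \int[leb]_x f ((x - c) / s) = s * \int[leb]_x f x.
Proof.
move=> s0 fi; have /integrableP[mf _] := fi.
rewrite /Rintegral integralE [in RHS]integralE.
have ep := ge0_integral_affine c s0 (measurable_funepos mf) (funepos_ge0 _).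
have en := ge0_integral_affine c s0 (measurable_funeneg mf) (funeneg_ge0 _).
transitivity (fine (\int[leb]_x (EFin \o f)^\+ ((x - c) / s)%R -
  \int[leb]_x (EFin \o f)^\- ((x - c) / s)%R)%E).
  by congr (fine (_ - _)); apply: eq_integral => x _; rewrite ?funeposE ?funenegE.
rewrite ep en.
have fp := integrable_pos_fin_num measurableT fi.
have fn := integrable_neg_fin_num measurableT fi.
rewrite -muleBr//; last by rewrite fin_num_adde_defr.
by rewrite fineM// fin_numB fp fn.
Qed.

(** * Gaussian moments *)

Lemma poly_expR_bounded (R : realType) (n : nat) (c : R) : 0 < c ->
  exists2 C : R, 0 < C & forall y, 0 <= y -> (1 + y) ^+ n * expR (- (c * y)) <= C.
Proof.
move=> c0.
pose K := n.+1`!%:R / c ^+ n.+1 * expR c.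
have K0 : 0 < K by rewrite mulr_gt0 ?expR_gt0// divr_gt0// ?exprn_gt0// ltr0n fact_gt0.
exists K => // y y0.
rewrite expRN ler_pdivrMr ?expR_gt0//.
have y1 : 1 <= 1 + y by rewrite lerDl.
apply: (@le_trans _ _ ((1 + y) ^+ n.+1)).
  by rewrite exprS ler_peMl// exprn_ge0//; lra.
have cy : 0 <= c * (1 + y) by rewrite mulr_ge0 ?ltW//; lra.
have := expR_ge1Dxn n cy => h.
have : (c * (1 + y)) ^+ n.+1 / n.+1`!%:R <= expR (c * (1 + y)).
  by apply: le_trans h; rewrite lerDr.
rewrite ler_pdivrMr ?ltr0n ?fact_gt0// exprMn => h2.
rewrite /K mulrAC -mulrA -mulrA -expRD (_ : c * y + c = c * (1 + y)); last by ring.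
rewrite mulrCA ler_pdivlMl ?exprn_gt0//.
by rewrite [leRHS]mulrC.
Qed.

(** The function 1 / (1 + u^2) serves as the one integrable majorant for all
    the Gaussian and exponential bounds below. *)
Lemma poly_expR_le_cauchy (R : realType) (n : nat) (c : R) : 0 < c ->
  exists2 C : R, 0 < C &
    forall u, (1 + `|u|) ^+ n * expR (- (c * `|u|)) <= C * (oneDsqr u)^-1.
Proof.
move=> c0; have [C C0 hC] := poly_expR_bounded n.+2 c0.
exists C => // u; rewrite ler_pdivlMr; last by rewrite (lt_le_trans ltr01)// oneDsqr_ge1.
apply: le_trans (hC `|u| (normr_ge0 u)).
rewrite mulrAC ler_wpM2r ?expR_ge0// -addn2 exprD ler_wpM2l//.
rewrite /oneDsqr -(real_normK (num_real u)).
have := normr_ge0 u; nra.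
Qed.

Lemma integrable_cauchy (R : realType) : leb.-integrable [set: R]
  (fun x : R => ((oneDsqr x)^-1)%:E).
Proof.
have c0 (x : R) : 0 <= (oneDsqr x)^-1 by rewrite invr_ge0 (le_trans ler01)// oneDsqr_ge1.
have cc := @continuous_oneDsqrV R.
apply/integrableP; split.
  by apply/measurable_EFinP; exact: continuous_measurable_fun.
under eq_integral => x _ do rewrite gee0_abs ?lee_fin//.
rewrite (@ge0_symfun_integralT R (fun x => (oneDsqr x)^-1))//; last first.
  by move=> x; rewrite /= /oneDsqr sqrrN.
rewrite (_ : [set x | 0 <= x] = `[0, +oo[); last first.
  by apply/seteqP; split => x /=; rewrite in_itv/= andbT.
by rewrite integral0y_oneDsqr -EFinM ltry.
Qed.

Definition gauss_weight (R : realType) (u : R) : R := expR (- (u ^+ 2 / 2)).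

Lemma gauss_weight_le (R : realType) (c u : R) :
  gauss_weight u <= expR (c ^+ 2 / 2) * expR (- (c * `|u|)).
Proof.
rewrite /gauss_weight -expRD ler_expR -(real_normK (num_real u)).
have := sqr_ge0 (`|u| - c); lra.
Qed.

Lemma gauss_weight_ge0 (R : realType) (u : R) : 0 <= gauss_weight u.
Proof. exact: expR_ge0. Qed.

Lemma continuous_gauss_weight (R : realType) : continuous (@gauss_weight R).
Proof.
move=> x; apply: continuous_comp; last exact: continuous_expR.
by apply: cvgN; apply: cvgMl; exact: exprn_continuous.
Qed.

(** The bound is uniform under a unit shift of the argument: this makes it
    usable for differentiating a Gaussian integral in the shift. *)
Lemma gauss_moment_le_cauchy (R : realType) (n : nat) :
  exists2 C : R, 0 < C & forall u v, `|u - v| <= 1 ->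
    (1 + `|v|) ^+ n * gauss_weight v <= C * (oneDsqr u)^-1.
Proof.
have [C C0 hC] := @poly_expR_le_cauchy R n 1 ltr01.
exists (2 ^+ n * expR (1 / 2) * expR 1 * C) => [|u v uv].
  by rewrite !mulr_gt0// ?expR_gt0 ?exprn_gt0.
rewrite -mulrA; apply: le_trans (ler_wpM2l _ (hC u)); last first.
  by rewrite !mulr_ge0// ?expR_ge0 ?exprn_ge0.
have := lerB_dist u v; have := lerB_dist v u; rewrite distrC => h1 h2.
apply: (@le_trans _ _ ((2 * (1 + `|u|)) ^+ n * (expR (1 / 2) * (expR 1 * expR (- (1 * `|u|)))))).
  apply: ler_pM.
  - by rewrite exprn_ge0// addr_ge0.
  - exact: gauss_weight_ge0.
  - by apply: lerXn2r; rewrite ?nnegrE; have := normr_ge0 u; have := normr_ge0 v; lra.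
  - apply: le_trans (gauss_weight_le 1 v) _.
    rewrite expr1n ler_wpM2l ?expR_ge0// -expRD ler_expR; lra.
by rewrite exprMn le_eqVlt; apply/orP; left; apply/eqP; ring.
Qed.

Lemma integrable_gauss_moment (R : realType) (k : nat) : leb.-integrable [set: R]
  (fun u : R => (u ^+ k * gauss_weight u)%:E).
Proof.
have [C C0 hC] := gauss_moment_le_cauchy R k.
have iG := integrableZl measurableT C (integrable_cauchy R).
apply: le_integrable iG => //.
  apply/measurable_EFinP; apply: continuous_measurable_fun => x.
  by apply: cvgM; [exact: exprn_continuous|exact: continuous_gauss_weight].
move=> u _; rewrite -EFinM !abse_EFin lee_fin [leRHS]ger0_norm; last first.
  by rewrite mulr_ge0 ?ltW// invr_gt0 (lt_le_trans ltr01)// oneDsqr_ge1.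
apply: le_trans (hC u u _); last by rewrite subrr normr0.
rewrite normrM (ger0_norm (gauss_weight_ge0 u)) ler_wpM2r ?gauss_weight_ge0//.
by rewrite normrX lerXn2r ?nnegrE//; have := normr_ge0 u; lra.
Qed.

Definition gauss_moment (R : realType) (k : nat) : R :=
  \int[leb]_u (u ^+ k * gauss_weight u).

Lemma is_derive_gauss_weight (R : realType) (x : R) :
  is_derive x 1 (@gauss_weight R) (- x * gauss_weight x).
Proof.
refine (is_derive_eq (der_expR (derN (derM (derX 2 (derI x)) (derC x 2^-1)))) _).
by rewrite /gauss_weight /=; field.
Qed.

Lemma is_derive_gauss_monomial (R : realType) (n : nat) (u c : R) :
  is_derive c 1 (fun c => (u - c) ^+ n * gauss_weight (u - c))
    ((u - c) ^+ n.+1 * gauss_weight (u - c)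
     - n%:R * ((u - c) ^+ n.-1 * gauss_weight (u - c))).
Proof.
have d1 : is_derive c 1 (fun c : R => u - c) (-1).
  by refine (is_derive_eq (derB (derC c u) (derI c)) _); rewrite sub0r.
refine (is_derive_eq (derM (derX n d1) (der_comp (is_derive_gauss_weight _) d1)) _).
by rewrite exprS; ring.
Qed.

(** The integral of (u - c)^n phi(u - c) over u does not depend on c; its
    derivative in c, taken under the integral sign, is
    M_(n+1) - n M_(n-1) and must vanish. This replaces integration by parts
    on the whole line. *)
Lemma gauss_moment_rec (R : realType) (n : nat) :
  gauss_moment R n.+1 = n%:R * gauss_moment R n.-1.
Proof.
pose f (c u : R) := (u - c) ^+ n * gauss_weight (u - c).
have dfE c u : (f ^~ u)^`() c = (u - c) ^+ n.+1 * gauss_weight (u - c)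
     - n%:R * ((u - c) ^+ n.-1 * gauss_weight (u - c)).
  by rewrite derive1E; have [_ ->] := is_derive_gauss_monomial n u c.
have [C C0 hC] := gauss_moment_le_cauchy R n.+1.
have intf c : leb.-integrable [set: R] (EFin \o f c).
  have -> : EFin \o f c = (fun u => ((fun v => v ^+ n * gauss_weight v) ((u - c) / 1))%:E).
    by apply/funext => u; rewrite /f /= divr1.
  exact: integrable_affine (integrable_gauss_moment R n).
have Fcst c : \int[leb]_u f c u = gauss_moment R n.
  have := Rintegral_affine c ltr01 (integrable_gauss_moment R n).
  rewrite mul1r /gauss_moment => h; apply: etrans h.
  by apply: eq_Rintegral => u _; rewrite /f divr1.
have G0 (y : R) : 0 <= n.+1%:R * C * (oneDsqr y)^-1.
  by rewrite !mulr_ge0 ?ltW// invr_gt0 (lt_le_trans ltr01)// oneDsqr_ge1.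
have Gint : leb.-integrable [set: R]
    (EFin \o (fun y => n.+1%:R * C * (oneDsqr y)^-1)).
  by apply: eq_integrable (integrableZl measurableT (n.+1%:R * C) (integrable_cauchy R)).
apply/eqP; rewrite -subr_eq0; apply/eqP.
have Fc : (fun c => \int[leb]_u f c u) = cst (gauss_moment R n).
  by apply/funext => c; exact: Fcst.
transitivity ((fun c => \int[leb]_u f c u)^`() 0); last first.
  by rewrite Fc derive1_cst.
rewrite (@differentiation_under_integral R _ _ leb f setT measurableT 0 (-1) 1
   _ (fun c _ => intf c) _ _ G0 Gint _); last 3 first.
- by rewrite /= in_itv/=; lra.
- by move=> c u _ _; have [] := is_derive_gauss_monomial n u c.
- move=> c u; rewrite /= in_itv/= => /andP[c1 c2] _; rewrite /partial1of2 dfE.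
  have uv : `|u - (u - c)| <= 1 by rewrite opprB addrC subrK ler_norml; lra.
  rewrite -mulrA; apply: le_trans (ler_wpM2l _ (hC _ _ uv)) => //.
  set v := u - c.
  apply: le_trans (ler_normB _ _) _; rewrite !normrM (ger0_norm (gauss_weight_ge0 v)).
  rewrite mulrA -mulrDl mulrA ler_wpM2r ?gauss_weight_ge0// !normrX normr_nat.
  have v1 : 1 <= 1 + `|v| by rewrite lerDl.
  have e1 : `|v| ^+ n.+1 <= (1 + `|v|) ^+ n.+1 by rewrite lerXn2r ?nnegrE//; lra.
  have e2 : `|v| ^+ n.-1 <= (1 + `|v|) ^+ n.+1.
    apply: (@le_trans _ _ ((1 + `|v|) ^+ n.-1)).
      by rewrite lerXn2r ?nnegrE//; lra.
    by rewrite ler_weXn2l// (leq_trans (leq_pred n)).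
  rewrite -natr1 mulrDl mul1r addrC lerD// ler_wpM2l//.
rewrite /partial1of2; under eq_Rintegral => u _ do rewrite dfE subr0.
rewrite RintegralB//; last 2 first.
- exact: integrable_gauss_moment.
- by apply: eq_integrable (integrableZl measurableT n%:R (integrable_gauss_moment R n.-1)).
by rewrite RintegralZl//; exact: integrable_gauss_moment.
Qed.

Lemma gauss_moment_odd (R : realType) (k : nat) : odd k -> gauss_moment R k = 0.
Proof.
elim/ltn_ind: k => -[//|[|k]] IH ok; rewrite gauss_moment_rec ?mul0r//=.
by rewrite IH ?mulr0//; move: ok; rewrite /= negbK.
Qed.

Lemma normal_pdf_gauss_weight (R : realType) (x : R) :
  normal_pdf 0 1 x = normal_peak (1 : R) * gauss_weight x.
Proof. by rewrite normal_pdfE ?oner_neq0// /normal_fun subr0 expr1n mulNr. Qed.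

Lemma integral_normal_pdf_monomial (R : realType) (n : nat) :
  (\int[leb]_x (x ^+ n * normal_pdf 0 1 x)%:E =
   (normal_peak (1 : R) * gauss_moment R n)%:E)%E.
Proof.
under eq_integral => x _ do rewrite normal_pdf_gauss_weight mulrCA EFinM.
have ig := integrable_gauss_moment R n.
rewrite integralZl// EFinM /gauss_moment /Rintegral fineK//.
exact: integrable_fin_num.
Qed.

Lemma normal_peak_gauss_moment (R : realType) :
  normal_peak (1 : R) * gauss_moment R 0 = 1.
Proof.
apply: EFin_inj; rewrite -integral_normal_pdf_monomial -(@integral_normal_pdf R 0 1).
by apply: eq_integral => x _; rewrite expr0 mul1r.
Qed.

Lemma gauss_moment0_gt0 (R : realType) : 0 < gauss_moment R 0.
Proof.
by rewrite -(pmulr_rgt0 _ (normal_peak_gt0 (oner_neq0 R))) normal_peak_gauss_moment.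
Qed.

(** Working with the unnormalized weight keeps square roots of pi out of all
    computations: only quotients of moments matter. *)
Lemma normal_momentE (R : realType) (k : nat) :
  normal_moment R k = gauss_moment R k / gauss_moment R 0.
Proof.
rewrite /normal_moment /Rintegral (@integral_density R _ (normal_pdf 0 1))//.
- rewrite integral_normal_pdf_monomial/=; apply: (canRL (mulfK _)).
    by rewrite gt_eqF// gauss_moment0_gt0.
  by rewrite mulrAC normal_peak_gauss_moment mul1r.
- exact: measurable_normal_pdf.
- exact: normal_pdf_ge0.
Qed.

(** * Uniform convergence in slow variation *)

Section uniform_convergence.
Context (R : realType) (k : R -> R) (A : R).
Hypothesis mk : measurable_fun `]A, +oo[ k.
Hypothesis k_slow : forall u, k (x + u) - k x @[x --> +oo] --> 0.

Let I02 : set R := `[0, 2].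

Let close_at (e : R) (ys : nat -> R) (m : nat) : set R :=
  I02 `&` [set u | `|k (ys m + u) - k (ys m)| <= e].

(** The shifts for which the oscillation of k stays below e from index n on.
    Since k is slowly varying at each shift, these sets increase to [0, 2],
    so their measure tends to 2. *)
Let settled e ys n := \bigcap_m close_at e ys (n + m).

Let measurable_close e ys m : A < ys m -> measurable (close_at e ys m).
Proof.
move=> Ay.
have mf : measurable_fun I02 (fun u => `|k (ys m + u) - k (ys m)|).
  apply: measurableT_comp => //; apply: measurable_funB => //.
  apply: (@measurable_comp _ _ _ _ _ _ `]A, +oo[ k) => //.
    move=> _ [u /= + <-]; rewrite /= !in_itv/= andbT => /andP[u0 _].
    by rewrite (lt_le_trans Ay)// lerDl.
  exact: measurable_funD.
have -> : close_at e ys m = I02 `&` (fun u => `|k (ys m + u) - k (ys m)|) @^-1` `]-oo, e].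
  by apply/seteqP; split => u [u02]; rewrite /= in_itv/=.
apply: mf; exact: measurable_itv.
Qed.

Let settled_large e ys : 0 < e -> (forall m, A < ys m) -> ys n @[n --> \oo] --> +oo ->
  \forall n \near \oo, (leb (settled e ys n) > (7 / 4)%:E)%E.
Proof.
move=> e0 Ay yoo.
have mE m : measurable (close_at e ys m) by exact: measurable_close.
have mS n : measurable (settled e ys n) by apply: bigcapT_measurable => m; exact: mE.
have US : \bigcup_n settled e ys n = I02.
  apply/seteqP; split => [u [n _ /(_ 0%N I)[]//]|u u02].
  have /cvgrPdist_le/(_ e e0) := k_slow u.
  move=> /yoo[n _ hn]; exists n => // m _; split => //=.
  by have := hn (n + m)%N (leq_addr _ _); rewrite /= sub0r normrN.
have ndS : nondecreasing_seq (settled e ys).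
  move=> n m nm; apply/subsetPset => u Su j _.
  by have := Su (m - n + j)%N I; rewrite addnA subnKC.
have := @nondecreasing_cvg_mu _ _ _ leb _ mS _ ndS.
rewrite US => /(_ (measurable_itv _)) cS.
have I2 : leb I02 = 2%:E.
  by rewrite /I02 lebesgue_measure_itv/= lte_fin ltr0n/= -EFinB subr0.
apply: (cS [set y | ((7 / 4)%:E < y)%E]); apply: open_nbhs_nbhs; split.
  exact: open_ereal_gt_ereal.
by rewrite /= I2 lte_fin; lra.
Qed.

(** If uniformity failed along x_n and shifts u_n, put y_n = x_n + u_n. The
    shifts that are good at x_n and those that are good at y_n, translated by
    u_n, both lie in [0, 3] and have measure above 7/4, so they meet. At a
    common shift v the increments from x_n to x_n + v and from y_n to the same
    point are both at most e/2, which bounds the increment from x_n to y_n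
    by e. *)
Lemma slow_uniform (e : R) : 0 < e -> \forall x \near +oo,
  forall u, 0 <= u <= 1 -> `|k (x + u) - k x| <= e.
Proof.
move=> e0; apply: contrapT => nh.
have bad (n : nat) : exists xu : R * R, [/\ Num.max A n%:R < xu.1, 0 <= xu.2 <= 1 &
    e < `|k (xu.1 + xu.2) - k xu.1|].
  apply: contrapT => nb; apply: nh; exists (Num.max A n%:R); split; [exact: num_real|move=> x xn u u01].
  rewrite leNgt; apply/negP => eu; apply: nb; exists (x, u); split => //.
have [xu hxu] := choice bad.
pose xs n := (xu n).1; pose us n := (xu n).2; pose ys n := xs n + us n.
have xsA n : A < xs n by have [+ _ _] := hxu n; rewrite gt_max => /andP[].
have xsn n : n%:R < xs n by have [+ _ _] := hxu n; rewrite gt_max => /andP[].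
have us01 n : 0 <= us n <= 1 by have [] := hxu n.
have xys n : xs n <= ys n by rewrite lerDl; case/andP: (us01 n).
have cxs : xs n @[n --> \oo] --> +oo.
  apply/cvgryPge => M; near=> n; apply: (@le_trans _ _ n%:R); last exact: ltW.
  near: n; exact: nbhs_infty_ger.
have cys : ys n @[n --> \oo] --> +oo.
  apply/cvgryPge => M; near=> n; apply: (@le_trans _ _ (xs n)) => //.
  by near: n; move/cvgryPge : cxs; exact.
have e20 : 0 < e / 2 by rewrite divr_gt0.
have ysA n : A < ys n by exact: lt_le_trans (xsA n) (xys n).
have Sx := settled_large e20 xsA cxs.
have Sy := settled_large e20 ysA cys.
near \oo => n.
have h1 : (leb (settled (e / 2) xs n) > (7 / 4)%:E)%E by near: n.
have h2 : (leb (settled (e / 2) ys n) > (7 / 4)%:E)%E by near: n.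
have mSx : measurable (settled (e / 2) xs n) by apply: bigcapT_measurable => m; exact: measurable_close.
have mSy : measurable (settled (e / 2) ys n) by apply: bigcapT_measurable => m; exact: measurable_close.
(* the shifts that are good at ys n, counted from xs n instead *)
pose W := (fun x => (x - us n) / 1) @^-1` settled (e / 2) ys n.
have mW : measurable W.
  have mF : measurable_fun [set: R] (fun x : R => (x - us n) / 1).
    by apply: measurable_funM => //; exact: measurable_funB.
  by rewrite -[W]setTI; exact: mF.
have h3 : (leb W > (7 / 4)%:E)%E.
  by rewrite lebesgue_measure_affine// mul1e.
have [v [Vv Wv]] : (settled (e / 2) xs n `&` W) !=set0.
  apply/set0P/negP => /eqP SW0.
  have : (leb (settled (e / 2) xs n `|` W) <= 3%:E)%E.
    apply: (@le_trans _ _ (leb (`[0, 3] : set R))).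
      apply: le_measure; rewrite ?inE//.
        exact: measurableU.
      move=> u; rewrite /= in_itv/= => -[/(_ 0%N I)|/(_ 0%N I)] [] /=;
        rewrite /I02/= in_itv/= ?divr1; have := us01 n; lra.
    by rewrite lebesgue_measure_itv/= lte_fin ltr0n/= -EFinB subr0.
  rewrite measureU// leNgt => /negP; apply.
  apply: (@lt_trans _ _ ((7 / 4)%:E + (7 / 4)%:E)%E); last exact: lteD.
  rewrite -EFinD lte_fin; lra.
have [_ /= hv] := Vv 0%N I; have [_ /= hw] := Wv 0%N I.
have [_ _] := hxu n.
rewrite -/(xs n) -/(us n) -/(ys n) ltNge => /negP; apply.
move: hv hw; rewrite addn0 divr1 {1}/ys => hv.
rewrite (_ : xs n + us n + (v - us n) = xs n + v); last by ring.
rewrite -/(ys n) => hw.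
rewrite (_ : k (ys n) - k (xs n) =
  (k (xs n + v) - k (xs n)) - (k (xs n + v) - k (ys n))); last by ring.
by apply: le_trans (ler_normB _ _) _; lra.
Unshelve. all: by end_near. Qed.

End uniform_convergence.

(** * Uniform regular variation *)

Lemma near_pinftyP (R : realType) (P : R -> Prop) :
  (\forall x \near +oo, P x) <-> exists M, forall x, M < x -> P x.
Proof.
split=> [[M [_ hM]]|[M hM]]; first by exists M.
by exists M; split => //; exact: num_real.
Qed.

Lemma near_upward (R : realType) (P : R -> Prop) :
  (\forall x \near +oo, P x) -> \forall x \near +oo, forall y, x <= y -> P y.
Proof.
move=> /near_pinftyP[M hM]; apply/near_pinftyP; exists M => x Mx y xy.
by apply: hM; exact: lt_le_trans xy.
Qed.

(** Regular variation of index alpha, uniform on the ranges [x, e x] and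
    written on logarithms. In this form it is additive under products, scales
    under powers, and avoids limits that depend on a parameter. *)
Definition rvU (R : realType) (alpha : R) (f : R -> R) : Prop :=
  (\forall x \near +oo, 0 < f x) /\
  forall delta, 0 < delta -> \forall x \near +oo, forall y, x <= y ->
    ln y <= ln x + 1 -> `|ln (f y) - ln (f x) - alpha * (ln y - ln x)| <= delta.

Lemma cvgy_expR (R : realType) : expR x @[x --> +oo] --> (+oo : set_system R).
Proof.
apply/cvgryPge => M; near=> x; apply: (@le_trans _ _ (1 + x)); last exact: expR_ge1Dx.
by rewrite -lerBlDl; near: x; apply: nbhs_pinfty_ge; exact: num_real.
Unshelve. all: by end_near. Qed.

Section rvU_theory.
Context (R : realType).
Implicit Types (f g : R -> R) (alpha gamma : R).

(** In the variable ln x, the function ln f - alpha ln is slowly varying in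
    additive form, so that slow_uniform applies. *)
Lemma rvU_of_measurable (A alpha : R) f : measurable_fun `]A, +oo[ f ->
  (\forall x \near +oo, 0 < f x) -> regularly_varying alpha f -> rvU alpha f.
Proof.
move=> mf /near_pinftyP[M fM] rf.
pose B := Num.max 1 (Num.max A M).
have B0 : 0 < B by rewrite lt_max ltr01.
have Bf x : B < x -> 0 < f x.
  by rewrite !gt_max => /and3P[_ _ /fM].
pose k v := ln (f (expR v)) - alpha * v.
have Bexp v : ln B < v -> B < expR v.
  by move=> Bv; rewrite -(lnK B0) ltr_expR.
have mk : measurable_fun `]ln B, +oo[ k.
  apply: measurable_funB; last by apply: measurable_funM.
  apply: (measurableT_comp (f := @ln R)); first exact: measurable_ln.
  apply: (measurable_comp (F := `]A, +oo[%classic) (f := f) (g := @expR R)) => //.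
    move=> _ [v /= + <-]; rewrite !in_itv/= !andbT => /Bexp.
    by rewrite !gt_max => /and3P[].
  by apply: measurable_funS (@measurable_expR R).
have kslow u : k (x + u) - k x @[x --> +oo] --> 0.
  have c1 : f (expR u * expR x) / f (expR x) @[x --> +oo] --> expR u `^ alpha.
    by have := rf _ (expR_gt0 u); exact: (cvg_comp _ _ (@cvgy_expR R)).
  have c2 : ln (f (expR u * expR x) / f (expR x)) @[x --> +oo] --> ln (expR u `^ alpha).
    apply: continuous_cvg c1; apply: continuous_ln; rewrite powR_gt0 ?expR_gt0//.
  have c3 : ln (f (expR u * expR x) / f (expR x)) - alpha * u @[x --> +oo] --> 0.
    rewrite -[X in _ --> X](subrr (alpha * u)); apply: cvgB; last exact: cvg_cst.
    by move: c2; rewrite ln_powR expRK.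
  apply: cvg_trans c3; apply: near_eq_cvg; near=> x.
  have Bx : B < expR x by apply: Bexp; near: x; apply: nbhs_pinfty_gt; exact: num_real.
  have Bux : B < expR (x + u).
    apply: Bexp; rewrite -ltrBlDr; near: x; apply: nbhs_pinfty_gt; exact: num_real.
  rewrite /k -expRD (addrC u) ln_div ?posrE ?Bf//; ring.
have slow := slow_uniform mk kslow.
split; first by apply/near_pinftyP; exists M.
move=> delta d0; have /near_pinftyP[N hN] := slow delta d0.
apply/near_pinftyP; exists (Num.max B (expR N)) => x.
rewrite gt_max => /andP[Bx Nx] y xy yx.
have x0 : 0 < x by exact: lt_trans Bx.
have y0 : 0 < y by exact: lt_le_trans xy.
have Nlx : N < ln x by rewrite -ltr_expR lnK.
have := hN _ Nlx (ln y - ln x).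
rewrite /k (_ : ln x + (ln y - ln x) = ln y); last by ring.
rewrite !lnK//.
have lxy : ln x <= ln y by rewrite ler_ln.
rewrite subr_ge0 lxy lerBlDl yx => /(_ isT).
by apply: le_trans; rewrite le_eqVlt; apply/orP; left; apply/eqP; congr `|_|; ring.
Unshelve. all: by end_near. Qed.

Lemma rvU_gt0 alpha f : rvU alpha f -> \forall x \near +oo, 0 < f x.
Proof. by case. Qed.

Lemma rvU_eq alpha f g : (\forall x \near +oo, f x = g x) -> rvU alpha f -> rvU alpha g.
Proof.
move=> fg [f0 hf]; split; first by apply: filterS2 fg f0 => x ->.
move=> d d0; apply: filterS2 (near_upward fg) (hf d d0) => x fgx h y xy yx.
by rewrite -!fgx// h.
Qed.

Lemma rvU_id : rvU 1 (id : R -> R).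
Proof.
split; first exact: nbhs_pinfty_gt.
by move=> d d0; near=> x => y xy yx; rewrite mul1r subrr normr0 ltW.
Unshelve. all: by end_near. Qed.

Lemma rvU_mul alpha gamma f g : rvU alpha f -> rvU gamma g ->
  rvU (alpha + gamma) (fun x => f x * g x).
Proof.
move=> [f0 hf] [g0 hg]; split; first by apply: filterS2 f0 g0 => x; exact: mulr_gt0.
move=> d d0; have d20 : 0 < d / 2 by rewrite divr_gt0.
near=> x => y xy yx.
have fx : 0 < f x by near: x.
have gx : 0 < g x by near: x.
have fy : 0 < f y by clear yx; move: y xy; near: x; exact: near_upward.
have gy : 0 < g y by clear yx fy; move: y xy; near: x; exact: near_upward.
have h1 : `|ln (f y) - ln (f x) - alpha * (ln y - ln x)| <= d / 2.
  by clear fy gy; move: y xy yx; near: x; exact: hf.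
have h2 : `|ln (g y) - ln (g x) - gamma * (ln y - ln x)| <= d / 2.
  by clear fy gy h1; move: y xy yx; near: x; exact: hg.
rewrite !lnM//.
rewrite (_ : _ - _ = (ln (f y) - ln (f x) - alpha * (ln y - ln x)) +
   (ln (g y) - ln (g x) - gamma * (ln y - ln x))); last by ring.
by apply: le_trans (ler_normD _ _) _; lra.
Unshelve. all: by end_near. Qed.

Lemma rvU_powR alpha c f : rvU alpha f -> rvU (c * alpha) (fun x => f x `^ c).
Proof.
move=> [f0 hf]; split; first by apply: filterS f0 => x; exact: powR_gt0.
move=> d d0; have dc : 0 < d / (`|c| + 1) by rewrite divr_gt0// ltr_wpDl.
apply: filterS (hf _ dc) => x h y xy yx; rewrite !ln_powR.
rewrite (_ : _ - _ = c * (ln (f y) - ln (f x) - alpha * (ln y - ln x))); last by ring.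
rewrite normrM; apply: le_trans (ler_wpM2l (normr_ge0 _) (h _ xy yx)) _.
by rewrite mulrCA ler_piMr ?(ltW d0)// ler_pdivrMr ?ltr_wpDl// mul1r lerDl.
Qed.

Lemma rvU_inv alpha f : rvU alpha f -> rvU (- alpha) (fun x => (f x)^-1).
Proof.
move=> hf; rewrite -mulN1r; apply: rvU_eq (rvU_powR (-1) hf).
by apply: filterS (rvU_gt0 hf) => x /ltW; exact: powR_inv1.
Qed.

Lemma rvU_lim (c : R) f : 0 < c -> f x @[x --> +oo] --> c -> rvU 0 f.
Proof.
move=> c0 fc; split; first exact: (cvgr_gt _ fc).
have lc : ln (f x) @[x --> +oo] --> ln c.
  by apply: continuous_cvg fc; exact: continuous_ln.
move=> d d0; have d20 : 0 < d / 2 by rewrite divr_gt0.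
have /cvgrPdist_le/(_ _ d20) := lc => /near_upward; apply: filterS => x h y xy _.
rewrite mul0r subr0 (_ : _ - _ = (ln c - ln (f x)) - (ln c - ln (f y))); last by ring.
have := h x (lexx _); have := h y xy => h1 h2.
by apply: le_trans (ler_normB _ _) _; lra.
Qed.

(** The limit says that ln f - alpha ln has derivative o(1/x); the mean value
    theorem over [x, e x] then makes its increment small. *)
Lemma rvU_derive alpha f (df : R -> R) :
  (\forall x \near +oo, 0 < f x) ->
  (\forall x \near +oo, is_derive (x : R) 1 f (df x)) ->
  x * df x / f x @[x --> +oo] --> alpha -> rvU alpha f.
Proof.
move=> f0 hd hl; split=> // d d0.
have de : 0 < d / expR 1 by rewrite divr_gt0// expR_gt0.
have /cvgrPdist_le/(_ _ de) hl' := hl.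
have : \forall x \near +oo, [/\ 0 < x, 0 < f x, is_derive (x : R) 1 f (df x) &
    `|alpha - x * df x / f x| <= d / expR 1].
  by near=> x; split; near: x => //; exact: nbhs_pinfty_gt.
move=> /near_upward; apply: filterS => x h y xy yx.
have [x0 _ _ _] := h x (lexx _); have y0 := lt_le_trans x0 xy.
move: (xy); rewrite le_eqVlt => /predU1P[<-|xy'].
  by rewrite !subrr mulr0 subrr normr0 ltW.
pose F z := ln (f z) - alpha * ln z.
pose dF z := df z / f z - alpha * z^-1.
have Fd z : x <= z -> is_derive z 1 F (dF z).
  move=> xz; have [z0 fz hz _] := h z xz.
  refine (is_derive_eq (derB (der_ln fz hz) (derM (derC z alpha) (der_ln z0 (derI z)))) _).
  by rewrite /dF mul0r add0r /= mul1r.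
have [| |z zxy] := @MVT _ F dF x y xy'.
- by move=> z; rewrite in_itv/= => /andP[/ltW xz _]; exact: Fd.
- apply: derivable_within_continuous => z; rewrite in_itv/= => /andP[xz _].
  by have [] := Fd z xz.
move: zxy; rewrite in_itv/= => /andP[/ltW xz zy] E.
have [z0 fz _ hz] := h z xz.
rewrite (_ : _ - _ = F y - F x); last by rewrite /F; ring.
rewrite E (_ : dF z = - (alpha - z * df z / f z) / z); last first.
  by rewrite /dF; field; rewrite ?gt_eqF.
rewrite !mulNr -mulrA normrN normrM.
apply: (@le_trans _ _ (d / expR 1 * expR 1)); last by rewrite divfK ?gt_eqF ?expR_gt0.
apply: ler_pM => //.
rewrite ger0_norm; last by rewrite mulr_ge0 ?invr_ge0 ?subr_ge0 ?(ltW z0).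
apply: (@le_trans _ _ (y / x)).
  rewrite mulrC ler_pM ?invr_ge0 ?(ltW z0) ?subr_ge0//; first by rewrite lerBlDr lerDl ltW.
  by rewrite lef_pV2 ?posrE.
rewrite -[y / x]lnK ?posrE ?divr_gt0// ler_expR ln_div ?posrE//; lra.
Unshelve. all: by end_near. Qed.

Lemma expR_near1 (z d : R) : 0 < d <= 1 -> `|z| <= d / 2 -> `|expR z - 1| <= d.
Proof.
move=> /andP[d0 d1] zd.
have /andP[z1 z2] : - (d / 2) <= z <= d / 2 by rewrite -ler_norml.
rewrite ler_norml; apply/andP; split.
  by have := expR_ge1Dx z; lra.
have : expR z <= (1 - z)^-1.
  rewrite -[z in leLHS]opprK expRN lef_pV2 ?posrE ?expR_gt0//; first exact: expR_ge1Dx.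
  lra.
move=> /le_trans h; rewrite lerBlDr; apply: h.
rewrite -div1r ler_pdivrMr; last lra.
nra.
Qed.

(** The form in which uniformity is consumed: f is nearly constant over a
    window that is small relative to x. *)
Lemma rvU_uniform alpha f (e : R) : rvU alpha f -> 0 < e ->
  exists2 kappa, 0 < kappa <= 1 / 2 & \forall x \near +oo, forall y,
    `|y / x - 1| <= kappa -> `|f y / f x - 1| <= e.
Proof.
move=> [/near_pinftyP[M fM] hf] e0.
pose d := Num.min 1 e.
have d01 : 0 < d <= 1 by rewrite lt_min ltr01 e0 ge_min lexx.
have d0 : 0 < d by case/andP: d01.
have d1 : d <= 1 by case/andP: d01.
have d40 : 0 < d / 4 by rewrite divr_gt0.
have /near_pinftyP[N hN] := hf _ d40.
have a0 : 0 < `|alpha| + 1 by rewrite ltr_wpDl.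
(* y/x within kappa of 1 gives |ln y - ln x| <= 2 kappa, so that the term
   alpha (ln y - ln x) contributes at most d/4 *)
pose kappa := d / (`|alpha| + 1) / 8.
have k0 : 0 < kappa by rewrite !divr_gt0.
have kd : kappa <= d / 8.
  by rewrite /kappa ler_pM2r ?invr_gt0// ler_pdivrMr// ler_peMr ?(ltW d0)// lerDr.
have ka : kappa * `|alpha| <= d / 8.
  rewrite /kappa mulrAC ler_pM2r ?invr_gt0// mulrAC ler_pdivrMr// ler_wpM2l ?(ltW d0)//.
  by rewrite lerDl.
exists kappa; first by rewrite k0/=; lra.
apply/near_pinftyP; exists (2 * (1 + `|M| + `|N|)) => x Mx y yx.
have nM := ler_norm M; have nN := ler_norm N.
have nM0 := normr_ge0 M; have nN0 := normr_ge0 N.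
have x0 : 0 < x by lra.
have /andP[r1 r2] : - kappa <= y / x - 1 <= kappa by rewrite -ler_norml.
have r0 : 1 / 2 <= y / x by lra.
have xy2 : x / 2 <= y.
  by move: r0; rewrite ler_pdivlMr//; lra.
have y0 : 0 < y by lra.
have fx : 0 < f x by apply: fM; lra.
have fy : 0 < f y by apply: fM; lra.
have lr : `|ln y - ln x| <= 2 * kappa.
  rewrite -ln_div ?posrE//; set r := y / x in r0 r1 r2 *.
  have r00 : 0 < r by lra.
  have h1 : ln r <= r - 1.
    by rewrite lerBrDl; apply: le_trans (expR_ge1Dx _) _; rewrite lnK.
  have h2 : - ln r <= r^-1 - 1.
    by rewrite -lnV// lerBrDl; apply: le_trans (expR_ge1Dx _) _; rewrite lnK ?posrE ?invr_gt0.
  have h3 : r^-1 - 1 <= 2 * kappa.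
    rewrite lerBlDr -div1r ler_pdivrMr//; nra.
  rewrite ler_norml; lra.
have lyx : `|ln (f y) - ln (f x) - alpha * (ln y - ln x)| <= d / 4.
  have [xy|/ltW yx'] := leP x y.
    apply: hN => //; first lra.
    by move: lr; rewrite ler_norml; lra.
  rewrite (_ : _ - _ = - (ln (f x) - ln (f y) - alpha * (ln x - ln y))) ?normrN; last by ring.
  apply: hN => //; first lra.
  by move: lr; rewrite ler_norml; lra.
apply: (@le_trans _ _ d); last by rewrite ge_min lexx orbT.
rewrite -[f y / f x]lnK ?posrE ?divr_gt0// ln_div ?posrE//; apply: expR_near1 => //.
rewrite -(subrK (alpha * (ln y - ln x)) (ln (f y) - ln (f x))).
apply: le_trans (ler_normD _ _) _.
have : `|alpha * (ln y - ln x)| <= `|alpha| * (2 * kappa) by rewrite normrM ler_wpM2l.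
lra.
Qed.

(** Potter-type bound, by summing the increments over about ln x steps of
    ratio e, each contributing at most e/2. *)
Lemma rvU_potter alpha f (e : R) : rvU alpha f -> 0 < e ->
  \forall x \near +oo, `|ln (f x) - alpha * ln x| <= e * ln x.
Proof.
move=> [f0 hf] e0; have e20 : 0 < e / 2 by rewrite divr_gt0.
have /near_pinftyP[M hM] := hf _ e20.
pose X := Num.max 1 (M + 1).
have X0 : 0 < X by rewrite lt_max ltr01.
have MX : M < X by rewrite lt_max; apply/orP; right; lra.
pose L x := ln (f x) - alpha * ln x.
have LL x y : X <= x -> x <= y -> ln y <= ln x + 1 -> `|L y - L x| <= e / 2.
  move=> Xx xy yx; have := hM x (lt_le_trans MX Xx) y xy yx.
  by rewrite (_ : _ - _ = L y - L x)//; rewrite /L; ring.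
have Ln n y : X <= y -> ln y <= ln X + n%:R -> `|L y - L X| <= n%:R * (e / 2).
  elim: n y => [|n IH] y Xy yn.
    rewrite mul0r (_ : y = X) ?subrr ?normr0//; apply/eqP.
    by rewrite eq_le Xy andbT -ler_ln ?posrE ?(lt_le_trans X0)//; rewrite addr0 in yn.
  have y0 := lt_le_trans X0 Xy.
  pose z := Num.max X (y / expR 1).
  have ye0 : 0 < y / expR 1 by rewrite divr_gt0 ?expR_gt0.
  have Xz : X <= z by rewrite le_max lexx.
  have lye : ln (y / expR 1) = ln y - 1 by rewrite ln_div ?posrE ?expR_gt0// expRK.
  have zy : z <= y.
    rewrite ge_max Xy/= ler_pdivrMr ?expR_gt0// ler_peMr ?(ltW y0)//.
    by apply: le_trans (expR_ge1Dx 1); lra.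
  have z0 := lt_le_trans X0 Xz.
  have yz : ln y <= ln z + 1.
    by rewrite -lerBlDr -lye ler_ln ?posrE// le_max lexx orbT.
  have zn : ln z <= ln X + n%:R.
    rewrite /z maxEle; case: ifP => _; last by rewrite lerDl.
    by rewrite lye; move: yn; rewrite -natr1; lra.
  have h1 := IH z Xz zn; have h2 := LL z y Xz zy yz.
  rewrite (_ : L y - L X = (L z - L X) + (L y - L z)); last by ring.
  by apply: le_trans (ler_normD _ _) _; rewrite -natr1; lra.
near=> x.
have Xx : X <= x by near: x; apply: nbhs_pinfty_ge; exact: num_real.
have x0 := lt_le_trans X0 Xx.
have lXx : ln X <= ln x by rewrite ler_ln.
have lX0 : 0 <= ln X by apply: ln_ge0; rewrite le_max lexx.
have [] := andP (truncn_itv (_ : 0 <= ln x - ln X)); first by rewrite subr_ge0.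
set n := Num.truncn _ => n1 n2.
have := Ln n.+1 x Xx; rewrite -/(L x).
have big : (2 / e) * (`|L X| + e) <= ln x.
  rewrite -ler_expR (lnK x0); near: x.
  by apply: nbhs_pinfty_ge; exact: num_real.
have {}big : `|L X| + e <= e / 2 * ln x.
  have := ler_wpM2l (ltW e20) big.
  by rewrite mulrA (_ : e / 2 * (2 / e) = 1) ?mul1r//; field; rewrite gt_eqF.
have h2 : ln x <= ln X + n.+1%:R by lra.
move=> /(_ h2); rewrite -natr1 => h3.
rewrite -(subrK (L X) (L x)); apply: le_trans (ler_normD _ _) _.
have : n%:R * (e / 2) <= (ln x - ln X) * (e / 2) by rewrite ler_wpM2r// ltW.
have : 0 <= ln X * e by rewrite mulr_ge0// ltW.
lra.
Unshelve. all: by end_near. Qed.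

End rvU_theory.

(** * Expansion of the exponent at the mode *)

(** Applied repeatedly from the highest derivative down, this gives Taylor
    estimates of any order. The factor 1/(n+1) is lost, which does not matter
    because the constants are absorbed. *)
Lemma mvt_le (R : realType) (F dF : R -> R) (x0 r C : R) (n : nat) :
  (forall x, `|x - x0| <= r -> is_derive x 1 F (dF x)) -> F x0 = 0 -> 0 <= C ->
  (forall x, `|x - x0| <= r -> `|dF x| <= C * `|x - x0| ^+ n) ->
  forall x, `|x - x0| <= r -> `|F x| <= C * `|x - x0| ^+ n.+1.
Proof.
move=> dFF F0 C0 hdF x xr.
have cw (a b : R) : (forall z, a <= z -> z <= b -> `|z - x0| <= r) -> {within `[a, b], continuous F}.
  move=> hab; apply: derivable_within_continuous => z; rewrite in_itv/= => /andP[az zb].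
  by have [] := dFF z (hab z az zb).
suff [c cx E] : exists2 c, `|c - x0| <= `|x - x0| & F x = dF c * (x - x0).
  rewrite E normrM exprSr mulrA ler_wpM2r//.
  apply: le_trans (hdF c (le_trans cx xr)) _.
  by rewrite ler_wpM2l// lerXn2r ?nnegrE.
have [x0x|xx0|x0x] := ltgtP x0 x.
- have hz z : x0 <= z -> z <= x -> `|z - x0| <= `|x - x0|.
    by move=> h1 h2; rewrite !ger0_norm ?subr_ge0 ?(ltW x0x)// lerD2r.
  have [| |c] := @MVT _ F dF x0 x x0x.
  + by move=> z; rewrite in_itv/= => /andP[/ltW a /ltW b]; apply/dFF/(le_trans (hz _ a b)).
  + by apply: cw => z a b; apply/(le_trans (hz _ a b)).
  + rewrite in_itv/= => /andP[/ltW a /ltW b]; rewrite F0 subr0 => ->.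
    by exists c => //; exact: hz.
- have hz z : x <= z -> z <= x0 -> `|z - x0| <= `|x - x0|.
    by move=> h1 h2; rewrite !ler0_norm ?subr_le0 ?(ltW xx0)// lerN2 lerD2r.
  have [| |c] := @MVT _ F dF x x0 xx0.
  + by move=> z; rewrite in_itv/= => /andP[/ltW a /ltW b]; apply/dFF/(le_trans (hz _ a b)).
  + by apply: cw => z a b; apply/(le_trans (hz _ a b)).
  + rewrite in_itv/= => /andP[/ltW a /ltW b]; rewrite F0 sub0r => E.
    by exists c; [exact: hz|rewrite -[F x]opprK E -mulrN opprB].
- by exists x; rewrite ?lexx// -x0x F0 subrr mulr0.
Qed.

Lemma expR_taylor1 (R : realType) (s : R) :
  `|expR s - 1 - s| <= s ^+ 2 * expR `|s|.
Proof.
have h1 := expR_ge1Dx s.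
have h2 : expR s - 1 <= s * expR s.
  have := expR_ge1Dx (- s); rewrite expRN -(ler_pM2l (expR_gt0 s)).
  by rewrite divff ?gt_eqF ?expR_gt0//; lra.
rewrite ger0_norm; last by lra.
have [s0|/ltW s0] := leP 0 s.
  by rewrite (ger0_norm s0); nra.
apply: (@le_trans _ _ (s ^+ 2)); first by nra.
by rewrite ler_peMr ?sqr_ge0// -expR0 ler_expR.
Qed.

(** What the tilted density must satisfy at its mode xh, where h xh = t, for
    the expansion to hold with relative precision delta. The unit of length
    is sigma = h'(xh)^(-1/2), and a = h''(xh) sigma^3 is the skewness
    coefficient. On a window of U units, h', h'' and q are controlled, and it
    stays to the right of 2, away from the negative half-line. The remaining
    fields say that the mass beyond U units, of order exp(-U), is negligible
    with respect to a, which may itself be very small; the extra factor sigma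
    is needed on the negative half-line, where the majorant is sigma p(x). *)
Record local_gaussian (R : realType) (g h h1 h2 q : R -> R) (delta t xh sigma a U : R) : Prop := {
  lg_sigma : 0 < sigma;
  lg_h : h xh = t;
  lg_h1 : h1 xh = sigma ^- 2;
  lg_h2 : h2 xh = a / sigma ^+ 3;
  lg_a0 : a != 0;
  lg_a : `|a| <= delta;
  lg_U : delta^-1 <= U;
  lg_expU : expR (- U) <= delta * `|a|;
  lg_expUs : expR (- U) <= delta * `|a| * sigma;
  lg_win : forall x, `|x - xh| <= U * sigma ->
    [/\ 2 <= x, `|h1 x - h1 xh| <= delta * h1 xh,
        `|h2 x - h2 xh| <= delta * `|h2 xh| & `|q x| <= delta * `|a|] }.

Section local_expansion.
Context (R : realType) (g h h1 h2 q : R -> R).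
Hypothesis dg : forall x : R, 0 < x -> is_derive x 1 g (h x).
Hypothesis dh : forall x : R, 0 < x -> is_derive x 1 h (h1 x).
Hypothesis dh1 : forall x : R, 0 < x -> is_derive x 1 h1 (h2 x).
Hypothesis h_gt0 : forall x, 0 < x -> 0 < h x.
Hypothesis h_homo : forall x y : R, 0 < x -> x <= y -> h x <= h y.

(** Convexity of g in the form of a tangent inequality, from the monotonicity
    of its derivative h. *)
Lemma tangent_le x y : 0 < x -> 0 < y -> g x + h x * (y - x) <= g y.
Proof.
move=> x0 y0; have cw (a b : R) : 0 < a -> {within `[a, b], continuous g}.
  move=> a0; apply: derivable_within_continuous => z; rewrite in_itv/= => /andP[az _].
  by have [] := dg (lt_le_trans a0 az).
have [xy|yx|->] := ltgtP x y; last by rewrite subrr mulr0 addr0.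
  have [| |c] := @MVT _ g h x y xy; last 1 first.
  - rewrite in_itv/= => /andP[xc cy] E.
    rewrite -lerBrDl E ler_wpM2r ?subr_ge0 ?(ltW xy)//.
    by apply: h_homo => //; exact: ltW.
  - by move=> z; rewrite in_itv/= => /andP[xz _]; apply: dg; exact: lt_trans xz.
  - exact: cw.
have [| |c] := @MVT _ g h y x yx; last 1 first.
- rewrite in_itv/= => /andP[yc cx] E.
  have hc : h c <= h x by apply: h_homo; [exact: lt_trans yc|exact: ltW].
  have : h c * (x - y) <= h x * (x - y) by rewrite ler_wpM2r// subr_ge0 ltW.
  lra.
- by move=> z; rewrite in_itv/= => /andP[xz _]; apply: dg; exact: lt_trans xz.
- exact: cw.
Qed.

Context (delta t xh sigma a U : R).
Hypothesis delta01 : 0 < delta <= 1 / 16.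
Hypothesis lg : local_gaussian g h h1 h2 q delta t xh sigma a U.

Let s0 : 0 < sigma := lg_sigma lg.
Let u x := (x - xh) / sigma.
Let K x := t * x - (t * xh - g xh) - g x.

Let d0 : 0 < delta. Proof. by case/andP: delta01. Qed.

Lemma lg_U16 : 16 <= U.
Proof.
apply: le_trans (lg_U lg); case/andP: delta01 => _ d16.
rewrite -[leLHS]invrK lef_pV2 ?posrE ?invr_gt0//; lra.
Qed.

Let win_gt0 x : `|x - xh| <= U * sigma -> 0 < x.
Proof. by move=> /(lg_win lg)[x2 _ _ _]; lra. Qed.

Let dK (x : R) : 0 < x -> is_derive x 1 K (t - h x).
Proof.
move=> x0.
refine (is_derive_eq (derB (derB (derM (derC x t) (derI x)) (derC x (t * xh - g xh))) (dg x0)) _).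
by rewrite /=; ring.
Qed.

(** Rough expansion of the exponent, from near constancy of h'. It provides
    Gaussian decay over the whole window, where a u^3 need not be small. *)
Lemma window_expansion2 x : `|x - xh| <= U * sigma ->
  `|K x + u x ^+ 2 / 2| <= delta * u x ^+ 2.
Proof.
move=> xw.
have d2 (y : R) : is_derive y 1 (fun x => (x - xh) ^+ 2 / 2 * sigma ^- 2)
    ((y - xh) * sigma ^- 2).
  refine (is_derive_eq (derM (derM (derX 2 (derB (derI y) (derC y xh))) (derC y 2^-1)) (derC y (sigma ^- 2))) _).
  by rewrite /=; field; rewrite gt_eqF.
have h1xh := lg_h1 lg.
have s20 : 0 < sigma ^- 2 by rewrite invr_gt0 exprn_gt0.
have c0 : 0 <= delta * sigma ^- 2 by rewrite mulr_ge0 ?ltW.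
have e1 := @mvt_le R (fun y => t - h y + (y - xh) * sigma ^- 2)
  (fun y => - h1 y + sigma ^- 2) xh (U * sigma) (delta * sigma ^- 2) 0.
have {}e1 : forall y : R, `|y - xh| <= U * sigma ->
    `|t - h y + (y - xh) * sigma ^- 2| <= delta * sigma ^- 2 * `|y - xh| ^+ 1.
  apply: (e1 _ _ c0).
  - move=> y yw.
    refine (is_derive_eq (derD (derB (derC y t) (dh (win_gt0 yw)))
      (derM (derB (derI y) (derC y xh)) (derC y (sigma ^- 2)))) _).
    by rewrite /=; ring.
  - by rewrite (lg_h lg) !subrr mul0r addr0.
  - move=> y yw; have [_ hy _ _] := lg_win lg yw.
    by rewrite expr0 mulr1 addrC -normrN opprB -h1xh.
have e2 := @mvt_le R (fun y => K y + (y - xh) ^+ 2 / 2 * sigma ^- 2)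
  (fun y => t - h y + (y - xh) * sigma ^- 2) xh (U * sigma) (delta * sigma ^- 2) 1.
have {}e2 : forall y : R, `|y - xh| <= U * sigma ->
    `|K y + (y - xh) ^+ 2 / 2 * sigma ^- 2| <= delta * sigma ^- 2 * `|y - xh| ^+ 2.
  apply: (e2 _ _ c0 e1).
  - by move=> y yw; exact: (derD (dK (win_gt0 yw)) (d2 y)).
  - by rewrite /K !subrr expr0n/= !mul0r addr0; ring.
have -> : u x ^+ 2 = (x - xh) ^+ 2 * sigma ^- 2 by rewrite /u expr_div_n.
rewrite (_ : _ / 2 = (x - xh) ^+ 2 / 2 * sigma ^- 2); last by ring.
rewrite (_ : delta * _ = delta * sigma ^- 2 * `|x - xh| ^+ 2); first exact: e2.
by rewrite real_normK ?num_real//; ring.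
Qed.

(** Fine expansion of the exponent, from near constancy of h'' integrated three
    times; the remainder is proportional to a, as required. *)
Lemma window_expansion3 x : `|x - xh| <= U * sigma ->
  `|K x + u x ^+ 2 / 2 + a * u x ^+ 3 / 6| <= delta * `|a| * `|u x| ^+ 3.
Proof.
move=> xw.
have h1xh := lg_h1 lg; have h2xh := lg_h2 lg.
have s20 : 0 < sigma ^- 2 by rewrite invr_gt0 exprn_gt0.
pose A := a / sigma ^+ 3.
have d2 (y : R) : is_derive y 1 (fun x => (x - xh) ^+ 2 / 2) (y - xh).
  refine (is_derive_eq (derM (derX 2 (derB (derI y) (derC y xh))) (derC y 2^-1)) _).
  by rewrite /=; field.
have d3 (y : R) : is_derive y 1 (fun x => (x - xh) ^+ 3 / 6) ((y - xh) ^+ 2 / 2).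
  refine (is_derive_eq (derM (derX 3 (derB (derI y) (derC y xh))) (derC y 6^-1)) _).
  by rewrite /=; field.
have d1 (y : R) : is_derive y 1 (fun x => x - xh) 1.
  by refine (is_derive_eq (derB (derI y) (derC y xh)) _); rewrite subr0.
have c0 : 0 <= delta * `|A| by rewrite mulr_ge0 ?(ltW d0).
have e1 := @mvt_le R (fun y => - h1 y + sigma ^- 2 + A * (y - xh))
  (fun y => - h2 y + A) xh (U * sigma) (delta * `|A|) 0.
have {}e1 : forall y : R, `|y - xh| <= U * sigma ->
    `|- h1 y + sigma ^- 2 + A * (y - xh)| <= delta * `|A| * `|y - xh| ^+ 1.
  apply: (e1 _ _ c0).
  - move=> y yw.
    refine (is_derive_eq (derD (derD (derN (dh1 (win_gt0 yw))) (derC y (sigma ^- 2)))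
      (derM (derC y A) (d1 y))) _).
    by rewrite /=; ring.
  - by rewrite h1xh subrr mulr0 addr0 addNr.
  - move=> y yw; have [_ _ hy _] := lg_win lg yw.
    by rewrite expr0 mulr1 addrC -normrN opprB /A -h2xh.
have e2 := @mvt_le R (fun y => t - h y + sigma ^- 2 * (y - xh) + A * ((y - xh) ^+ 2 / 2))
  (fun y => - h1 y + sigma ^- 2 + A * (y - xh)) xh (U * sigma) (delta * `|A|) 1.
have {}e2 : forall y : R, `|y - xh| <= U * sigma ->
    `|t - h y + sigma ^- 2 * (y - xh) + A * ((y - xh) ^+ 2 / 2)|
    <= delta * `|A| * `|y - xh| ^+ 2.
  apply: (e2 _ _ c0 e1).
  - move=> y yw.
    refine (is_derive_eq (derD (derD (derB (derC y t) (dh (win_gt0 yw)))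
      (derM (derC y (sigma ^- 2)) (d1 y))) (derM (derC y A) (d2 y))) _).
    by rewrite /=; ring.
  - by rewrite (lg_h lg) !subrr expr0n/= !(mul0r, mulr0) !addr0.
have e3 := @mvt_le R (fun y => K y + sigma ^- 2 * ((y - xh) ^+ 2 / 2) + A * ((y - xh) ^+ 3 / 6))
  (fun y => t - h y + sigma ^- 2 * (y - xh) + A * ((y - xh) ^+ 2 / 2)) xh (U * sigma) (delta * `|A|) 2.
have {}e3 : forall y : R, `|y - xh| <= U * sigma ->
    `|K y + sigma ^- 2 * ((y - xh) ^+ 2 / 2) + A * ((y - xh) ^+ 3 / 6)|
    <= delta * `|A| * `|y - xh| ^+ 3.
  apply: (e3 _ _ c0 e2).
  - move=> y yw.
    refine (is_derive_eq (derD (derD (dK (win_gt0 yw))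
      (derM (derC y (sigma ^- 2)) (d2 y))) (derM (derC y A) (d3 y))) _).
    by rewrite /=; ring.
  - by rewrite /K !subrr !expr0n/= !(mul0r, mulr0) !addr0; ring.
have E2 : u x ^+ 2 / 2 = sigma ^- 2 * ((x - xh) ^+ 2 / 2) by rewrite /u expr_div_n; ring.
have E3 : a * u x ^+ 3 / 6 = A * ((x - xh) ^+ 3 / 6) by rewrite /u /A expr_div_n; ring.
have E : delta * `|a| * `|u x| ^+ 3 = delta * `|A| * `|x - xh| ^+ 3.
  rewrite /u /A !normrM !normfV normrX (gtr0_norm s0) expr_div_n; ring.
by rewrite E2 E3 E; exact: e3.
Qed.

(** K is concave and vanishes at the mode. At the edge of the window it has
    already dropped by U^2/4, hence the tangent there has slope at least
    U/(4 sigma) in absolute value, and beyond the edge K lies below it. *)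
Let K_le_edge x : `|x - xh| = U * sigma -> K x <= - (U ^+ 2 / 4).
Proof.
move=> xe; have xw : `|x - xh| <= U * sigma by rewrite xe.
have := window_expansion2 xw.
have -> : u x ^+ 2 = U ^+ 2.
  by rewrite /u expr_div_n -real_normK ?num_real// xe exprMn mulfK// expf_neq0// gt_eqF.
rewrite ler_norml => /andP[_]; case/andP: delta01 => _ d16.
by have := sqr_ge0 U; nra.
Qed.

Let K_tangent x z : 0 < x -> 0 < z -> K z <= K x + (t - h x) * (z - x).
Proof. by move=> x0 z0; have := tangent_le x0 z0; rewrite /K; lra. Qed.

Let Kxh : K xh = 0. Proof. by rewrite /K; ring. Qed.

Let Us0 : 0 < U * sigma.
Proof. by rewrite mulr_gt0//; have := lg_U16; lra. Qed.

Let xh_gt0 : 0 < xh.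
Proof. by apply: win_gt0; rewrite subrr normr0 ltW. Qed.

Let edge_l : `|xh - U * sigma - xh| = U * sigma.
Proof. by rewrite addrAC subrr sub0r normrN gtr0_norm. Qed.

Let edge_r : `|xh + U * sigma - xh| = U * sigma.
Proof. by rewrite addrAC subrr add0r gtr0_norm. Qed.

Let slope_l : U / (4 * sigma) <= t - h (xh - U * sigma).
Proof.
have Kl := K_le_edge edge_l.
have l0 : 0 < xh - U * sigma by apply: win_gt0; rewrite edge_l.
have := K_tangent l0 xh_gt0; rewrite Kxh opprB addrCA subrr addr0 => h0.
have : U ^+ 2 / 4 <= (t - h (xh - U * sigma)) * (U * sigma) by lra.
rewrite -ler_pdivrMr//; apply: le_trans; rewrite le_eqVlt; apply/orP; left; apply/eqP.
by field; rewrite !gt_eqF//; have := lg_U16; lra.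
Qed.

Let slope_r : t - h (xh + U * sigma) <= - (U / (4 * sigma)).
Proof.
have Kr := K_le_edge edge_r.
have r0 : 0 < xh + U * sigma by apply: win_gt0; rewrite edge_r.
have := K_tangent r0 xh_gt0; rewrite Kxh opprD addrA subrr sub0r => h0.
have : (t - h (xh + U * sigma)) * (U * sigma) <= - (U ^+ 2 / 4) by lra.
rewrite -ler_pdivlMr//; move=> hle; apply: (le_trans hle).
rewrite le_eqVlt; apply/orP; left; apply/eqP.
by field; rewrite !gt_eqF//; have := lg_U16; lra.
Qed.

(** Beyond the window the concave exponent lies below its tangent at the edge,
    so that the decay is exponential at a rate proportional to U. *)
Lemma tail_decay x : 0 < x -> U * sigma <= `|x - xh| -> K x <= - (U * `|u x| / 4).
Proof.
move=> x0 xw.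
have nu : `|u x| = `|x - xh| / sigma by rewrite /u normrM normfV (gtr0_norm s0).
have U0 : 0 < U by have := lg_U16; lra.
have [xh_x|x_xh] := leP xh x.
- have E : `|x - xh| = x - xh by rewrite ger0_norm ?subr_ge0.
  have Kr := K_le_edge edge_r.
  have r0 : 0 < xh + U * sigma by apply: win_gt0; rewrite edge_r.
  have h0 := K_tangent r0 x0.
  have xe : 0 <= x - (xh + U * sigma) by rewrite E in xw; lra.
  have h3 := ler_wpM2r xe slope_r.
  rewrite nu E; apply: le_trans h0 _.
  apply: (@le_trans _ _ (- (U ^+ 2 / 4) + - (U / (4 * sigma)) * (x - (xh + U * sigma)))).
    exact: lerD.
  rewrite le_eqVlt; apply/orP; left; apply/eqP.
  by field; rewrite gt_eqF.
- have E : `|x - xh| = xh - x by rewrite ltr0_norm ?subr_lt0// opprB.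
  have Kl := K_le_edge edge_l.
  have l0 : 0 < xh - U * sigma by apply: win_gt0; rewrite edge_l.
  have h0 := K_tangent l0 x0.
  have xe : x - (xh - U * sigma) <= 0 by rewrite E in xw; lra.
  have h3 := ler_wnM2r xe slope_l.
  rewrite nu E; apply: le_trans h0 _.
  apply: (@le_trans _ _ (- (U ^+ 2 / 4) + (U / (4 * sigma)) * (x - (xh - U * sigma)))).
    exact: lerD.
  rewrite le_eqVlt; apply/orP; left; apply/eqP.
  by field; rewrite gt_eqF.
Qed.

(** A lower bound on t is needed because on the negative half-line the factor
    exp(t x) is the only source of decay. *)
Lemma tilt_ge : U / (4 * sigma) <= t.
Proof.
have l0 : 0 < xh - U * sigma by apply: win_gt0; rewrite edge_l.
by have := slope_l; have := h_gt0 l0; lra.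
Qed.

Lemma window_left_of x : x <= 1 -> U * sigma < `|x - xh|.
Proof.
move=> x1; rewrite ltNge; apply/negP => /(lg_win lg)[]; lra.
Qed.

(** The value of the exponent at the mode dominates its value at 1, a point
    outside the window; this controls the normalization exp(-(t xh - g xh))
    on the negative half-line. *)
Lemma legendre_ge : - (t * xh - g xh) <= g 1 - U * ((xh - 1) / sigma) / 4.
Proof.
have x1 := window_left_of (lexx 1).
have := tail_decay ltr01 (ltW x1).
have xh2 : 2 <= xh by have [] := lg_win lg (_ : `|xh - xh| <= _); rewrite ?subrr ?normr0 ?(ltW Us0).
have nu : `|u 1| = (xh - 1) / sigma.
  rewrite /u normrM normfV (gtr0_norm s0) ltr0_norm ?opprB// subr_lt0; lra.
have t0 : 0 <= t by rewrite -(lg_h lg); apply/ltW/h_gt0.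
by rewrite nu /K; lra.
Qed.

End local_expansion.

(** * Pointwise comparison with the Edgeworth weight *)

Section pointwise.
Context (R : realType) (g h h1 h2 q p : R -> R) (Q : R).
Hypothesis dg : forall x : R, 0 < x -> is_derive x 1 g (h x).
Hypothesis dh : forall x : R, 0 < x -> is_derive x 1 h (h1 x).
Hypothesis dh1 : forall x : R, 0 < x -> is_derive x 1 h1 (h2 x).
Hypothesis h_gt0 : forall x, 0 < x -> 0 < h x.
Hypothesis h_homo : forall x y : R, 0 < x -> x <= y -> h x <= h y.
Hypothesis pE : forall x, 0 < x -> p x = expR (- (g x - q x)).
Hypothesis p_ge0 : forall x, 0 <= p x.
Hypothesis qQ : forall x, 0 < x -> `|q x| <= Q.

(** The tilted density up to a factor that depends on t only: the exponent is
    shifted so that it vanishes at the mode when q does. *)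
Definition rel_weight (t xh x : R) : R := expR (t * x - (t * xh - g xh)) * p x.

(** First Edgeworth correction of the Gaussian weight; the skewness is -a. *)
Definition edgeworth (a u : R) : R := gauss_weight u * (1 - a * u ^+ 3 / 6).

Lemma rel_weight_pos t xh x : 0 < x ->
  rel_weight t xh x = expR (t * x - (t * xh - g xh) - g x + q x).
Proof. by move=> x0; rewrite /rel_weight pE// -expRD; congr expR; ring. Qed.

Lemma sum_pow3_le (y : R) : 0 <= y -> 1 + y ^+ 3 <= (1 + y) ^+ 3.
Proof. by move=> y0; have := exprn_ge0 2 y0; nra. Qed.

(** In the window rel_weight = phi(u) exp(s) with s = - a u^3/6 + O(delta a) up
    to polynomial factors, and exp(s) - 1 - s is of order
    a^2 <= delta |a|. The crude bound |s| <= u^2/8 + 1 lets phi absorb the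
    remaining exponential. *)
Lemma window_bound k : exists2 C, 0 < C & forall delta t xh sigma a U,
  0 < delta <= 1 / 16 -> local_gaussian g h h1 h2 q delta t xh sigma a U ->
  forall x, `|x - xh| <= U * sigma ->
  `|(x - xh) / sigma| ^+ k * `|rel_weight t xh x - edgeworth a ((x - xh) / sigma)|
  <= C * (delta * `|a|) * (oneDsqr ((x - xh) / sigma))^-1.
Proof.
have [C C0 hC] := @poly_expR_le_cauchy R (k + 6) 1 ltr01.
exists ((expR 1 + 1) * expR 1 * C) => [|delta t xh sigma a U d16 lg x xw].
  by rewrite !mulr_gt0 ?addr_gt0 ?expR_gt0.
have x0 : 0 < x by have [x2 _ _ _] := lg_win lg xw; lra.
have [d0 d1] := andP d16.
have K2 := window_expansion2 dg dh d16 lg xw.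
have K3 := window_expansion3 dg dh dh1 d16 lg xw.
have [_ _ _ qx] := lg_win lg xw.
have aD := lg_a lg.
set u := (x - xh) / sigma in K2 K3 *; rewrite rel_weight_pos//.
set K := t * x - (t * xh - g xh) - g x in K2 K3 *.
set y := `|u|.
have y0 : 0 <= y by exact: normr_ge0.
have u2 : u ^+ 2 = y ^+ 2 by rewrite real_normK ?num_real.
pose s := K + u ^+ 2 / 2 + q x.
have a0 : 0 <= `|a| by exact: normr_ge0.
have y30 : 0 <= y ^+ 3 by rewrite exprn_ge0.
have s3 : `|s + a * u ^+ 3 / 6| <= delta * `|a| * (1 + y ^+ 3).
  rewrite /s (_ : _ + _ = (K + u ^+ 2 / 2 + a * u ^+ 3 / 6) + q x); last by ring.
  apply: le_trans (ler_normD _ _) _; rewrite mulrDr mulr1 addrC lerD//.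
have s1 : `|s| <= `|a| * (1 + y ^+ 3).
  rewrite (_ : s = (s + a * u ^+ 3 / 6) - a * u ^+ 3 / 6); last by ring.
  apply: le_trans (ler_normB _ _) _.
  have -> : `|a * u ^+ 3 / 6| = `|a| * y ^+ 3 / 6.
    by rewrite 2!normrM normrX normfV normr_nat.
  have : delta * (`|a| * (1 + y ^+ 3)) <= 1 / 16 * (`|a| * (1 + y ^+ 3)).
    by rewrite ler_wpM2r// mulr_ge0// addr_ge0.
  have : 0 <= `|a| * y ^+ 3 by rewrite mulr_ge0.
  lra.
have s2 : `|s| <= y ^+ 2 / 8 + 1.
  apply: le_trans (ler_normD _ _) _; apply: lerD.
    apply: le_trans K2 _; rewrite u2.
    by have := sqr_ge0 y; nra.
  apply: le_trans qx _; nra.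
have e1 : `|expR s - 1 + a * u ^+ 3 / 6| <=
    delta * `|a| * ((1 + y) ^+ 6 * (expR (y ^+ 2 / 8) * (expR 1 + 1))).
  rewrite (_ : _ + _ = (expR s - 1 - s) + (s + a * u ^+ 3 / 6)); last by ring.
  apply: le_trans (ler_normD _ _) _.
  have t1 : `|expR s - 1 - s| <= delta * `|a| * ((1 + y) ^+ 6 * (expR (y ^+ 2 / 8) * expR 1)).
    apply: le_trans (expR_taylor1 s) _; rewrite -expRD mulrA; apply: ler_pM.
    - exact: sqr_ge0.
    - exact: expR_ge0.
    - rewrite -(real_normK (num_real s)).
      apply: (@le_trans _ _ ((`|a| * (1 + y ^+ 3)) ^+ 2)).
        by rewrite lerXn2r ?nnegrE// mulr_ge0// addr_ge0.
      rewrite exprMn; apply: ler_pM; rewrite ?sqr_ge0//.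
        by rewrite expr2 ler_wpM2r.
      rewrite -[6%N]/(3 * 2)%N exprM lerXn2r ?nnegrE ?exprn_ge0 ?addr_ge0//.
      exact: sum_pow3_le.
    - by rewrite ler_expR.
  have t2 : delta * `|a| * (1 + y ^+ 3) <= delta * `|a| * ((1 + y) ^+ 6 * expR (y ^+ 2 / 8)).
    apply: ler_wpM2l; first by rewrite mulr_ge0 ?(ltW d0).
    apply: (@le_trans _ _ ((1 + y) ^+ 6)).
      apply: le_trans (sum_pow3_le y0) _; rewrite ler_weXn2l// lerDl//.
    rewrite ler_peMr ?exprn_ge0 ?addr_ge0// -expR0 ler_expR.
    by rewrite divr_ge0 ?sqr_ge0.
  apply: le_trans (lerD t1 (le_trans s3 t2)) _.
  by rewrite le_eqVlt; apply/orP; left; apply/eqP; ring.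
have -> : expR (K + q x) - edgeworth a u = gauss_weight u * (expR s - 1 + a * u ^+ 3 / 6).
  have -> : expR (K + q x) = gauss_weight u * expR s.
    by rewrite /gauss_weight -expRD; congr expR; rewrite /s; ring.
  by rewrite /edgeworth; ring.
rewrite normrM (ger0_norm (gauss_weight_ge0 u)).
apply: (@le_trans _ _ (y ^+ k * (gauss_weight u * (delta * `|a| *
   ((1 + y) ^+ 6 * (expR (y ^+ 2 / 8) * (expR 1 + 1))))))).
  by rewrite ler_wpM2l ?exprn_ge0// ler_wpM2l ?gauss_weight_ge0.
have ge : gauss_weight u * expR (y ^+ 2 / 8) <= expR 1 * expR (- (1 * y)).
  rewrite /gauss_weight -!expRD ler_expR u2.
  by have := sqr_ge0 (3 * y - 4); lra.
have yk : y ^+ k <= (1 + y) ^+ k by rewrite lerXn2r ?nnegrE ?addr_ge0// lerDr.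
rewrite [leLHS](_ : _ = (delta * `|a| * (expR 1 + 1)) *
   (y ^+ k * (1 + y) ^+ 6 * (gauss_weight u * expR (y ^+ 2 / 8)))); last by ring.
rewrite [leRHS](_ : _ = (delta * `|a| * (expR 1 + 1)) * (expR 1 * (C * (oneDsqr u)^-1))); last by ring.
apply: ler_wpM2l; first by rewrite !mulr_ge0 ?(ltW d0)// addr_ge0 ?expR_ge0.
apply: (@le_trans _ _ ((1 + y) ^+ (k + 6) * (expR 1 * expR (- (1 * y))))).
  apply: ler_pM => //.
  - by rewrite mulr_ge0 ?exprn_ge0 ?addr_ge0.
  - by rewrite mulr_ge0 ?expR_ge0.
  - by rewrite exprD ler_wpM2r ?exprn_ge0 ?addr_ge0.
by rewrite mulrCA ler_wpM2l ?expR_ge0//; exact: hC.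
Qed.

(** At |u| >= U >= 16, phi(u) <= exp(-U) exp(-|u|); the first factor pays for
    delta |a| and the second one gives integrability. *)
Lemma edgeworth_tail k : exists2 C, 0 < C & forall delta t xh sigma a U,
  0 < delta <= 1 / 16 -> local_gaussian g h h1 h2 q delta t xh sigma a U ->
  forall x, U * sigma <= `|x - xh| ->
  `|(x - xh) / sigma| ^+ k * `|edgeworth a ((x - xh) / sigma)|
  <= C * (delta * `|a|) * (oneDsqr ((x - xh) / sigma))^-1.
Proof.
have [C C0 hC] := @poly_expR_le_cauchy R (k + 3) 1 ltr01.
exists C => // delta t xh sigma a U d16 lg x xw.
have [d0 d1] := andP d16.
have s0 := lg_sigma lg; have aD := lg_a lg; have U16 := lg_U16 d16 lg.
set u := (x - xh) / sigma.
have Uu : U <= `|u| by rewrite normrM normfV (gtr0_norm s0) ler_pdivlMr.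
set y := `|u| in Uu *.
have y0 : 0 <= y by exact: normr_ge0.
have u2 : u ^+ 2 = y ^+ 2 by rewrite real_normK ?num_real.
have e1 : `|edgeworth a u| <= expR (- U) * (expR (- (1 * y)) * (1 + y) ^+ 3).
  rewrite /edgeworth normrM (ger0_norm (gauss_weight_ge0 u)) mulrA.
  apply: ler_pM => //; first exact: gauss_weight_ge0.
    by rewrite /gauss_weight -expRD ler_expR u2; nra.
  apply: le_trans (ler_normB _ _) _; rewrite normr1.
  apply: le_trans (sum_pow3_le y0); rewrite lerD2l.
  rewrite 2!normrM normrX normfV normr_nat -/y.
  have : 0 <= y ^+ 3 by rewrite exprn_ge0.
  have : `|a| <= 1 by lra.
  nra.
have yk : y ^+ k <= (1 + y) ^+ k by rewrite lerXn2r ?nnegrE ?addr_ge0// lerDr.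
apply: (@le_trans _ _ ((1 + y) ^+ k * (expR (- U) * (expR (- (1 * y)) * (1 + y) ^+ 3)))).
  by apply: ler_pM => //; rewrite exprn_ge0.
rewrite [leLHS](_ : _ = expR (- U) * ((1 + y) ^+ (k + 3) * expR (- (1 * y)))); last first.
  by rewrite exprD; ring.
rewrite [leRHS](_ : _ = (delta * `|a|) * (C * (oneDsqr u)^-1)); last by ring.
apply: ler_pM; rewrite ?expR_ge0 ?mulr_ge0 ?exprn_ge0 ?addr_ge0 ?expR_ge0//.
  exact: lg_expU lg.
exact: hC.
Qed.

(** Here exp(-U |u|/4) is split into exp(-U) and exp(-|u|), using U >= 16. *)
Lemma weight_tail k : exists2 C, 0 < C & forall delta t xh sigma a U,
  0 < delta <= 1 / 16 -> local_gaussian g h h1 h2 q delta t xh sigma a U ->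
  forall x, 0 < x -> U * sigma <= `|x - xh| ->
  `|(x - xh) / sigma| ^+ k * rel_weight t xh x
  <= C * (delta * `|a|) * (oneDsqr ((x - xh) / sigma))^-1.
Proof.
have [C C0 hC] := @poly_expR_le_cauchy R k 1 ltr01.
exists (expR Q * C) => [|delta t xh sigma a U d16 lg x x0 xw].
  by rewrite mulr_gt0 ?expR_gt0.
have [d0 d1] := andP d16.
have s0 := lg_sigma lg; have aD := lg_a lg; have U16 := lg_U16 d16 lg.
have Kt := tail_decay dg dh h_homo d16 lg x0 xw.
rewrite rel_weight_pos//.
set u := (x - xh) / sigma in Kt *.
have Uu : U <= `|u| by rewrite normrM normfV (gtr0_norm s0) ler_pdivlMr.
set y := `|u| in Kt Uu *.
have y0 : 0 <= y by exact: normr_ge0.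
have yk : y ^+ k <= (1 + y) ^+ k by rewrite lerXn2r ?nnegrE ?addr_ge0// lerDr.
have qx := qQ x0; have qn := ler_norm (q x).
apply: (@le_trans _ _ ((1 + y) ^+ k * (expR Q * (expR (- U) * expR (- (1 * y)))))).
  apply: ler_pM; rewrite ?exprn_ge0 ?expR_ge0//.
  rewrite -!expRD ler_expR; nra.
rewrite [leLHS](_ : _ = expR Q * (expR (- U) * ((1 + y) ^+ k * expR (- (1 * y))))); last by ring.
rewrite [leRHS](_ : _ = expR Q * ((delta * `|a|) * (C * (oneDsqr u)^-1))); last by ring.
rewrite ler_wpM2l ?expR_ge0//.
apply: ler_pM; rewrite ?expR_ge0 ?mulr_ge0 ?exprn_ge0 ?addr_ge0 ?expR_ge0//.
  exact: lg_expU lg.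
exact: hC.
Qed.

(** On the negative half-line nothing is known about p except that it is a
    density, so p itself has to be the majorant. The factor exp(t x) absorbs
    the part of |u|^k due to x, and the smallness of the normalization
    (legendre_ge) absorbs the part due to xh. *)
Lemma weight_neg k : exists2 C, 0 < C & forall delta t xh sigma a U,
  0 < delta <= 1 / 16 -> local_gaussian g h h1 h2 q delta t xh sigma a U ->
  forall x, x <= 0 ->
  `|(x - xh) / sigma| ^+ k * rel_weight t xh x <= C * (delta * `|a|) * (sigma * p x).
Proof.
have [C C0 hC] := @poly_expR_bounded R k 1 ltr01.
exists (expR (g 1) * 2 ^+ k * C * C) => [|delta t xh sigma a U d16 lg x x0].
  by rewrite !mulr_gt0 ?expR_gt0 ?exprn_gt0.
have [d0 d1] := andP d16.
have s0 := lg_sigma lg; have aD := lg_a lg; have U16 := lg_U16 d16 lg.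
have U0 : 0 < U by lra.
have leg := legendre_ge dg dh h_gt0 h_homo d16 lg.
have tU := tilt_ge dg dh h_gt0 h_homo d16 lg.
have w1 := window_left_of lg (lexx 1).
have xh2 : 2 <= xh.
  have xx : `|xh - xh| <= U * sigma by rewrite subrr normr0 mulr_ge0// ltW.
  by have [] := lg_win lg xx.
set z := (xh - 1) / sigma in leg.
have z0 : U <= z.
  rewrite /z ler_pdivlMr//; apply/ltW/(lt_le_trans w1).
  by rewrite ler0_norm ?opprB// subr_le0; lra.
pose v := - x / sigma.
have v0 : 0 <= v by rewrite mulr_ge0 ?oppr_ge0// invr_ge0 ltW.
have nu : `|(x - xh) / sigma| <= 2 * ((1 + z) * (1 + v)).
  have xx : `|x - xh| = xh - x by rewrite ler0_norm ?opprB// subr_le0; lra.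
  rewrite normrM normfV (gtr0_norm s0) xx.
  apply: (@le_trans _ _ (2 * z + v)); last by nra.
  by rewrite /z /v mulrA -mulrDl ler_wpM2r ?invr_ge0 ?(ltW s0)//; lra.
(* t sigma >= U/4 >= 1 by tilt_ge *)
have tx : t * x <= - (1 * v).
  have -> : x = - (v * sigma) by rewrite /v divfK ?gt_eqF// opprK.
  rewrite mul1r mulrN lerN2 mulrCA ler_peMr//.
  apply: (@le_trans _ _ (U / (4 * sigma) * sigma)); last by rewrite ler_wpM2r ?(ltW s0).
  rewrite (_ : _ * sigma = U / 4); first by lra.
  by field; rewrite gt_eqF.
have wle : rel_weight t xh x <=
    expR (g 1) * (expR (- U) * expR (- (1 * z))) * expR (- (1 * v)) * p x.
  rewrite /rel_weight ler_wpM2r// -!expRD ler_expR; nra.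
have zk := hC z (le_trans (ltW U0) z0); have vk := hC v v0.
apply: (@le_trans _ _ ((2 * ((1 + z) * (1 + v))) ^+ k *
   (expR (g 1) * (expR (- U) * expR (- (1 * z))) * expR (- (1 * v)) * p x))).
  apply: ler_pM; rewrite ?exprn_ge0//.
  - by rewrite mulr_ge0 ?expR_ge0.
  - rewrite lerXn2r ?nnegrE// !mulr_ge0//; lra.
rewrite !exprMn.
rewrite [leLHS](_ : _ = (expR (g 1) * 2 ^+ k * p x * expR (- U)) *
  (((1 + z) ^+ k * expR (- (1 * z))) * ((1 + v) ^+ k * expR (- (1 * v))))); last by ring.
rewrite [leRHS](_ : _ = (expR (g 1) * 2 ^+ k * p x * (delta * `|a| * sigma)) * (C * C)); last by ring.
apply: ler_pM.
- by rewrite !mulr_ge0 ?expR_ge0 ?exprn_ge0.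
- by rewrite !mulr_ge0 ?expR_ge0 ?exprn_ge0//; lra.
- by rewrite ler_wpM2l ?(lg_expUs lg)// !mulr_ge0 ?expR_ge0 ?exprn_ge0.
- by apply: ler_pM => //; rewrite !mulr_ge0 ?expR_ge0 ?exprn_ge0//; lra.
Qed.

(** The majorant integrates to a constant times delta |a| sigma, that is, to
    o(a) relative to the total mass, which is of order sigma. *)
Lemma pointwise_bound k : exists2 C, 0 < C & forall delta t xh sigma a U,
  0 < delta <= 1 / 16 -> local_gaussian g h h1 h2 q delta t xh sigma a U ->
  forall x,
  `|(x - xh) / sigma| ^+ k * `|rel_weight t xh x - edgeworth a ((x - xh) / sigma)|
  <= C * (delta * `|a|) * ((oneDsqr ((x - xh) / sigma))^-1 + sigma * p x).
Proof.
have [C1 C10 H1] := window_bound k; have [C2 C20 H2] := edgeworth_tail k.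
have [C3 C30 H3] := weight_tail k; have [C4 C40 H4] := weight_neg k.
exists (C1 + C2 + C3 + C4) => [|delta t xh sigma a U d16 lg x].
  by rewrite !addr_gt0.
have s0 := lg_sigma lg; have [d0 _] := andP d16.
set u := (x - xh) / sigma.
have D0 : 0 < (oneDsqr u)^-1 by rewrite invr_gt0 (lt_le_trans ltr01)// oneDsqr_ge1.
have da0 : 0 <= delta * `|a| by rewrite mulr_ge0 ?(ltW d0).
have sp0 : 0 <= sigma * p x by rewrite mulr_ge0 ?(ltW s0).
have cmb c1 c2 : 0 <= c1 -> 0 <= c2 ->
    0 <= c1 * (delta * `|a|) * (oneDsqr u)^-1 /\ 0 <= c2 * (delta * `|a|) * (sigma * p x).
  by move=> c10 c20; rewrite !mulr_ge0// ltW.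
have [P1 N1] := cmb _ _ (ltW C10) (ltW C10); have [P2 N2] := cmb _ _ (ltW C20) (ltW C20).
have [P3 N3] := cmb _ _ (ltW C30) (ltW C30); have [P4 N4] := cmb _ _ (ltW C40) (ltW C40).
have [xw|/ltW xw] := leP `|x - xh| (U * sigma).
  by have := H1 _ _ _ _ _ _ d16 lg x xw; rewrite -/u; lra.
have w0 : 0 <= rel_weight t xh x by rewrite mulr_ge0 ?expR_ge0.
have le1 : `|u| ^+ k * `|rel_weight t xh x - edgeworth a u| <=
    `|u| ^+ k * rel_weight t xh x + `|u| ^+ k * `|edgeworth a u|.
  rewrite -mulrDr ler_wpM2l ?exprn_ge0//; apply: le_trans (ler_normB _ _) _.
  by rewrite (ger0_norm w0).
have := H2 _ _ _ _ _ _ d16 lg x xw; rewrite -/u => h2'.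
have [x0|x0] := leP x 0.
  by have := H4 _ _ _ _ _ _ d16 lg x x0; rewrite -/u; lra.
by have := H3 _ _ _ _ _ _ d16 lg x x0 xw; rewrite -/u; lra.
Qed.

End pointwise.

(** * Moments of the tilted weight *)

Lemma integrable_edgeworth (R : realType) (a : R) (k : nat) :
  leb.-integrable [set: R] (fun v : R => (v ^+ k * edgeworth a v)%:E).
Proof.
have i1 := integrable_gauss_moment R k.
have i2 := integrableZl measurableT (a / 6) (integrable_gauss_moment R (k + 3)).
apply: eq_integrable (integrableB measurableT i1 i2) => // v _.
rewrite -EFinM -EFinB; congr EFin; rewrite /edgeworth exprD; ring.
Qed.

Lemma Rintegral_edgeworth (R : realType) (a : R) (k : nat) :
  \int[leb]_v (v ^+ k * edgeworth a v) = gauss_moment R k - a / 6 * gauss_moment R (k + 3).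
Proof.
have i1 := integrable_gauss_moment R k.
have i2 := integrable_gauss_moment R (k + 3).
have i3 : leb.-integrable [set: R] (EFin \o (fun v => a / 6 * (v ^+ (k + 3) * gauss_weight v))).
  by apply: eq_integrable (integrableZl measurableT (a / 6) i2).
rewrite /gauss_moment -(RintegralZl (a / 6) measurableT i2) -RintegralB//.
by apply: eq_Rintegral => v _; rewrite /edgeworth exprD; ring.
Qed.

Section moments.
Context (R : realType) (g h h1 h2 q p : R -> R) (Q : R).
Hypothesis dg : forall x : R, 0 < x -> is_derive x 1 g (h x).
Hypothesis dh : forall x : R, 0 < x -> is_derive x 1 h (h1 x).
Hypothesis dh1 : forall x : R, 0 < x -> is_derive x 1 h1 (h2 x).
Hypothesis h_gt0 : forall x, 0 < x -> 0 < h x.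
Hypothesis h_homo : forall x y : R, 0 < x -> x <= y -> h x <= h y.
Hypothesis pE : forall x, 0 < x -> p x = expR (- (g x - q x)).
Hypothesis p_ge0 : forall x, 0 <= p x.
Hypothesis qQ : forall x, 0 < x -> `|q x| <= Q.
Hypothesis mp : measurable_fun [set: R] p.
Hypothesis p1 : (\int[leb]_x (p x)%:E = 1%:E)%E.

Lemma integrable_density : leb.-integrable [set: R] (EFin \o p).
Proof.
apply/integrableP; split; first exact/measurable_EFinP.
under eq_integral => x _ do rewrite gee0_abs ?lee_fin//.
by rewrite p1 ltry.
Qed.

Lemma measurable_rel_weight t xh : measurable_fun [set: R] (rel_weight g p t xh).
Proof.
apply: measurable_funM => //; apply: measurableT_comp => //.
by apply: measurable_funB => //; exact: measurable_funM.
Qed.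

(** Integration of pointwise_bound. The moments of the Edgeworth weight are
    explicit: M_k - a M_(k+3)/6 up to normalization. *)
Lemma moment_bound k : exists2 C, 0 < C & forall delta t xh sigma a U,
  0 < delta <= 1 / 16 -> local_gaussian g h h1 h2 q delta t xh sigma a U ->
  leb.-integrable [set: R]
    (fun x => (((x - xh) / sigma) ^+ k * rel_weight g p t xh x)%:E) /\
  `|\int[leb]_x (((x - xh) / sigma) ^+ k * rel_weight g p t xh x)
    - sigma * (gauss_moment R k - a / 6 * gauss_moment R (k + 3))|
  <= C * (delta * `|a|) * sigma.
Proof.
have [C C0 hC] := pointwise_bound dg dh dh1 h_gt0 h_homo pE p_ge0 qQ k.
pose D := \int[leb]_x ((oneDsqr (x : R))^-1).
have dom0 (x : R) : 0 <= (oneDsqr x)^-1.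
  by rewrite invr_ge0 (le_trans ler01)// oneDsqr_ge1.
have D0 : 0 <= D by apply: Rintegral_ge0.
exists (C * (D + 1)) => [|delta t xh sigma a U d16 lg].
  by rewrite mulr_gt0// ltr_wpDl.
have s0 := lg_sigma lg; have [d0 _] := andP d16.
pose u x := (x - xh) / sigma.
pose E x := u x ^+ k * edgeworth a (u x).
pose W x := u x ^+ k * rel_weight g p t xh x.
pose B x := C * (delta * `|a|) * ((oneDsqr (u x))^-1 + sigma * p x).
have iE : leb.-integrable [set: R] (EFin \o E).
  exact: (integrable_affine xh s0 (integrable_edgeworth a k)).
have idom := integrable_affine xh s0 (integrable_cauchy R).
have isp : leb.-integrable [set: R] (EFin \o (fun x => sigma * p x)).
  by apply: eq_integrable (integrableZl measurableT sigma integrable_density).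
have idp : leb.-integrable [set: R] (EFin \o (fun x => (oneDsqr (u x))^-1 + sigma * p x)).
  by apply: eq_integrable (integrableD measurableT idom isp).
have iB : leb.-integrable [set: R] (EFin \o B).
  by apply: eq_integrable (integrableZl measurableT (C * (delta * `|a|)) idp).
have m_u : measurable_fun [set: R] u.
  by apply: measurable_funM => //; exact: measurable_funB.
have mW : measurable_fun [set: R] W.
  by apply: measurable_funM; [exact: measurable_funX|exact: measurable_rel_weight].
have mE : measurable_fun [set: R] E by have /integrableP[/measurable_EFinP] := iE.
have WB x : `|W x - E x| <= B x.
  by rewrite -mulrBr normrM normrX; exact: hC d16 lg x.
have iD : leb.-integrable [set: R] (EFin \o (fun x => W x - E x)).
  apply: le_integrable iB => //.
    by apply/measurable_EFinP; exact: measurable_funB.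
  move=> x _; rewrite !abse_EFin lee_fin; apply: (le_trans (WB x)); exact: ler_norm.
have iW : leb.-integrable [set: R] (EFin \o W).
  apply: eq_integrable (integrableD measurableT iD iE) => // x _.
  by rewrite /= -EFinD subrK.
split => //.
have IE : \int[leb]_x E x = sigma * (gauss_moment R k - a / 6 * gauss_moment R (k + 3)).
  rewrite -Rintegral_edgeworth.
  exact: (Rintegral_affine xh s0 (integrable_edgeworth a k)).
rewrite -IE -RintegralB//.
apply: le_trans (le_normr_Rintegral measurableT iD) _.
have iaD : leb.-integrable [set: R] (EFin \o (fun x => `|W x - E x|)).
  by have := integrable_norm iD.
apply: (@le_trans _ _ (\int[leb]_x B x)).
  by apply: le_Rintegral => // x _; exact: WB.
rewrite RintegralZl// RintegralD// RintegralZl//; last exact: integrable_density.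
have -> : \int[leb]_x p x = 1 by rewrite /Rintegral p1.
have -> : \int[leb]_x (oneDsqr (u x))^-1 = sigma * D.
  exact: (Rintegral_affine xh s0 (integrable_cauchy R)).
by rewrite le_eqVlt; apply/orP; left; apply/eqP; ring.
Qed.

End moments.

(** * Centered moments from moment ratios *)

Lemma normal_moment0 (R : realType) : normal_moment R 0 = 1.
Proof. by rewrite normal_momentE divff// gt_eqF// gauss_moment0_gt0. Qed.

Lemma normal_moment_rec (R : realType) k :
  normal_moment R k.+2 = k.+1%:R * normal_moment R k.
Proof. by rewrite !normal_momentE gauss_moment_rec mulrA. Qed.

Lemma normal_moment_odd (R : realType) k : odd k -> normal_moment R k = 0.
Proof. by move=> ok; rewrite normal_momentE gauss_moment_odd ?mul0r. Qed.

Lemma normal_moment_even (R : realType) k : ~~ odd k -> 0 < normal_moment R k.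
Proof.
elim/ltn_ind: k => -[_ _|[//|k] IH /= ok]; first by rewrite normal_moment0.
rewrite normal_moment_rec mulr_gt0 ?ltr0n// IH//.
by move: ok; rewrite negbK.
Qed.

Lemma cvg_sumr (R : realType) (I : Type) (s : seq I) (f : I -> R -> R) (l : I -> R) :
  (forall i, f i t @[t --> +oo] --> l i) ->
  \sum_(i <- s) f i t @[t --> +oo] --> \sum_(i <- s) l i.
Proof. by move=> fl; apply: cvg_big => //; exact: add_continuous. Qed.

Section moment_algebra.
Context (R : realType) (a : R -> R) (r : nat -> R -> R).
Local Notation M := (normal_moment R).
Hypothesis a_cvg0 : a t @[t --> +oo] --> 0.
Hypothesis a_neq0 : \forall t \near +oo, a t != 0.
Hypothesis r_cvg : forall k, (r k t - M k) / a t @[t --> +oo] --> - (M (k + 3) / 6).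

Lemma ratio_cvg k : r k t @[t --> +oo] --> M k.
Proof.
have h : (r k t - M k) / a t * a t + M k @[t --> +oo] --> - (M (k + 3) / 6) * 0 + M k.
  by apply: cvgD; [exact: cvgM (@r_cvg k) a_cvg0|exact: cvg_cst].
rewrite mulr0 add0r in h; apply: cvg_trans h; apply: near_eq_cvg.
by apply: filterS a_neq0 => t at0; rewrite divfK// subrK.
Qed.

(** The j-th moment about the point xh + sigma r_1, in units of sigma, by the
    binomial formula in the normalized moments r_i about xh. *)
Definition centered (j : nat) (t : R) : R :=
  \sum_(i < j.+1) 'C(j, i)%:R * (- r 1 t) ^+ (j - i) * r i t.

Let M1 : M 1 = 0. Proof. exact: normal_moment_odd. Qed.

Let r1_cvg : - r 1 t @[t --> +oo] --> 0.
Proof.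
have h := cvgN (@ratio_cvg 1).
rewrite M1 oppr0 in h.
exact: h.
Qed.

Let r1a_cvg : - r 1 t / a t @[t --> +oo] --> M 4 / 6.
Proof.
have c : - ((r 1 t - M 1) / a t) @[t --> +oo] --> M 4 / 6.
  by rewrite -[X in _ --> X]opprK; exact: (cvgN (@r_cvg 1)).
apply: cvg_trans c; apply: near_eq_cvg.
by apply: nearW => t; rewrite /= M1 subr0 mulNr.
Qed.

Let r1X_cvg n : (- r 1 t) ^+ n @[t --> +oo] --> ((n == 0%N)%:R : R).
Proof.
have := cvg_comp _ _ r1_cvg (@exprn_continuous R n 0).
by rewrite expr0n.
Qed.

Lemma centered_cvg j : centered j t @[t --> +oo] --> M j.
Proof.
have -> : M j = \sum_(i < j.+1) 'C(j, i)%:R * ((j - i)%N == 0%N)%:R * M i.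
  rewrite big_ord_recr/= subnn binn !mul1r big1 ?add0r// => i _.
  by rewrite subn_eq0 leqNgt ltn_ord/= mulr0 mul0r.
apply: cvg_sumr => i; apply: cvgM; last exact: ratio_cvg.
by apply: cvgM; [exact: cvg_cst|exact: r1X_cvg].
Qed.

(** The powers of r_1, which is of order a, leave two terms after division by
    a: the term i = j, which tends to -M_(j+3)/6 since M_j = 0, and the term
    i = j - 1, which is j (-r_1) M_(j-1), where -r_1/a tends to
    M_4/6 = 1/2. *)
Lemma centered_odd_cvg j : odd j -> (2 < j)%N ->
  centered j t / a t @[t --> +oo] --> - ((M (j + 3) - 3 * j%:R * M (j - 1)) / 6).
Proof.
move=> oj j2.
pose L (i : 'I_j.+1) : R := if (j - i)%N == 0%N then - (M (j + 3) / 6)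
  else if (j - i)%N == 1%N then j%:R * (M 4 / 6) * M (j - 1) else 0.
have -> : - ((M (j + 3) - 3 * j%:R * M (j - 1)) / 6) = \sum_i L i.
  case: j oj j2 @L => // j oj j2 L.
  rewrite big_ord_recr big_ord_recr/= big1 ?add0r; last first.
    move=> i _; rewrite /L/=.
    by have := ltn_ord i; case E : (j.+1 - i)%N => [|[|]]//; lia.
  rewrite /L/= subnn eqxx subSnn/= (_ : M 4 = 3); last first.
    by rewrite !normal_moment_rec normal_moment0; ring.
  by rewrite subSS subn0; field.
have E : (fun t => centered j t / a t) =
    (fun t => \sum_(i < j.+1) 'C(j, i)%:R * (- r 1 t) ^+ (j - i) * r i t / a t).
  by apply/funext => t; rewrite /centered mulr_suml.
rewrite E; apply: cvg_sumr => i; rewrite /L.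
have := ltn_ord i; case E1 : (j - i)%N => [|[|n]]/= ij.
- have ii : i = j :> nat by lia.
  apply: cvg_trans (@r_cvg j); apply: near_eq_cvg; apply: nearW => t.
  by rewrite ii binn expr0 !mul1r (normal_moment_odd _ oj) subr0.
- have ii : i = j.-1 :> nat by lia.
  have -> : (j - 1 = i)%N by lia.
  have c : (j%:R * (- r 1 t / a t)) * r i t @[t --> +oo] --> j%:R * (M 4 / 6) * M i.
    apply: cvgM; last exact: ratio_cvg.
    by apply: cvgM; [exact: cvg_cst|exact: r1a_cvg].
  apply: cvg_trans c; apply: near_eq_cvg; apply: nearW => t.
  have -> : 'C(j, i) = j by rewrite ii -bin_sub ?leq_pred// (_ : (j - j.-1 = 1)%N) ?bin1//; lia.
  by rewrite expr1; ring.
- have c : ('C(j, i)%:R * ((- r 1 t) ^+ n.+1 * (- r 1 t / a t))) * r i t @[t --> +oo]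
      --> ('C(j, i)%:R * ((n.+1 == 0%N)%:R * (M 4 / 6))) * M i.
    apply: cvgM; last exact: ratio_cvg.
    apply: cvgM; first exact: cvg_cst.
    by apply: cvgM; [exact: r1X_cvg|exact: r1a_cvg].
  rewrite /= mul0r mulr0 mul0r in c.
  apply: cvg_trans c; apply: near_eq_cvg; apply: nearW => t.
  by rewrite (exprS _ n.+1); ring.
Qed.

End moment_algebra.

(** * Moments of the tilted density as the parameter grows *)

(** For large t the tilted density is locally Gaussian with arbitrary
    precision. The size U of the window may depend on the precision, whereas
    the mode, the scale and the skewness do not. *)
Definition laplace_regime (R : realType) (g h h1 h2 q xh sigma a : R -> R) : Prop :=
  forall delta : R, 0 < delta <= 1 / 16 -> \forall t \near +oo,
    exists U, local_gaussian g h h1 h2 q delta t (xh t) (sigma t) (a t) U.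

Section asymptotic_moments.
Context (R : realType) (g h h1 h2 q p xh sigma a : R -> R) (Q : R).
Hypothesis dg : forall x : R, 0 < x -> is_derive x 1 g (h x).
Hypothesis dh : forall x : R, 0 < x -> is_derive x 1 h (h1 x).
Hypothesis dh1 : forall x : R, 0 < x -> is_derive x 1 h1 (h2 x).
Hypothesis h_gt0 : forall x, 0 < x -> 0 < h x.
Hypothesis h_homo : forall x y : R, 0 < x -> x <= y -> h x <= h y.
Hypothesis pE : forall x, 0 < x -> p x = expR (- (g x - q x)).
Hypothesis p_ge0 : forall x, 0 <= p x.
Hypothesis qQ : forall x, 0 < x -> `|q x| <= Q.
Hypothesis mp : measurable_fun [set: R] p.
Hypothesis p1 : (\int[leb]_x (p x)%:E = 1%:E)%E.
Hypothesis regime : laplace_regime g h h1 h2 q xh sigma a.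
Local Notation M := (normal_moment R).
Local Notation G0 := (gauss_moment R 0).

Definition scaled_weight (k : nat) (t x : R) : R :=
  ((x - xh t) / sigma t) ^+ k * rel_weight g p t (xh t) x.

Definition scaled_moment (k : nat) (t : R) : R := \int[leb]_x scaled_weight k t x.

Definition moment_ratio (k : nat) (t : R) : R := scaled_moment k t / scaled_moment 0 t.

Let d16 : 0 < (1 / 16 : R) <= 1 / 16. Proof. by rewrite lexx andbT divr_gt0. Qed.

Lemma regime_near : \forall t \near +oo,
  [/\ 0 < sigma t, a t != 0, 2 <= xh t & sigma t <= xh t].
Proof.
apply: filterS (regime d16) => t [U lg].
have s0 := lg_sigma lg; have U16 := lg_U16 d16 lg.
have Us : 0 <= U * sigma t by rewrite mulr_ge0 ?(ltW s0)//; lra.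
split => //; first exact: lg_a0 lg.
  by have [|] := lg_win lg (x := xh t) _; rewrite ?subrr ?normr0.
have [|+ _ _ _] := lg_win lg (x := xh t - U * sigma t) _.
  by rewrite addrAC subrr sub0r normrN ger0_norm.
have : sigma t <= U * sigma t by rewrite ler_peMl ?(ltW s0)//; lra.
lra.
Qed.

Lemma regime_a_cvg0 : a t @[t --> +oo] --> 0.
Proof.
apply/cvgrPdist_le => e e0.
pose d := Num.min e (1 / 16).
have dd : 0 < d <= 1 / 16 by rewrite lt_min e0 divr_gt0//= ge_min lexx orbT.
apply: filterS (regime dd) => t [U lg]; rewrite sub0r normrN.
by apply: le_trans (lg_a lg) _; rewrite ge_min lexx.
Qed.

Lemma integrable_scaled_weight k : \forall t \near +oo,
  leb.-integrable [set: R] (EFin \o scaled_weight k t).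
Proof.
have [C _ hC] := moment_bound dg dh dh1 h_gt0 h_homo pE p_ge0 qQ mp p1 k.
by apply: filterS (regime d16) => t [U lg]; have [] := hC _ _ _ _ _ _ d16 lg.
Qed.

Let nrm k t := scaled_moment k t / (sigma t * G0).

Let nrm_cvg k : (nrm k t - M k) / a t @[t --> +oo] --> - (M (k + 3) / 6).
Proof.
have [C C0 hC] := moment_bound dg dh dh1 h_gt0 h_homo pE p_ge0 qQ mp p1 k.
have G00 := gauss_moment0_gt0 R.
apply/cvgrPdist_le => e e0.
pose d := Num.min (e * G0 / C) (1 / 16).
have dd : 0 < d <= 1 / 16.
  by rewrite lt_min !divr_gt0 ?mulr_gt0//= ge_min lexx orbT.
apply: filterS (regime dd) => t [U lg].
have s0 := lg_sigma lg; have a0 := lg_a0 lg.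
have [_] := hC _ _ _ _ _ _ dd lg.
rewrite -[\int[leb]_x _]/(scaled_moment k t) => h0.
rewrite /nrm !normal_momentE.
rewrite [X in `|X|](_ : _ = - ((scaled_moment k t - sigma t * (gauss_moment R k - a t / 6 * gauss_moment R (k + 3)))
   / (a t * sigma t * G0))); last first.
  by field; rewrite a0 (gt_eqF s0) (gt_eqF G00).
rewrite normrN normrM normfV ler_pdivrMr; last first.
  by rewrite normr_gt0 !mulf_neq0 ?(gt_eqF s0) ?(gt_eqF G00).
apply: (le_trans h0); rewrite !normrM (gtr0_norm s0) (gtr0_norm G00).
have da : d <= e * G0 / C by rewrite ge_min lexx.
have : C * d <= e * G0 by rewrite mulrC -ler_pdivlMr.
move=> cd; rewrite [leLHS](_ : _ = (C * d) * (`|a t| * sigma t)); last by ring.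
rewrite [leRHS](_ : _ = (e * G0) * (`|a t| * sigma t)); last by ring.
by rewrite ler_wpM2r// mulr_ge0// ltW.
Qed.

Let nrm0_cvg : nrm 0 t @[t --> +oo] --> (1 : R).
Proof.
have c := cvgM (@nrm_cvg 0) regime_a_cvg0.
rewrite mulr0 in c.
have c2 : (nrm 0 t - M 0) / a t * a t + M 0 @[t --> +oo] --> 0 + M 0.
  by apply: cvgD; [exact: c|exact: cvg_cst].
rewrite add0r normal_moment0 in c2; apply: cvg_trans c2; apply: near_eq_cvg.
by apply: filterS regime_near => t [_ at0 _ _]; rewrite divfK// subrK.
Qed.

Lemma scaled_moment0_gt0 : \forall t \near +oo, 0 < scaled_moment 0 t.
Proof.
have h0 : \forall t \near +oo, 0 < nrm 0 t by exact: (cvgr_gt _ nrm0_cvg).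
apply: filterS2 regime_near h0 => t [s0 _ _ _].
by rewrite /nrm pmulr_lgt0// invr_gt0 mulr_gt0// gauss_moment0_gt0.
Qed.

(** The normalizing integral is 1 - a M_3/6 + o(a) = 1 + o(a) since M_3 = 0, so
    dividing by it does not change the term of order a. *)
Lemma moment_ratio_cvg k :
  (moment_ratio k t - M k) / a t @[t --> +oo] --> - (M (k + 3) / 6).
Proof.
have c : ((nrm k t - M k) / a t - M k * ((nrm 0 t - M 0) / a t)) * (nrm 0 t)^-1 @[t --> +oo]
    --> (- (M (k + 3) / 6) - M k * - (M 3 / 6)) * 1^-1.
  apply: cvgM; last by apply: cvgV => //; rewrite oner_neq0.
  apply: cvgB; first exact: nrm_cvg.
  by apply: cvgM; [exact: cvg_cst|exact: nrm_cvg].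
rewrite invr1 mulr1 (normal_moment_odd _ (_ : odd 3))// mul0r oppr0 mulr0 subr0 in c.
apply: cvg_trans c; apply: near_eq_cvg.
apply: filterS2 regime_near scaled_moment0_gt0 => t [s0 at0 _ _] J0.
rewrite /nrm /moment_ratio normal_moment0.
by field; rewrite at0 (gt_eqF s0) (gt_eqF J0) (gt_eqF (gauss_moment0_gt0 R)).
Qed.

(** Reduction of the centered moments, about xh + sigma r_1, to the moment
    ratios, by linearity of the integral and the binomial formula. *)
Lemma tilted_centered_moment j : \forall t \near +oo,
  \int[leb]_x ((x - (xh t + sigma t * moment_ratio 1 t)) ^+ j *
      (rel_weight g p t (xh t) x / scaled_moment 0 t)) =
  sigma t ^+ j * centered moment_ratio j t.
Proof.
have hI : \forall t \near +oo, forall i, (i < j.+1)%N ->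
    leb.-integrable [set: R] (EFin \o scaled_weight i t).
  elim: j.+1 => [|n IH]; first exact: nearW.
  apply: filterS2 IH (integrable_scaled_weight n) => t IH In i.
  by rewrite ltnS leq_eqVlt => /predU1P[->//|/IH].
near=> t.
have [s0 _ _ _] : [/\ 0 < sigma t, a t != 0, 2 <= xh t & sigma t <= xh t].
  by near: t; exact: regime_near.
have J0 : 0 < scaled_moment 0 t by near: t; exact: scaled_moment0_gt0.
have It : forall i, (i < j.+1)%N -> leb.-integrable [set: R] (EFin \o scaled_weight i t).
  by near: t.
pose c (i : 'I_j.+1) := sigma t ^+ j * ('C(j, i)%:R * (- moment_ratio 1 t) ^+ (j - i)) / scaled_moment 0 t.
have E x : (x - (xh t + sigma t * moment_ratio 1 t)) ^+ j *
      (rel_weight g p t (xh t) x / scaled_moment 0 t) =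
      \sum_(i < j.+1) c i * scaled_weight i t x.
  have -> : x - (xh t + sigma t * moment_ratio 1 t) =
     sigma t * (- moment_ratio 1 t + (x - xh t) / sigma t).
    by field; rewrite gt_eqF.
  rewrite exprMn exprDn mulr_sumr mulr_suml; apply: eq_bigr => i _.
  by rewrite /c /scaled_weight -mulr_natl; field; rewrite gt_eqF.
under eq_Rintegral => x _ do rewrite E.
have S : \int[leb]_x (\sum_(i < j.+1) c i * scaled_weight i t x) =
   \sum_(i < j.+1) c i * scaled_moment i t.
  rewrite /Rintegral.
  under eq_integral => x _ do rewrite -sumEFin.
  rewrite integral_sum//=; last first.
    move=> i; apply: eq_integrable (integrableZl measurableT (c i) (It i (ltn_ord i))) => //.
  rewrite -[RHS]/(fine (\sum_(i < j.+1) c i * scaled_moment i t)%:E) -sumEFin; congr fine.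
  apply: eq_bigr => i _; have Ii := It i (ltn_ord i).
  have fi := integrable_fin_num measurableT Ii.
  transitivity ((c i)%:E * \int[leb]_x (EFin \o scaled_weight i t) x)%E.
    by rewrite -integralZl//; apply: eq_integral => x _; rewrite EFinM.
  by rewrite -(fineK fi) -EFinM.
rewrite S /centered mulr_sumr; apply: eq_bigr => i _.
by rewrite /c /moment_ratio; field; rewrite gt_eqF.
Unshelve. all: by end_near. Qed.

End asymptotic_moments.

(** * Differentiation of the moment generating function *)

(** The distribution of X is seen as a probability on the Borel sets of the
    line, for which integration against a density is available. *)
Lemma mgf_density (R : realType) (d : measure_display) (T : measurableType d)
    (P : probability T R) (X : {RV P >-> R}) (p : R -> R) (t : R) :
  has_density X p ->
  'M_P X t = (\int[leb]_x (expR (t * x) * p x)%:E)%E.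
Proof.
move=> [mp p0 pX].
pose X' : T -> measurableTypeR R := X.
have mX' : measurable_fun [set: T] X' by exact: (measurable_funP X).
pose X'' : {RV P >-> measurableTypeR R} := mfun_Sub (mem_set mX').
rewrite /mmt_gen_fun unlock.
have mf : measurable_fun [set: measurableTypeR R] (fun x : R => (expR (t * x))%:E).
  apply/measurable_EFinP; apply: measurableT_comp => //; exact: measurable_funM.
have e0 (x : R) : (0 <= (expR (t * x))%:E)%E by rewrite lee_fin expR_ge0.
transitivity (\int[P]_w ((fun x : measurableTypeR R => (expR (t * x))%:E) \o X'') w)%E.
  by apply: eq_integral => w _ /=; rewrite mulrC.
rewrite -(ge0_integral_distribution X'' mf e0).
by rewrite (ge0_integral_density mp p0 _ mf e0).
Qed.

Lemma integral_density1 (R : realType) (d : measure_display) (T : measurableType d)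
    (P : probability T R) (X : {RV P >-> R}) (p : R -> R) :
  has_density X p -> (\int[leb]_x (p x)%:E = 1%:E)%E.
Proof. by move=> [_ _ pX]; rewrite -pX// /distribution /pushforward/= preimage_setT probability_setT. Qed.

Section exponential_family.
Context (R : realType) (p : R -> R) (T0 : R).
Hypothesis mp : measurable_fun [set: R] p.
Hypothesis p_ge0 : forall x, 0 <= p x.
Hypothesis ip : forall t, T0 < t -> leb.-integrable [set: R] (fun x => (expR (t * x) * p x)%:E).

Definition exp_moment (k : nat) (t : R) : R := \int[leb]_x (x ^+ k * (expR (t * x) * p x)).

Lemma pow_le_expR (k : nat) : exists2 C : R, 0 < C & forall x : R, `|x| ^+ k <= C * expR `|x|.
Proof.
have [C C0 hC] := @poly_expR_bounded R k 1 ltr01; exists C => // x.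
have := hC `|x| (normr_ge0 x); rewrite mul1r expRN ler_pdivrMr ?expR_gt0//.
by apply: le_trans; rewrite lerXn2r ?nnegrE ?addr_ge0// lerDr.
Qed.

Lemma expR_norm_le (x : R) : expR `|x| <= expR x + expR (- x).
Proof.
by have [x0|x0] := leP 0 x; rewrite ?(ger0_norm x0) ?(ltr0_norm x0) ?lerDl ?lerDr ?expR_ge0.
Qed.

Let measurable_emom k t : measurable_fun [set: R] (fun x => x ^+ k * (expR (t * x) * p x)).
Proof.
apply: measurable_funM; first exact: exprn_measurable.
by apply: measurable_funM => //; apply: measurableT_comp => //; exact: measurable_funM.
Qed.

(** For s within 1 of t, the factor |x|^k exp((s - t) x) is at most a constant
    times exp(2 |x|), and exp(2 |x|) <= exp(2 x) + exp(- 2 x): finiteness of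
    the generating function at t + 2 and t - 2 dominates every derivative. *)
Let dom C t x := C * (expR ((t + 2) * x) * p x + expR ((t - 2) * x) * p x).

Let dom_le k : exists2 C, 0 < C & forall t s x, `|s - t| <= 1 ->
  `|x ^+ k * (expR (s * x) * p x)| <= dom C t x.
Proof.
have [C C0 hC] := pow_le_expR k; exists C => // t s x st.
rewrite normrM normrX (ger0_norm (_ : 0 <= expR (s * x) * p x)) ?mulr_ge0 ?expR_ge0//.
rewrite /dom -mulrDl mulrA mulrA ler_wpM2r//.
apply: (@le_trans _ _ (C * expR `|x| * expR (s * x))); first by rewrite ler_wpM2r ?expR_ge0.
rewrite -mulrA ler_wpM2l ?(ltW C0)// -expRD.
apply: (@le_trans _ _ (expR (2 * `|x| + t * x))).
  rewrite ler_expR; have : (s - t) * x <= `|s - t| * `|x| by rewrite -normrM ler_norm.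
  have : `|s - t| * `|x| <= 1 * `|x| by rewrite ler_wpM2r.
  lra.
rewrite expRD -[2 * `|x|](_ : `|2 * x| = _); last by rewrite normrM normr_nat.
apply: le_trans (ler_wpM2r (expR_ge0 _) (expR_norm_le _)) _.
rewrite mulrDl -!expRD le_eqVlt; apply/orP; left; apply/eqP.
by congr (expR _ + expR _); ring.
Qed.

Let idom C t : T0 + 2 < t -> leb.-integrable [set: R] (EFin \o dom C t).
Proof.
move=> Tt; have i1 := ip (_ : T0 < t + 2); have i2 := ip (_ : T0 < t - 2).
apply: eq_integrable (integrableZl measurableT C (integrableD measurableT (i1 _) (i2 _))) => //; lra.
Qed.

Lemma integrable_exp_moment k t : T0 + 2 < t ->
  leb.-integrable [set: R] (fun x => (x ^+ k * (expR (t * x) * p x))%:E).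
Proof.
move=> Tt; have [C C0 hC] := dom_le k.
apply: le_integrable (idom C Tt) => //; first by apply/measurable_EFinP; exact: measurable_emom.
move=> x _; rewrite !abse_EFin lee_fin; apply: le_trans (ler_norm _).
by apply: hC; rewrite subrr normr0.
Qed.

(** Differentiation under the integral sign; this holds once t exceeds T0 by
    more than 3, as the majorant needs t - 2 and is used on a unit
    neighborhood of t. *)
Lemma is_derive_exp_moment k t : T0 + 3 < t ->
  is_derive t 1 (exp_moment k) (exp_moment k.+1 t).
Proof.
move=> Tt; have [C C0 hC] := dom_le k.+1.
pose f (s x : R) := x ^+ k * (expR (s * x) * p x).
have df (s x : R) : is_derive s 1 (f ^~ x) (x ^+ k.+1 * (expR (s * x) * p x)).
  refine (is_derive_eq (derM (derC s (x ^+ k)) (derM (der_expR (derM (derI s) (derC s x))) (derC s (p x)))) _).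
  by rewrite /= exprS; ring.
have dE (s x : R) : partial1of2 f s x = x ^+ k.+1 * (expR (s * x) * p x).
  by rewrite partial1of2E; have [_ ->] := df s x.
pose I : set R := `]t - 1, t + 1[.
have tI : I t by rewrite /I/= in_itv/=; lra.
have If s : I s -> leb.-integrable [set: R] (EFin \o f s).
  by rewrite /I/= in_itv/= => /andP[s1 s2]; apply: integrable_exp_moment; lra.
have G0 x : 0 <= dom C t x.
  by rewrite mulr_ge0 ?(ltW C0)// addr_ge0// mulr_ge0 ?expR_ge0.
have iG : leb.-integrable [set: R] (EFin \o dom C t) by apply: idom; lra.
have Gub s x : I s -> [set: R] x -> `|partial1of2 f s x| <= dom C t x.
  by rewrite /I/= in_itv/= => /andP[s1 s2] _; rewrite dE; apply: hC; rewrite ler_norml; lra.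
have dff s x : I s -> [set: R] x -> derivable (f ^~ x) s 1.
  by move=> _ _; have [] := df s x.
have D := derivable_under_integral measurableT tI If dff G0 iG Gub.
have E := differentiation_under_integral measurableT tI If dff G0 iG Gub.
apply: DeriveDef; first exact: D.
rewrite -derive1E; apply: (etrans E).
by apply: eq_Rintegral => x _; exact: dE.
Qed.

End exponential_family.

Section log_mgf.
Context (R : realType) (d : measure_display) (T : measurableType d)
  (P : probability T R) (X : {RV P >-> R}) (p : R -> R) (T0 : R).
Hypothesis X_density : has_density X p.
Hypothesis ip : forall t, T0 < t -> leb.-integrable [set: R] (fun x => (expR (t * x) * p x)%:E).
Hypothesis Phi_pos : forall t, T0 < t -> 0 < exp_moment p 0 t.

Let mp : measurable_fun [set: R] p. Proof. by case: X_density. Qed.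
Let p_ge0 x : 0 <= p x. Proof. by case: X_density. Qed.

Lemma PhiE t : Phi X t = exp_moment p 0 t.
Proof.
rewrite /Phi (mgf_density t X_density) /exp_moment /Rintegral; congr fine.
by apply: eq_integral => x _; rewrite expr0 mul1r.
Qed.

Let L k t := exp_moment p k t.

Let dL k t : T0 + 3 < t -> is_derive t 1 (L k) (L k.+1 t).
Proof. exact: is_derive_exp_moment mp p_ge0 ip k t. Qed.

Lemma is_derive_ln_Phi (t : R) : T0 + 3 < t ->
  is_derive t 1 (fun t => ln (Phi X t)) (L 1 t / L 0 t).
Proof.
move=> Tt; rewrite (_ : (fun t => ln (Phi X t)) = (fun t => ln (L 0 t))); last first.
  by apply/funext => s; rewrite PhiE.
by apply: der_ln; [apply: Phi_pos; lra|exact: dL].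
Qed.

Lemma mgf_meanE (t : R) : T0 + 3 < t -> m X t = L 1 t / L 0 t.
Proof. by move=> Tt; rewrite /m derive1E; have [_ ->] := is_derive_ln_Phi Tt. Qed.

Lemma mgf_varianceE (t : R) : T0 + 3 < t -> s2 X t = L 2 t / L 0 t - m X t ^+ 2.
Proof.
move=> Tt; rewrite /s2 derive1nS/= -/(m X) derive1E.
have L0 : 0 < L 0 t by apply: Phi_pos; lra.
have h : is_derive t 1 (fun s => L 1 s * (L 0 s)^-1) (L 2 t / L 0 t - m X t ^+ 2).
  refine (is_derive_eq (derM (dL 1 Tt) (derV _ (dL 0 Tt))) _); first by rewrite gt_eqF.
  by rewrite mgf_meanE//; field; rewrite gt_eqF.
suff [_ ->] : is_derive t 1 (m X) (L 2 t / L 0 t - m X t ^+ 2) by [].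
apply: near_eq_is_derive h; rewrite ?oner_neq0//.
near=> s; rewrite mgf_meanE//; near: s.
by apply: lt_nbhsr.
Unshelve. all: by end_near. Qed.

Let iL k t : T0 + 3 < t -> leb.-integrable [set: R]
  (EFin \o (fun x => x ^+ k * (expR (t * x) * p x))).
Proof. by move=> Tt; apply: (integrable_exp_moment mp p_ge0 ip); lra. Qed.

Lemma tilted_densityE t x : tilted_density X p t x = (expR (t * x) * p x) / L 0 t.
Proof. by rewrite /tilted_density PhiE -/(L 0 t); ring. Qed.

Lemma tilted_mean t : T0 + 3 < t ->
  m X t = \int[leb]_x (x * tilted_density X p t x).
Proof.
move=> Tt; rewrite mgf_meanE// mulrC /L /exp_moment -RintegralZl//; last exact: iL.
by apply: eq_Rintegral => x _; rewrite tilted_densityE expr1; ring.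
Qed.

Lemma tilted_variance t : T0 + 3 < t ->
  s2 X t = \int[leb]_x ((x - m X t) ^+ 2 * tilted_density X p t x).
Proof.
move=> Tt; rewrite mgf_varianceE//.
have L0 : 0 < L 0 t by apply: Phi_pos; lra.
have i0 := integrableZl measurableT ((m X t) ^+ 2 / L 0 t) (iL 0 Tt).
have i1 := integrableZl measurableT (- 2 * m X t / L 0 t) (iL 1 Tt).
have i2 := integrableZl measurableT ((L 0 t)^-1) (iL 2 Tt).
transitivity ((L 0 t)^-1 * L 2 t + (- 2 * m X t / L 0 t) * L 1 t + (m X t) ^+ 2 / L 0 t * L 0 t).
  rewrite divfK ?gt_eqF// (_ : L 1 t = m X t * L 0 t); last first.
    by rewrite mgf_meanE// divfK// gt_eqF.
  by field; rewrite gt_eqF.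
rewrite /L /exp_moment -!RintegralZl//; try exact: iL.
rewrite -!RintegralD//.
  by apply: eq_Rintegral => x _; rewrite tilted_densityE /L /exp_moment expr0 expr1; ring.
by apply: eq_integrable (integrableD measurableT i2 i1).
Qed.

End log_mgf.

(** * From regular variation to the Laplace regime *)

Section rvU_small.
Context (R : realType).
Implicit Types (f b B : R -> R).

Lemma rvU_small (alpha e : R) f : rvU alpha f -> alpha < 0 -> 0 < e ->
  \forall x \near +oo, f x <= e.
Proof.
move=> hf a0 e0; have d0 : 0 < - alpha / 2 by rewrite divr_gt0// oppr_gt0.
near=> x.
have x1 : 1 < x by near: x; apply: nbhs_pinfty_gt; exact: num_real.
have fx : 0 < f x by near: x; exact: rvU_gt0 hf.
have h1 : `|ln (f x) - alpha * ln x| <= (- alpha / 2) * ln x.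
  by near: x; exact: rvU_potter hf d0.
have h2 : expR (ln e / (alpha / 2)) <= x by near: x; apply: nbhs_pinfty_ge; exact: num_real.
have x0 : 0 < x by lra.
have {}h2 : ln e / (alpha / 2) <= ln x by rewrite -ler_expR (lnK x0).
have a20 : alpha / 2 < 0 by lra.
rewrite ler_ndivrMr// in h2.
rewrite -ler_ln ?posrE//; move: h1; rewrite ler_norml; lra.
Unshelve. all: by end_near. Qed.

(** exp(-y) is smaller than any power of 1/y, while 1/b and B grow or decay
    like powers. *)
Lemma expR_inv_small (beta gamma kappa delta : R) b B :
  rvU gamma b -> gamma < 0 -> rvU beta B -> 0 < kappa -> 0 < delta ->
  \forall x \near +oo, expR (- (kappa / b x)) <= delta * B x.
Proof.
move=> hb g0 hB k0 d0.
(* n is such that b^n has smaller index than B *)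
pose n := (Num.truncn `|beta / gamma|).+1.
have [C C0 hC] := @poly_expR_bounded R n 1 ltr01.
have ng : n%:R * gamma + - beta < 0.
  have : beta / gamma < n%:R by apply: le_lt_trans (ler_norm _) _; exact: truncnS_gt.
  by rewrite ltr_ndivrMr//; lra.
have hf := rvU_mul (rvU_powR n%:R hb) (rvU_inv hB).
have e0 : 0 < delta * kappa ^+ n / C by rewrite divr_gt0// mulr_gt0// exprn_gt0.
have := rvU_small hf ng e0.
apply: filterS3 (rvU_gt0 hb) (rvU_gt0 hB) => x bx Bx.
rewrite powR_mulrn ?(ltW bx)// => hx.
have y0 : 0 < kappa / b x by rewrite divr_gt0.
have := hC _ (ltW y0); rewrite mul1r.
set y := kappa / b x in y0 *.
have yn : 0 < y ^+ n by rewrite exprn_gt0.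
have yn1 : y ^+ n <= (1 + y) ^+ n by rewrite lerXn2r ?nnegrE ?addr_ge0 ?(ltW y0)// lerDr.
move=> hy; have {}hy : y ^+ n * expR (- y) <= C.
  by apply: le_trans hy; rewrite ler_wpM2r ?expR_ge0.
have {}hy : expR (- y) <= C / y ^+ n by rewrite ler_pdivlMr// mulrC.
apply: (le_trans hy); rewrite ler_pdivrMr//.
rewrite /y expr_div_n.
have bn : 0 < b x ^+ n by rewrite exprn_gt0.
rewrite mulrA ler_pdivlMr//; rewrite ler_pdivlMr// in hx.
rewrite mulrAC ler_pdivrMr// in hx.
lra.
Qed.

End rvU_small.

Section regime_of_regular_variation.
Context (R : realType) (g h h1 h2 q X b : R -> R) (s : R -> R) (al1 al2 alq alb : R).
Hypothesis s_infty : s t @[t --> +oo] --> +oo.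
Hypothesis hX : \forall t \near +oo, h (X (s t)) = t.
Hypothesis rv1 : rvU al1 (fun x => h1 (X x)).
Hypothesis rv2 : rvU al2 (fun x => `|h2 (X x)|).
Hypothesis rvq : rvU alq (fun x => `|q (X x)|).
Hypothesis rvb : rvU alb b.
Hypothesis alb_lt0 : alb < 0.
Hypothesis ala_lt0 : al2 - 3 / 2 * al1 < 0.
Hypothesis alq_lt : alq < al2 - 3 / 2 * al1.
Hypothesis sgn2 : \forall N \near +oo, forall x y, N < x -> N < y ->
  0 < h2 (X x) * h2 (X y).

(** The mode is written X y, where y is the variable in which regular
    variation holds: y = X y in the regularly varying case, and y = t,
    X = psi in the rapidly varying case. *)
Definition scale_of (y : R) : R := h1 (X y) `^ (- (1 / 2)).
Definition skew_of (y : R) : R := h2 (X y) * scale_of y ^+ 3.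

Hypothesis window_cover : forall kappa', 0 < kappa' ->
  exists2 kappa, 0 < kappa & \forall y \near +oo, forall x,
    `|x - X y| <= kappa * scale_of y / b y ->
    2 <= x /\ exists2 y', `|y' / y - 1| <= kappa' & x = X y'.

Let rvs : rvU (- (1 / 2) * al1) scale_of.
Proof. exact: rvU_powR. Qed.

Let rva : rvU (al2 - 3 / 2 * al1) (fun y => `|skew_of y|).
Proof.
have := rvU_mul rv2 (rvU_powR 3%:R rvs).
rewrite (_ : al2 + _ = al2 - 3 / 2 * al1); last by field.
apply: rvU_eq; apply: filterS (rvU_gt0 rvs) => y sy.
by rewrite powR_mulrn ?(ltW sy)// /skew_of normrM normrX (gtr0_norm sy).
Qed.

(** The window has U = kappa / b(y) units of sigma, where b(y), which tends to
    0 as a power of y, is the scale sigma measured relatively to the range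
    over which regularly varying functions are nearly constant. Thus h', h''
    and q vary little on the window, exp(-U) is negligible with respect to
    any power, and the comparison of indices gives q = o(a). *)
Lemma laplace_regime_of_rvU :
  laplace_regime g h h1 h2 q (X \o s) (scale_of \o s) (skew_of \o s).
Proof.
move=> delta /andP[d0 d16].
have [k1 /andP[k10 k1h] u1] := rvU_uniform rv1 d0.
have [k2 /andP[k20 _] u2] := rvU_uniform rv2 d0.
have [k3 /andP[k30 _] u3] := rvU_uniform rvq ltr01.
pose k' := Num.min k1 (Num.min k2 k3).
have k'0 : 0 < k' by rewrite !lt_min k10 k20.
have [kappa kp0 wc] := window_cover k'0.
have d20 : 0 < delta / 2 by rewrite divr_gt0.
have rvqa : rvU (alq + - (al2 - 3 / 2 * al1)) (fun y => `|q (X y)| * `|skew_of y|^-1).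
  exact: rvU_mul rvq (rvU_inv rva).
have qa : \forall y \near +oo, `|q (X y)| * `|skew_of y|^-1 <= delta / 2.
  by apply: (rvU_small rvqa _ d20); rewrite subr_lt0.
have ad := rvU_small rva ala_lt0 d0.
have bd : \forall y \near +oo, b y <= kappa * delta.
  by apply: rvU_small rvb alb_lt0 _; rewrite mulr_gt0.
have ea := expR_inv_small rvb alb_lt0 rva kp0 d0.
have eas := expR_inv_small rvb alb_lt0 (rvU_mul rva rvs) kp0 d0.
have /near_pinftyP[N0 /(_ (N0 + 1))] := sgn2; rewrite ltrDl ltr01 => /(_ isT).
set N1 := N0 + 1 => sg.
have main : \forall y \near +oo,
   local_gaussian g h h1 h2 q delta (h (X y)) (X y) (scale_of y) (skew_of y) (kappa / b y).
  near=> y.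
  have H1 : 0 < h1 (X y) by near: y; exact: rvU_gt0 rv1.
  have H2 : 0 < `|h2 (X y)| by near: y; exact: rvU_gt0 rv2.
  have Hq : 0 < `|q (X y)| by near: y; exact: rvU_gt0 rvq.
  have s0 : 0 < scale_of y by rewrite powR_gt0.
  have a0 : 0 < `|skew_of y| by near: y; exact: rvU_gt0 rva.
  have b0 : 0 < b y by near: y; exact: rvU_gt0 rvb.
  have y0 : 0 < y by near: y; apply: nbhs_pinfty_gt; exact: num_real.
  have yN : 2 * `|N1| < y by near: y; apply: nbhs_pinfty_gt; exact: num_real.
  split => //.
  - rewrite /scale_of -powR_mulrn ?powR_ge0// -powRrM (_ : - _ * 2 = -1); last by field.
    by rewrite powR_inv1 ?(ltW H1)// invrK.
  - by rewrite /skew_of mulfK// expf_neq0// gt_eqF.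
  - by rewrite -normr_gt0.
  - by near: y; exact: ad.
  - rewrite ler_pdivlMr// mulrC -ler_pdivlMr ?invr_gt0// invrK; near: y; exact: bd.
  - by near: y; exact: ea.
  - by rewrite -mulrA; near: y; exact: eas.
  - move=> x xw.
    have [x2 [y' yy' xE]] : 2 <= x /\ exists2 y', `|y' / y - 1| <= k' & x = X y'.
      by move: x xw; near: y; apply: filterS wc => y hy x; rewrite mulrAC; exact: hy.
    have [c1 c2] : k' <= k1 /\ k' <= k2 by rewrite !ge_min !lexx ?orbT.
    have c3 : k' <= k3 by rewrite !ge_min !lexx ?orbT.
    have e1 : `|h1 (X y') / h1 (X y) - 1| <= delta.
      by move: (le_trans yy' c1); clear yy' xE; move: y'; near: y; exact: u1.
    have e2 : `| `|h2 (X y')| / `|h2 (X y)| - 1| <= delta.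
      by move: (le_trans yy' c2); clear yy' xE e1; move: y'; near: y; exact: u2.
    have e3 : `| `|q (X y')| / `|q (X y)| - 1| <= 1.
      by move: (le_trans yy' c3); clear yy' xE e1 e2; move: y'; near: y; exact: u3.
    rewrite xE; split; first by rewrite -xE.
    + rewrite -[h1 (X y') in leLHS](divfK (_ : h1 (X y) != 0)) ?gt_eqF//.
      by rewrite -[X in _ * h1 _ - X]mul1r -mulrBl normrM (gtr0_norm H1) ler_wpM2r ?(ltW H1).
    + have n1 := ler_norm N1; have n2 := ler_norm (- N1); rewrite normrN in n2.
      have y'N : N1 < y'.
        have : k' <= 1 / 2 by rewrite ge_min k1h.
        move: yy'; rewrite ler_norml => /andP[lo _] kh.
        have : 1 / 2 <= y' / y by lra.
        by rewrite ler_pdivlMr//; lra.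
      have yN1 : N1 < y by lra.
      have := sg _ _ y'N yN1 => pos.
      have h20 : h2 (X y) != 0 by rewrite -normr_gt0.
      have r0 : 0 <= h2 (X y') / h2 (X y).
        rewrite (_ : _ / _ = h2 (X y') * h2 (X y) / h2 (X y) ^+ 2); last by field.
        by rewrite divr_ge0 ?sqr_ge0 ?(ltW pos).
      have -> : h2 (X y') - h2 (X y) = (`|h2 (X y')| / `|h2 (X y)| - 1) * h2 (X y).
        by rewrite -normf_div (ger0_norm r0) mulrBl mul1r divfK.
      by rewrite normrM ler_wpM2r.
    + have qa' : `|q (X y)| <= delta / 2 * `|skew_of y|.
        by rewrite -ler_pdivrMr//; near: y; exact: qa.
      have : `|q (X y')| <= 2 * `|q (X y)|.
        by rewrite -ler_pdivrMr//; move: e3; rewrite ler_norml; lra.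
      lra.
apply: filterS2 hX (s_infty main) => t ht hm; exists (kappa / b (s t)).
by move: hm; rewrite /= ht.
Unshelve. all: by end_near. Qed.

End regime_of_regular_variation.

(** * Karamata representations and the inverse of h *)

Lemma derivable_continuous_at (R : realType) (f : R -> R) (x : R) :
  derivable f x 1 -> {for x, continuous f}.
Proof. by move=> /derivable1_diffP; exact: differentiable_continuous. Qed.

(** The logarithmic derivative of a function given by a Karamata representation
    is eps(x)/x, by the fundamental theorem of calculus. *)
Lemma is_derive_karamata (R : realType) (c : R) (eps f : R -> R) :
  karamata_form c eps f -> forall x : R, 1 < x ->
  0 < f x /\ is_derive x 1 f (f x * eps x / x).
Proof.
move=> [c0 ce de fE] x x1.
pose k u := eps u / u.
pose F y := \int[leb]_(u in `[1, y]) k u.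
have ck (y : R) : {within `[1, y], continuous k}.
  have c1 : {within `[1, y], continuous eps}.
    apply: continuous_subspaceW ce => z /=; rewrite !in_itv/= andbT.
    by case/andP.
  have c2 : {within `[1, y], continuous (fun u : R => u^-1)}.
    apply: continuous_in_subspaceT => z /[1!inE]/=; rewrite in_itv/= => /andP[z1 _].
    by apply: inv_continuous; rewrite gt_eqF//; lra.
  by move=> z; apply: cvgM; [exact: c1|exact: c2].
have ik (y : R) : leb.-integrable `[1, y] (EFin \o k).
  by apply: continuous_compact_integrable => //; exact: segment_compact.
have xx1 : x < x + 1 by rewrite ltrDl.
have ckx : {for x, continuous k}.
  apply: (within_continuous_continuous (a := 1) (b := x + 1)) => //; first lra.
  by rewrite in_itv/= x1.
have [dF F'] := continuous_FTC1_closed xx1 (ik _) x1 ckx.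
have hF : is_derive x 1 F (eps x / x).
  by apply: DeriveDef => //; rewrite -derive1E.
have fx : f x = c * expR (F x) by rewrite fE// ltW.
split; first by rewrite fx mulr_gt0 ?expR_gt0.
have h : is_derive x 1 (fun y => c * expR (F y)) (f x * eps x / x).
  refine (is_derive_eq (derM (derC x c) (der_expR hF)) _).
  by rewrite fx /=; ring.
apply: near_eq_is_derive h.
have := lt_nbhsr x1; apply: filterS => y y1; rewrite fE ?ltW//.
Qed.

Section inverse.
Context (R : realType) (h h1 h2 psi : R -> R).
Hypothesis dh : forall x : R, 0 < x -> is_derive x 1 h (h1 x).
Hypothesis dh1 : forall x : R, 0 < x -> is_derive x 1 h1 (h2 x).
Hypothesis psi_infty : psi t @[t --> +oo] --> +oo.
Hypothesis psi_inv : inverse_at_infinity h psi.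
Hypothesis h1_gt0 : \forall x \near +oo, 0 < h1 x.

Lemma near_psi (P : R -> Prop) : (\forall x \near +oo, P x) -> \forall t \near +oo, P (psi t).
Proof. by move=> hP; exact: psi_infty. Qed.

Lemma is_derive_psi : \forall t \near +oo, is_derive (t : R) 1 psi (h1 (psi t))^-1.
Proof.
have [_ hpsi psih] := psi_inv.
have /near_pinftyP[N hN] : \forall x \near +oo, [/\ 0 < x, 0 < h1 x & psi (h x) = x].
  near=> x; split; [|by near: x|by near: x].
  by near: x; apply: nbhs_pinfty_gt; exact: num_real.
have : \forall t \near +oo, N < psi t.
  by apply: (near_psi (P := fun x => N < x)); apply: nbhs_pinfty_gt; exact: num_real.
apply: filterS2 hpsi => t hpt Nt.
have [p0 h10 _] := hN _ Nt.
rewrite -{1}hpt; apply: is_derive_inverse.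
- by have := lt_nbhsr Nt; apply: filterS => y /hN[].
- have := lt_nbhsr Nt; apply: filterS => y /hN[y0 _ _].
  by apply: derivable_continuous_at; have [] := dh y0.
- exact: dh.
- by rewrite gt_eqF.
Unshelve. all: by end_near. Qed.

Lemma near_nbhs_pinfty (P : R -> Prop) : (\forall t \near +oo, P t) ->
  \forall t \near +oo, \forall u \near t, P u.
Proof.
move=> /near_pinftyP[N hN]; apply/near_pinftyP; exists N => t Nt.
by have := lt_nbhsr Nt; apply: filterS => u; exact: hN.
Qed.

Lemma derive1_psi : \forall t \near +oo, psi^`() t = (h1 (psi t))^-1.
Proof. by apply: filterS is_derive_psi => t [_ E]; rewrite derive1E. Qed.

Lemma is_derive_derive1_psi : \forall t \near +oo,
  is_derive (t : R) 1 psi^`() (- h2 (psi t) / h1 (psi t) ^+ 3).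
Proof.
have h10 := near_psi h1_gt0; have [p0 _ _] := psi_inv.
apply: filterS3 (near_nbhs_pinfty derive1_psi) (filterI h10 p0) is_derive_psi => t d1 [h1p pt0] dp.
have hd : is_derive t 1 (fun t => (h1 (psi t))^-1) (- h2 (psi t) / h1 (psi t) ^+ 3).
  refine (is_derive_eq (derV _ (der_comp (dh1 pt0) dp)) _); first by rewrite gt_eqF.
  by field; rewrite gt_eqF.
by apply: near_eq_is_derive hd; apply: filterS d1 => u ->.
Qed.

Lemma derive2_psi : \forall t \near +oo, psi^`(2) t = - h2 (psi t) / h1 (psi t) ^+ 3.
Proof. by apply: filterS is_derive_derive1_psi => t [_ E]; rewrite -[LHS]/(psi^`()^`() t) derive1E. Qed.

End inverse.

(** * The regularly varying and the rapidly varying case *)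

Lemma ge_half (R : realType) (r : R) : - (1 / 2) <= r - 1 -> 1 / 2 <= r.
Proof. lra. Qed.

Section two_cases.
Context (R : realType) (g q p psi : R -> R).
Local Notation h := (g^`()).
Local Notation h1 := (g^`(2)).
Local Notation h2 := (g^`(3)).
Hypothesis dg : forall x : R, 0 < x -> is_derive x 1 g (h x).
Hypothesis dh : forall x : R, 0 < x -> is_derive x 1 h (h1 x).
Hypothesis dh1 : forall x : R, 0 < x -> is_derive x 1 h1 (h2 x).
Hypothesis dh2 : forall x : R, 0 < x -> derivable h2 x 1.
Hypothesis h_gt0 : forall x, 0 < x -> 0 < h x.
Hypothesis h_homo : forall x y : R, 0 < x -> x <= y -> h x <= h y.
Hypothesis mp : measurable_fun [set: R] p.
Hypothesis pE : forall x, 0 < x -> p x = expR (- (g x - q x)).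
Hypothesis psi_inv : inverse_at_infinity h psi.
Hypothesis psi_infty : psi t @[t --> +oo] --> +oo.

Definition sigma_at t := h1 (psi t) `^ (- (1 / 2)).
Definition skew_at t := h2 (psi t) * sigma_at t ^+ 3.

Lemma measurable_Rplus (f : R -> R) : (forall x : R, 0 < x -> derivable f x 1) ->
  measurable_fun `](0 : R), +oo[ f.
Proof.
move=> df; apply: open_continuous_measurable_fun; first exact: interval_open.
move=> x /[1!inE]; rewrite /= in_itv/= andbT => x0.
exact: derivable_continuous_at (df x x0).
Qed.

(** On the positive half-line q = g + ln p, and p is measurable. *)
Lemma measurable_q : measurable_fun `](0 : R), +oo[ q.
Proof.
have mg : measurable_fun `](0 : R), +oo[ g by apply: measurable_Rplus => x /dg[].
have mlp : measurable_fun `](0 : R), +oo[ (fun x => ln (p x)).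
  apply: (measurableT_comp (f := @ln R)); first exact: measurable_ln.
  exact: measurable_funS mp.
apply: eq_measurable_fun (measurable_funD mlp mg) => x /[1!inE]/=.
by rewrite in_itv/= andbT => x0; rewrite pE// expRK; ring.
Qed.

Lemma regularly_varying_norm_gt0 (alpha : R) (f : R -> R) :
  regularly_varying alpha (fun x => `|f x|) -> \forall x \near +oo, 0 < `|f x|.
Proof.
move=> /(_ 1 ltr01); rewrite powR1 => hf.
have : \forall x \near +oo, 0 < `|f (1 * x)| / `|f x| by exact: (cvgr_gt _ hf).
apply: filterS => x; rewrite mul1r normr_gt0; apply: contraTneq => ->.
by rewrite normr0 mul0r ltxx.
Qed.

(** Regular variation controls |h''| only; a continuous function without zeros
    cannot change sign, so control of the absolute value is enough. *)
Lemma same_sign (f : R -> R) (N : R) : (forall x, N < x -> {for x, continuous f}) ->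
  (forall x, N < x -> f x != 0) -> forall x y, N < x -> N < y -> 0 < f x * f y.
Proof.
move=> cf f0.
have key x y : N < x -> x <= y -> 0 < f x * f y.
  move=> Nx xy; rewrite ltNge; apply/negP => fxy.
  have cxy : {within `[x, y], continuous f}.
    apply: continuous_in_subspaceT => z /[1!inE]/=; rewrite in_itv/= => /andP[xz _].
    by apply: cf; exact: lt_le_trans xz.
  have [|c] := IVT (v := 0) xy cxy.
    have fx := f0 _ Nx; have fy := f0 _ (lt_le_trans Nx xy).
    rewrite ge_min le_max.
    have [fx0|fx0] := leP (f x) 0; have [fy0|fy0] := leP (f y) 0.
    - have x_lt0 : f x < 0 by rewrite lt_neqAle fx.
      have y_lt0 : f y < 0 by rewrite lt_neqAle fy.
      by move: fxy; rewrite leNgt nmulr_rgt0// y_lt0.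
    - by rewrite (ltW fy0) orbT.
    - by rewrite (ltW fx0) orbT.
    - by move: fxy; rewrite leNgt mulr_gt0.
  rewrite in_itv/= => /andP[xc _] fc.
  by have := f0 _ (lt_le_trans Nx xc); rewrite fc eqxx.
move=> x y Nx Ny; have [xy|/ltW yx] := leP x y; first exact: key.
by rewrite mulrC; exact: key.
Qed.

(** Here y = x and the relative scale is b = sigma / x, of index
    -(beta + 1)/2. The skewness has index theta - 3(beta - 1)/2, negative
    because theta <= beta - 2, and the hypothesis on eta says that q has an
    even smaller index. *)
Lemma regular_case_regime (beta theta eta : R) :
  regular_case h beta theta -> eta < theta - 3 * beta / 2 - 3 / 2 ->
  regularly_varying eta (fun x => `|q x|) ->
  (\forall x \near +oo, 0 < h1 x) /\
  laplace_regime g h h1 h2 q psi sigma_at skew_at.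
Proof.
move=> [l [eps [c [b0 hl lk [eps0 _ _] [thb rv2]]]]] eta_lt rvq.
have lD := is_derive_karamata lk.
have hE x : 0 < x -> h x = x `^ beta * l x.
  by move=> x0; apply: hl; rewrite inE /Rplus/= in_itv/= andbT.
have h1E x : 1 < x -> h1 x = h x * (beta + eps x) / x.
  move=> x1; have x0 : 0 < x by lra.
  have [lx0 dl] := lD x x1.
  have hd : is_derive x 1 (fun x => x `^ beta * l x) (h x * (beta + eps x) / x).
    refine (is_derive_eq (derM (is_derive1_powR beta x0) dl) _).
    rewrite hE// powRB ?(gt_eqF x0) ?implybT// powRr1 ?(ltW x0)//.
    by field; rewrite gt_eqF.
  suff [_ <-] : is_derive x 1 h (h x * (beta + eps x) / x) by have [_ ->] := dh x0.
  apply: near_eq_is_derive hd; have := lt_nbhsr x0; apply: filterS => y y0.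
  by rewrite hE.
have be : beta + eps x @[x --> +oo] --> beta.
  by rewrite -[X in _ --> X]addr0; apply: cvgD => //; exact: cvg_cst.
have rvh : rvU beta h.
  apply: (rvU_derive (df := h1)).
  - apply/near_pinftyP; exists 0; exact: h_gt0.
  - apply/near_pinftyP; exists 0; exact: dh.
  - apply: cvg_trans be; apply: near_eq_cvg; apply/near_pinftyP; exists 1 => x x1.
    rewrite h1E//; have hx : 0 < h x by apply: h_gt0; lra.
    by field; rewrite !gt_eqF//; lra.
have rv1 : rvU (beta - 1) h1.
  have := rvU_mul (rvU_mul rvh (rvU_lim b0 be)) (rvU_inv (rvU_id R)).
  rewrite addr0; apply: rvU_eq; apply/near_pinftyP; exists 1 => x x1.
  by rewrite h1E.
have h2_pos := regularly_varying_norm_gt0 rv2.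
have rvh2 : rvU theta (fun x => `|h2 x|).
  apply: (rvU_of_measurable (A := 0)) => //.
  by apply: measurableT_comp => //; exact: measurable_Rplus.
have rvqq : rvU eta (fun x => `|q x|).
  apply: (rvU_of_measurable (A := 0)) => //; last exact: regularly_varying_norm_gt0 rvq.
  by apply: measurableT_comp => //; exact: measurable_q.
split; first exact: rvU_gt0 rv1.
pose b (x : R) := h1 x `^ (- (1 / 2)) * x^-1.
have rvb : rvU (- (1 / 2) * (beta - 1) + - 1) b.
  exact: rvU_mul (rvU_powR _ rv1) (rvU_inv (rvU_id R)).
apply: (@laplace_regime_of_rvU _ g h h1 h2 q id b psi (beta - 1) theta eta
  (- (1 / 2) * (beta - 1) + - 1)) => //; try lra.
- by have [_ + _] := psi_inv.
- have /near_pinftyP[M hM] := h2_pos.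
  apply/near_pinftyP; exists (Num.max M 0) => N; rewrite gt_max => /andP[MN N0].
  apply: same_sign => x Nx.
    by apply/derivable_continuous_at/dh2; lra.
  by rewrite -normr_gt0; apply: hM; lra.
- move=> k k0; pose kappa := Num.min k (1 / 2).
  have kp : 0 < kappa by rewrite lt_min k0 divr_gt0.
  have kk : kappa <= k by rewrite ge_min lexx.
  have k2 : kappa <= 1 / 2 by rewrite ge_min lexx orbT.
  exists kappa => //; near=> y => x.
  have y4 : 4 < y by near: y; apply: nbhs_pinfty_gt; exact: num_real.
  have hy : 0 < h1 y by near: y; exact: rvU_gt0 rv1.
  have -> : kappa * scale_of h1 id y / b y = kappa * y.
    have : 0 < h1 y `^ (- (1 / 2)) by rewrite powR_gt0.
    by rewrite /scale_of /b /= => s0; field; rewrite (gt_eqF s0) gt_eqF//; lra.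
  move=> xy; split.
    have : kappa * y <= 1 / 2 * y by rewrite ler_wpM2r//; lra.
    move: xy; rewrite ler_norml; lra.
  have y0 : 0 < y by lra.
  exists x => //; rewrite -(divff (negbT (gt_eqF y0))).
  rewrite -mulrBl normrM normfV (gtr0_norm y0).
  by rewrite ler_pdivrMr//; apply: (le_trans xy); rewrite ler_wpM2r// ltW.
Unshelve. all: by end_near. Qed.

(** The image under psi of a relative neighborhood of y contains an interval
    around psi(y) of length comparable to y psi'(y), since psi' does not drop
    below half of its value at y on this neighborhood. *)
Lemma inverse_window (D : R -> R) (k k1 : R) : 0 < k -> 0 < k1 <= 1 / 2 ->
  (\forall y \near +oo, forall z, `|z / y - 1| <= k1 -> `|D z / D y - 1| <= 1 / 2) ->
  (\forall t \near +oo, is_derive (t : R) 1 psi (D t)) ->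
  (\forall t \near +oo, 0 < D t) ->
  exists2 kk, 0 < kk & \forall y \near +oo, forall x,
    `|x - psi y| <= kk * (y * D y) ->
    2 <= x /\ exists2 z, `|z / y - 1| <= k & x = psi z.
Proof.
move=> k0 /andP[k10 k1h] u1 dpsi D0.
pose kk := Num.min k k1.
have kk0 : 0 < kk by rewrite lt_min k0.
have kkk : kk <= k by rewrite ge_min lexx.
have kk1 : kk <= k1 by rewrite ge_min lexx orbT.
exists (kk / 2); first by rewrite divr_gt0.
have [_ hpsi psih] := psi_inv.
have /near_pinftyP[N hN] := psih.
have [M hM] : exists M, forall t, M < t ->
    [/\ is_derive (t : R) 1 psi (D t), h (psi t) = t, 0 < D t & `|N| + 2 < psi t].
  apply/near_pinftyP.
  have big : \forall t \near +oo, `|N| + 2 < psi t.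
    by apply: (near_psi psi_infty (P := fun x => `|N| + 2 < x)); apply: nbhs_pinfty_gt; exact: num_real.
  by apply: filterS3 dpsi hpsi (filterI D0 big) => t d1 d2 [d3 d4].
near=> y => x.
have y0 : 2 * (`|M| + 1) < y by near: y; apply: nbhs_pinfty_gt; exact: num_real.
have uD : forall z, `|z / y - 1| <= k1 -> `|D z / D y - 1| <= 1 / 2 by near: y.
have nM := ler_norm M; have nM0 := normr_ge0 M.
have My : M < y by lra.
have yp : 0 < y by lra.
have [_ _ Dy _] := hM y My.
(* the increments of psi over a relative step kk are at least kk y D y / 2 *)
have Dc z : `|z - y| <= kk * y -> M < z /\ D y / 2 <= D z.
  move=> cy; have kky : kk * y <= 1 / 2 * y by rewrite ler_wpM2r ?(ltW yp)//; lra.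
  split; first by move: cy; rewrite ler_norml; lra.
  have : `|z / y - 1| <= k1.
    rewrite -(divff (negbT (gt_eqF yp))) -mulrBl normrM normfV (gtr0_norm yp) ler_pdivrMr//.
    by apply: (le_trans cy); rewrite ler_wpM2r ?(ltW yp).
  move=> /uD; rewrite ler_norml => /andP[lo _].
  have {}lo : 1 / 2 <= D z / D y by exact: ge_half.
  by rewrite mulrC -div1r -ler_pdivlMr.
have kyp : 0 < kk * y by rewrite mulr_gt0.
have step (a1 a2 : R) : a1 < a2 -> `|a1 - y| <= kk * y -> `|a2 - y| <= kk * y ->
    (a2 - a1) * (D y / 2) <= psi a2 - psi a1.
  move=> a12 h1a h2a.
  have inb c1 : a1 <= c1 <= a2 -> `|c1 - y| <= kk * y.
    by move: h1a h2a; rewrite !ler_norml; lra.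
  have [| |c1] := @MVT _ psi D a1 a2 a12.
  - move=> z; rewrite in_itv/= => /andP[/ltW z1 /ltW z2].
    have zz : a1 <= z <= a2 by rewrite z1 z2.
    by have [Mz _] := Dc z (inb z zz); have [] := hM z Mz.
  - apply: derivable_within_continuous => z; rewrite in_itv/= => zz.
    by have [Mz _] := Dc z (inb z zz); have [[]] := hM z Mz.
  - rewrite in_itv/= => /andP[/ltW z1 /ltW z2] ->.
    rewrite mulrC ler_wpM2r ?subr_ge0 ?(ltW a12)//.
    have zz : a1 <= c1 <= a2 by rewrite z1 z2.
    by have [] := Dc c1 (inb c1 zz).
pose lo := y - kk * y; pose hi := y + kk * y.
have elo : `|lo - y| <= kk * y by rewrite /lo addrAC subrr sub0r normrN gtr0_norm.
have ehi : `|hi - y| <= kk * y by rewrite /hi addrAC subrr add0r gtr0_norm.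
have eyy : `|y - y| <= kk * y by rewrite subrr normr0 ltW.
have slo := step lo y (_ : lo < y) elo eyy.
have shi := step y hi (_ : y < hi) eyy ehi.
have {}slo : kk / 2 * (y * D y) <= psi y - psi lo.
  by apply: le_trans (slo _); rewrite /lo; lra.
have {}shi : kk / 2 * (y * D y) <= psi hi - psi y.
  by apply: le_trans (shi _); rewrite /hi; lra.
rewrite ler_norml => /andP[xl xr].
have [Mlo _] := Dc _ elo; have [Mhi _] := Dc _ ehi.
have [_ hlo _ Nlo] := hM _ Mlo; have [_ hhi _ Nhi] := hM _ Mhi.
have nN := ler_norm N; have nN0 := normr_ge0 N.
have x2 : `|N| + 2 < x by lra.
split; first lra.
exists (h x); last by rewrite hN//; lra.
have h_lo : lo <= h x by rewrite -hlo h_homo//; lra.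
have h_hi : h x <= hi by rewrite -hhi h_homo//; lra.
rewrite -(divff (negbT (gt_eqF yp))) -mulrBl normrM normfV (gtr0_norm yp) ler_pdivrMr//.
have : kk * y <= k * y by rewrite ler_wpM2r ?(ltW yp).
by move: h_lo h_hi; rewrite /lo /hi ler_norml; lra.
Unshelve. all: by end_near. Qed.

(** Here y = t. From psi' = psi eps/t one gets h'(psi t) = t/(psi eps) and
    h''(psi t) = V t/(psi eps)^2 with V = 1 - eps - t eps'/eps tending to 1.
    As psi and eps are slowly varying, h' and h'' along psi have index 1 and
    the skewness has index -1/2, which is above the index of q. *)
Lemma rapid_case_regime (eta : R) : h x @[x --> +oo] --> +oo ->
  rapid_case psi -> eta < - (1 / 2) ->
  regularly_varying eta (fun t => `|q (psi t)|) ->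
  (\forall x \near +oo, 0 < h1 x) /\
  laplace_regime g h h1 h2 q psi sigma_at skew_at.
Proof.
move=> h_infty [eps [c [_ psik eps0 deps0 _]]] eta_lt rvq.
have psiD := is_derive_karamata psik.
have [psi0 hpsi psih] := psi_inv.
have depsx (t : R) : 1 < t -> is_derive t 1 eps (eps^`() t).
  move=> t1; have [_ _ de _] := psik.
  apply: DeriveDef; last by rewrite derive1E.
  by apply: (de 0%N) => //; rewrite /= in_itv/= t1.
have near1 : \forall t \near +oo, (1 : R) < t by apply: nbhs_pinfty_gt; exact: num_real.
(* h is strictly increasing near +oo, so that h1 >= 0 there *)
have h1_ge0 : \forall x \near +oo, 0 <= h1 x.
  have /near_pinftyP[N hN] := psih.
  pose A := Num.max N 0.
  have NA : N <= A by rewrite le_max lexx.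
  have A0 : 0 <= A by rewrite le_max lexx orbT.
  apply/near_pinftyP; exists A => x Ax.
  apply: (@incr_derive1_ge0_itvy _ h false A).
  - move=> y /[1!inE]/=; rewrite in_itv/= andbT => Ay.
    by have [] := dh (le_lt_trans A0 Ay).
  - move=> y z; rewrite !in_itv/= !andbT => Ay Az yz.
    rewrite lt_neqAle h_homo ?(ltW yz) ?(le_lt_trans A0 Ay)// andbT.
    apply: contraTneq yz => e.
    by rewrite -(hN y (le_lt_trans NA Ay)) -(hN z (le_lt_trans NA Az)) e ltxx.
  - by rewrite in_itv/= andbT.
(* differentiating h (psi t) = t *)
have h1psi : \forall t \near +oo, h1 (psi t) * (psi t * eps t / t) = 1.
  apply: filterS3 (near_nbhs_pinfty hpsi) psi0 near1 => t ht pt t1.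
  have [_ dp] := psiD t t1.
  have [_ <-] := der_comp (dh pt) dp.
  have [_ d1] := derI t.
  by apply: etrans d1; apply: near_eq_derive.
have h1p0 : \forall t \near +oo, 0 < h1 (psi t).
  apply: filterS2 h1psi (near_psi psi_infty h1_ge0) => t E h0.
  rewrite lt_neqAle h0 andbT eq_sym; apply: contra_eq_neq E => ->.
  by rewrite mul0r eq_sym oner_eq0.
have eps_gt0 : \forall t \near +oo, 0 < eps t.
  apply: filterS3 h1psi h1p0 (filterI psi0 near1) => t E h0 [p0 t1].
  have : 0 < psi t * eps t / t by rewrite -(pmulr_rgt0 _ h0) E.
  by rewrite pmulr_lgt0 ?invr_gt0 ?pmulr_rgt0//; lra.
(* transfer from t to x by x = psi (h x), as h tends to +oo *)
have h1pos : \forall x \near +oo, 0 < h1 x.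
  have := near_psi (psi := h) h_infty (P := fun t => 0 < h1 (psi t)) h1p0.
  by apply: filterS2 psih => x ->.
split => //.
have rvp : rvU 0 psi.
  apply: (rvU_derive (df := fun t => psi t * eps t / t)) => //.
    by apply: filterS near1 => t /psiD[].
  apply: cvg_trans eps0; apply: near_eq_cvg; apply: filterS2 psi0 near1 => t p0 t1.
  by field; rewrite !gt_eqF//; lra.
have rve : rvU 0 eps.
  apply: (rvU_derive (df := eps^`())) => //.
  by apply: filterS near1 => t; exact: depsx.
have rvpe : rvU (0 + 0) (fun t => psi t * eps t) := rvU_mul rvp rve.
have H1E : \forall t \near +oo, h1 (psi t) = t * (psi t * eps t)^-1.
  apply: filterS3 h1psi eps_gt0 (filterI psi0 near1) => t E e0 [p0 t1].
  rewrite -[RHS]mul1r -E; field; rewrite !gt_eqF//; lra.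
have rv1 : rvU (1 + - (0 + 0)) (fun t => h1 (psi t)).
  apply: rvU_eq (rvU_mul (rvU_id R) (rvU_inv rvpe)).
  by apply: filterS H1E => t ->.
pose V t := 1 - eps t - t * eps^`()%classic t / eps t.
have V1 : V t @[t --> +oo] --> (1 : R).
  rewrite -[X in _ --> X](_ : 1 - 0 - 0 = 1); last by rewrite !subr0.
  by apply: cvgB => //; apply: cvgB => //; exact: cvg_cst.
have V0 : \forall t \near +oo, 0 < V t by exact: (cvgr_gt _ V1).
have H2E : \forall t \near +oo, h2 (psi t) =
    V t * (t * (psi t * eps t)^-1 * (psi t * eps t)^-1).
  apply: filterS3 (near_nbhs_pinfty H1E) (filterI h1psi eps_gt0) (filterI psi0 near1)
    => t nE [E e0] [p0 t1].
  have [_ dp] := psiD t t1.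
  have pe0 : psi t * eps t != 0 by rewrite mulf_neq0 ?gt_eqF.
  have t0 : t != 0 by rewrite gt_eqF//; lra.
  have d1 := der_comp (dh1 p0) dp.
  have d2 := derM (derI t) (derV (f := fun t => psi t * eps t) pe0 (derM dp (depsx t t1))).
  have E2 : h2 (psi t) * (psi t * eps t / t) =
      1 * (psi t * eps t)^-1 + t * (- (psi t * eps t / t * eps t + psi t * eps^`()%classic t)
        / (psi t * eps t) ^+ 2).
    have [_ <-] := d1; have [_ <-] := d2; exact: near_eq_derive nE.
  have pt0 : psi t != 0 by rewrite gt_eqF.
  have et0 : eps t != 0 by rewrite gt_eqF.
  have pet : psi t * eps t / t != 0 by rewrite !mulf_neq0 ?invr_eq0.
  apply: (mulIf pet); rewrite E2 /V; field.
  by rewrite pt0 et0 t0.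
have rv2 : rvU (0 + (1 + - (0 + 0) + - (0 + 0))) (fun t => `|h2 (psi t)|).
  apply: rvU_eq (rvU_mul (rvU_lim ltr01 V1)
    (rvU_mul (rvU_mul (rvU_id R) (rvU_inv rvpe)) (rvU_inv rvpe))).
  apply: filterS3 H2E V0 (filterI eps_gt0 (filterI psi0 near1)) => t -> v0 [e0 [p0 t1]].
  by rewrite ger0_norm// !mulr_ge0 ?invr_ge0 ?mulr_ge0 ?ltW//; lra.
have rvqq : rvU eta (fun t => `|q (psi t)|).
  have /near_pinftyP[M hM] : \forall t \near +oo, 0 < psi t /\ 1 < t by exact: filterI.
  apply: (rvU_of_measurable (A := Num.max M 1)) => //; last exact: regularly_varying_norm_gt0 rvq.
  apply: measurableT_comp => //.
  apply: (measurable_comp (F := `](0 : R), +oo[%classic) (f := q) (g := psi)) => //.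
  - move=> _ [t /= + <-]; rewrite !in_itv/= !andbT gt_max => /andP[Mt _].
    by have [] := hM t Mt.
  - exact: measurable_q.
  - apply: open_continuous_measurable_fun; first exact: interval_open.
    move=> t /[1!inE]; rewrite /= in_itv/= andbT gt_max => /andP[_ t1].
    by apply: derivable_continuous_at; have [_ []] := psiD t t1.
pose b (t : R) := (h1 (psi t) `^ (- (1 / 2)) * t)^-1.
have rvb : rvU (- (- (1 / 2) * (1 + - (0 + 0)) + 1)) b.
  exact: rvU_inv (rvU_mul (rvU_powR _ rv1) (rvU_id R)).
apply: (@laplace_regime_of_rvU _ g h h1 h2 q psi b id _ _ _ _ _ _ rv1 rv2 rvqq rvb) => //; try lra.
- have /near_pinftyP[M hM] : \forall t \near +oo, 0 < h2 (psi t).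
    apply: filterS3 H2E V0 (filterI eps_gt0 (filterI psi0 near1)) => t -> v0 [e0 [p0 t1]].
    by rewrite !mulr_gt0 ?invr_gt0 ?mulr_gt0//; lra.
  apply/near_pinftyP; exists M => N MN x y Nx Ny.
  by apply: mulr_gt0; apply: hM; lra.
- move=> k k0.
  have h20 : 0 < (1 / 2 : R) by rewrite divr_gt0.
  have [k1 k1b u1] := rvU_uniform (rvU_inv rv1) h20.
  have dpsi := is_derive_psi dh psi_infty psi_inv h1pos.
  have D0 : \forall t \near +oo, 0 < (h1 (psi t))^-1.
    by apply: filterS h1p0 => t; rewrite invr_gt0.
  have [kk kk0 hw] := inverse_window k0 k1b u1 dpsi D0.
  exists kk => //; apply: filterS2 h1p0 hw => y h1y hy x xy; apply: hy.
  apply: (le_trans xy); rewrite le_eqVlt; apply/orP; left; apply/eqP.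
  have SS : h1 (psi y) `^ (- (1 / 2)) * h1 (psi y) `^ (- (1 / 2)) = (h1 (psi y))^-1.
    rewrite -powRD; last by rewrite (gt_eqF h1y) implybT.
    by rewrite (_ : - (1 / 2) + - (1 / 2) = -1) ?powR_inv1 ?(ltW h1y)//; field.
  by rewrite /scale_of /b invrK -SS; ring.
Qed.

End two_cases.

(** * Asymptotic equivalences *)

(** This form of equivalence needs no lower bound on g, which may vanish. *)
Lemma equiv_of_ratio (R : realType) (f g c : R -> R) :
  (\forall t \near +oo, f t = g t * c t) -> c t @[t --> +oo] --> (1 : R) ->
  f ~_(at_pinfty R) g.
Proof.
move=> fgc c1; apply/eqaddoP => e e0.
have /cvgrPdist_le/(_ e e0) h := c1.
apply: filterS2 fgc h => t E h; rewrite !fctE E.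
rewrite (_ : _ - _ = - (g t * (1 - c t))); last by ring.
by rewrite normrN normrM mulrC ler_wpM2r.
Qed.

Section conclusion.
Context (R : realType) (d : measure_display) (T : measurableType d)
    (P : probability T R) (X : {RV P >-> R}) (g h h1 h2 q p psi : R -> R) (Q : R).
Hypothesis X_density : has_density X p.
Hypothesis dg : forall x : R, 0 < x -> is_derive x 1 g (h x).
Hypothesis dh : forall x : R, 0 < x -> is_derive x 1 h (h1 x).
Hypothesis dh1 : forall x : R, 0 < x -> is_derive x 1 h1 (h2 x).
Hypothesis h_gt0 : forall x, 0 < x -> 0 < h x.
Hypothesis h_homo : forall x y : R, 0 < x -> x <= y -> h x <= h y.
Hypothesis pE : forall x, 0 < x -> p x = expR (- (g x - q x)).
Hypothesis qQ : forall x, 0 < x -> `|q x| <= Q.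
Context (sigma a : R -> R).
Hypothesis regime : laplace_regime g h h1 h2 q psi sigma a.

Let mp : measurable_fun [set: R] p. Proof. by case: X_density. Qed.
Let p_ge0 x : 0 <= p x. Proof. by case: X_density. Qed.
Let p1 := integral_density1 X_density.

Local Notation M := (normal_moment R).
Local Notation W := (rel_weight g p).
Local Notation SM := (scaled_moment g p psi sigma).
Local Notation r := (moment_ratio g p psi sigma).
Local Notation cm := (centered r).
Local Notation leg t := (t * psi t - g (psi t)).

Let reg := regime_near regime.
Let a_cvg0 := regime_a_cvg0 regime.
Let a_neq0 : \forall t \near +oo, a t != 0. Proof. by apply: filterS reg => t []. Qed.
Let SM0 := scaled_moment0_gt0 dg dh dh1 h_gt0 h_homo pE p_ge0 qQ mp p1 regime.
Let iSW := integrable_scaled_weight dg dh dh1 h_gt0 h_homo pE p_ge0 qQ mp p1 regime.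
Let r_cvg := moment_ratio_cvg dg dh dh1 h_gt0 h_homo pE p_ge0 qQ mp p1 regime.
Let cm_cvg := centered_cvg a_cvg0 a_neq0 r_cvg.
Let cm_odd := centered_odd_cvg a_cvg0 a_neq0 r_cvg.

Lemma exp_weightE t x : expR (t * x) * p x = expR (leg t) * W t (psi t) x.
Proof. by rewrite /rel_weight mulrA -expRD; congr (expR _ * _); ring. Qed.

Lemma exp_moment0E : \forall t \near +oo,
  leb.-integrable [set: R] (fun x => (expR (t * x) * p x)%:E) /\
  exp_moment p 0 t = expR (leg t) * SM 0 t.
Proof.
apply: filterS (@iSW 0) => t iW; split.
  apply: eq_integrable (integrableZl measurableT (expR (leg t)) iW) => // x _.
  by rewrite /scaled_weight /= expr0 mul1r -EFinM exp_weightE.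
rewrite /exp_moment /scaled_moment -RintegralZl//; apply: eq_Rintegral => x _.
by rewrite /scaled_weight !expr0 !mul1r exp_weightE.
Qed.

(** The integrability near the mode already shows that the generating function
    is finite for all large t. *)
Lemma exists_tilting_range : exists T0 : R,
  (forall t, T0 < t -> leb.-integrable [set: R] (fun x => (expR (t * x) * p x)%:E)) /\
  (forall t, T0 < t -> 0 < exp_moment p 0 t).
Proof.
have /near_pinftyP[T0 hT] : \forall t \near +oo,
    leb.-integrable [set: R] (fun x => (expR (t * x) * p x)%:E) /\ 0 < exp_moment p 0 t.
  by apply: filterS2 exp_moment0E SM0 => t [i ->] s0; rewrite mulr_gt0 ?expR_gt0.
by exists T0; split => t /hT[].
Qed.

Lemma tilted_density_rel : \forall t \near +oo, forall x,
  tilted_density X p t x = W t (psi t) x / SM 0 t.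
Proof.
apply: filterS2 exp_moment0E SM0 => t [_ E] s0 x.
rewrite /tilted_density (PhiE X_density) E mulrAC exp_weightE.
by field; rewrite !gt_eqF ?expR_gt0.
Qed.

(** The logarithmic derivative of the generating function is the mean of the
    tilted density, whose distance to the mode is sigma r_1. *)
Lemma mean_expansion : \forall t \near +oo, m X t = psi t + sigma t * r 1 t.
Proof.
have [T0 [ip Phi_pos]] := exists_tilting_range.
have big : \forall t \near +oo, T0 + 3 < t by apply: nbhs_pinfty_gt; exact: num_real.
apply: filterS3 (filterI exp_moment0E reg) SM0 big => t [[_ E] [s0 _ _ _]] J0 Tt.
rewrite (mgf_meanE X_density ip Phi_pos Tt).
have i1 : leb.-integrable [set: R] (fun x => (x ^+ 1 * (expR (t * x) * p x))%:E).
  by apply: (integrable_exp_moment mp p_ge0 ip); lra.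
have i0 : leb.-integrable [set: R] (fun x => (x ^+ 0 * (expR (t * x) * p x))%:E).
  by apply: (integrable_exp_moment mp p_ge0 ip); lra.
have E1 : exp_moment p 1 t - psi t * exp_moment p 0 t = expR (leg t) * sigma t * SM 1 t.
  have z0 := integrableZl measurableT (psi t) i0.
  rewrite /exp_moment -RintegralZl// -RintegralB//.
  have -> : SM 1 t = \int[leb]_x ((expR (leg t) * sigma t)^-1 *
      (x ^+ 1 * (expR (t * x) * p x) - psi t * (x ^+ 0 * (expR (t * x) * p x)))).
    apply: eq_Rintegral => x _; rewrite /scaled_weight exp_weightE expr0 !expr1.
    by field; rewrite !gt_eqF ?expR_gt0.
  rewrite RintegralZl//; last first.
    by apply: eq_integrable (integrableB measurableT i1 z0).
  by rewrite mulrA divff ?mul1r// mulf_neq0// gt_eqF ?expR_gt0.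
have -> : exp_moment p 1 t = expR (leg t) * sigma t * SM 1 t + psi t * exp_moment p 0 t.
  by rewrite -E1 subrK.
rewrite E /moment_ratio; field.
by rewrite !gt_eqF ?expR_gt0.
Qed.

Lemma mu_expansion j : \forall t \near +oo, mu X p j t = sigma t ^+ j * cm j t.
Proof.
have tc := tilted_centered_moment dg dh dh1 h_gt0 h_homo pE p_ge0 qQ mp p1 regime j.
apply: filterS3 tilted_density_rel mean_expansion tc => t tE mE <-.
by apply: eq_Rintegral => x _; rewrite mE tE.
Qed.

Lemma s2_expansion : \forall t \near +oo, s2 X t = sigma t ^+ 2 * cm 2 t.
Proof.
have [T0 [ip Phi_pos]] := exists_tilting_range.
have big : \forall t \near +oo, T0 + 3 < t by apply: nbhs_pinfty_gt; exact: num_real.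
apply: filterS2 (mu_expansion 2) big => t <- Tt.
exact: (tilted_variance X_density ip Phi_pos Tt).
Qed.

Let cm2_cvg : cm 2 t @[t --> +oo] --> (1 : R).
Proof. by have := @cm_cvg 2; rewrite normal_moment_rec normal_moment0 mulr1. Qed.

Let cm2_gt0 : \forall t \near +oo, 0 < cm 2 t.
Proof. exact: (cvgr_gt _ cm2_cvg). Qed.

Lemma s_expansion : \forall t \near +oo, 0 < s X t /\ s X t = sigma t * Num.sqrt (cm 2 t).
Proof.
apply: filterS3 s2_expansion reg cm2_gt0 => t E [s0 _ _ _] c0.
have sE : s X t = sigma t * Num.sqrt (cm 2 t).
  by rewrite /s E sqrtrM ?sqr_ge0// sqrtr_sqr gtr0_norm.
by split; rewrite sE// mulr_gt0// sqrtr_gt0.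
Qed.

Let sqcm_cvg n : Num.sqrt (cm 2 t) ^+ n @[t --> +oo] --> (1 : R).
Proof.
have c1 : Num.sqrt (cm 2 t) @[t --> +oo] --> (1 : R).
  by rewrite -[X in _ --> X]sqrtr1; apply: continuous_cvg cm2_cvg; exact: sqrt_continuous.
have := cvg_comp _ _ c1 (@exprn_continuous R n 1).
by rewrite expr1n.
Qed.

Lemma tilted_mean_variance : \forall t \near +oo,
     [/\ m X t = \int[leb]_x (x * tilted_density X p t x),
         s2 X t = \int[leb]_x ((x - m X t) ^+ 2 * tilted_density X p t x) &
         0 < s X t].
Proof.
have [T0 [ip Phi_pos]] := exists_tilting_range.
have big : \forall t \near +oo, T0 + 3 < t by apply: nbhs_pinfty_gt; exact: num_real.
apply: filterS2 s_expansion big => t [s0 _] Tt; split => //.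
  exact: (tilted_mean X_density ip Phi_pos Tt).
exact: (tilted_variance X_density ip Phi_pos Tt).
Qed.

(** The mean is within o(sigma) of psi, and sigma <= psi because the window
    lies in the positive half-line. *)
Lemma mean_equiv : m X ~_(at_pinfty R) psi.
Proof.
apply/eqaddoP => e e0.
have r1 := @ratio_cvg _ _ _ a_cvg0 a_neq0 r_cvg 1.
rewrite normal_moment_odd// in r1.
have /cvgrPdist_le/(_ e e0) h' := r1.
apply: filterS3 mean_expansion reg h' => t E [s0 _ p2 sp]; rewrite sub0r normrN => re.
rewrite !fctE E addrAC subrr add0r normrM (gtr0_norm s0) mulrC.
by rewrite (ger0_norm (_ : 0 <= psi t)); [apply: ler_pM => //; exact: ltW|lra].
Qed.

Lemma variance_equiv (D : R -> R) : (\forall t \near +oo, D t = sigma t ^+ 2) ->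
  s2 X ~_(at_pinfty R) D.
Proof.
move=> DE; apply: (equiv_of_ratio (c := cm 2)) => //.
by apply: filterS2 DE s2_expansion => t -> ->.
Qed.

Let cm3_cvg : - (cm 3 t / a t) @[t --> +oo] --> (1 : R).
Proof.
have E : (M (3 + 3) - 3 * 3%:R * M (3 - 1)) / 6 = 1.
  rewrite (_ : (3 + 3)%N = 6%N)// (_ : (3 - 1)%N = 2%N)//.
  by rewrite !normal_moment_rec normal_moment0; field.
have c3 := cvgN (@cm_odd 3 isT isT); rewrite opprK E in c3.
exact: c3.
Qed.

(** For j = 3 the constant of centered_odd_cvg is (M_6 - 9 M_2)/6 = 1. *)
Lemma third_moment_equiv (D : R -> R) : (\forall t \near +oo, D t = - (a t * sigma t ^+ 3)) ->
  mu X p 3 ~_(at_pinfty R) D.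
Proof.
move=> DE; apply: (equiv_of_ratio (c := fun t => - (cm 3 t / a t))) => //.
apply: filterS3 DE (mu_expansion 3) a_neq0 => t -> -> a0.
by field.
Qed.

Lemma even_moment_equiv j : ~~ odd j ->
  mu X p j ~_(at_pinfty R) (fun t => M j * s X t ^+ j).
Proof.
move=> ej; have Mj := normal_moment_even R ej.
apply: (equiv_of_ratio (c := fun t => cm j t * (M j * Num.sqrt (cm 2 t) ^+ j)^-1)).
  apply: filterS3 (mu_expansion j) s_expansion cm2_gt0 => t -> [_ ->] c0.
  rewrite exprMn; field.
  by rewrite (gt_eqF Mj) expf_neq0// gt_eqF// sqrtr_gt0.
have Mj1 : M j * 1 != 0 by rewrite mulr1 gt_eqF.
have c1 : M j * Num.sqrt (cm 2 t) ^+ j @[t --> +oo] --> M j * 1.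
  by apply: cvgM; [exact: cvg_cst|exact: (@sqcm_cvg j)].
have c2 := cvgM (@cm_cvg j) (cvgV Mj1 c1).
by rewrite mulr1 divff ?gt_eqF// in c2; exact: c2.
Qed.

(** Both sides are of order a sigma^j. Taking the quotient is legitimate since
    the constant M_(j+3) - 3 j M_(j-1) = j (j - 1) M_(j-1) is positive. *)
Lemma odd_moment_equiv j : (3 < j)%N -> odd j ->
  mu X p j ~_(at_pinfty R)
    (fun t => (M (j + 3) - 3 * j%:R * M (j - 1)) * mu X p 3 t * s X t ^+ (j - 3) / 6).
Proof.
move=> j3 oj; set K := _ - _.
have K0 : 0 < K.
  (* M_(j+3) = (j + 2) j M_(j-1) *)
  have -> : K = j%:R * (j - 1)%:R * M (j - 1).
    rewrite /K natrB ?(ltn_trans _ j3)//.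
    have -> : (j + 3 = (j - 1).+4)%N by lia.
    rewrite !normal_moment_rec -!natr1 natrB ?(ltn_trans _ j3)//; ring.
  rewrite !mulr_gt0 ?ltr0n ?subn_gt0 ?(ltn_trans _ j3)//.
  by apply: normal_moment_even; rewrite oddB ?oj ?(ltn_trans _ j3).
have c3 : \forall t \near +oo, 0 < - (cm 3 t / a t) by exact: (cvgr_gt _ cm3_cvg).
have cj := @cm_odd j oj (ltnW j3); rewrite -/K in cj.
pose c t := - (cm j t / a t) * (K / 6 * - (cm 3 t / a t) * Num.sqrt (cm 2 t) ^+ (j - 3))^-1.
apply: (equiv_of_ratio (c := c)).
  apply: filterS3 (filterI (mu_expansion j) (mu_expansion 3)) (filterI s_expansion c3)
    (filterI a_neq0 cm2_gt0) => t [-> ->] [[_ ->] c30] [a0 c0].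
  have c3n : cm 3 t != 0.
    by apply: contraTneq c30 => ->; rewrite mul0r oppr0 ltxx.
  have sq0 : Num.sqrt (cm 2 t) ^+ (j - 3) != 0 by rewrite expf_neq0// gt_eqF// sqrtr_gt0.
  have sj : sigma t ^+ j = sigma t ^+ (j - 3) * sigma t ^+ 3.
    by rewrite -exprD subnK// ltnW.
  rewrite /c exprMn sj.
  by field; rewrite a0 c3n sq0 (gt_eqF K0).
have K6 : 0 < K / 6 by rewrite divr_gt0.
have c1 : K / 6 * - (cm 3 t / a t) * Num.sqrt (cm 2 t) ^+ (j - 3) @[t --> +oo]
    --> K / 6 * 1 * 1.
  apply: cvgM; last exact: (@sqcm_cvg (j - 3)).
  by apply: cvgM; [exact: cvg_cst|exact: cm3_cvg].
have K60 : K / 6 * 1 * 1 != 0 by rewrite !mulr1 gt_eqF.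
have c2 := cvgM (cvgN cj) (cvgV K60 c1).
rewrite opprK !mulr1 divff ?gt_eqF// in c2.
exact: c2.
Qed.

End conclusion.

Theorem theorem1 (R : realType) (d : measure_display) (T : measurableType d)
    (P : probability T R) (X : {RV P >-> R}) (p g q psi : R -> R)
    (X_density : has_density X p)
    (X_support : support_of (distribution P X) = [set: R])
    (Phi_finite : \forall t \near (0 : R), 'M_P X t \is a fin_num)
    (p_form : {in Rplus, forall x, p x = expR (- (g x - q x))})
    (g_pos : {in Rplus, forall x, 0 < g x})
    (g_convex : convex_function (Rplus) g)
    (g_derivable : times_derivable 4 g (Rplus))
    (g_superlinear : g x / x @[x --> +oo] --> +oo)
    (h_pos : {in Rplus, forall x, 0 < g^`() x})
    (h_monotone : {in Rplus &, {homo g^`() : x y / x <= y}})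
    (h_infty : g^`() x @[x --> +oo] --> +oo)
    (psi_inverse : inverse_at_infinity g^`() psi)
    (psi_infty : psi t @[t --> +oo] --> +oo)
    (q_bounded : [bounded q x | x in Rplus])
    (h_class_R : class_R_assumption g^`() psi q) :
  (\forall t \near +oo,
     [/\ m X t = \int[lebesgue_measure]_x (x * tilted_density X p t x),
         s2 X t =
           \int[lebesgue_measure]_x ((x - m X t) ^+ 2 * tilted_density X p t x) &
         0 < s X t])
  /\
  [/\ m X ~_(at_pinfty R) psi,
      s2 X ~_(at_pinfty R) psi^`(),
      mu X p 3 ~_(at_pinfty R) psi^`(2),
      forall j : nat, (3 < j)%N -> ~~ odd j ->
        mu X p j ~_(at_pinfty R) (fun t => normal_moment R j * s X t ^+ j) &
      forall j : nat, (3 < j)%N -> odd j ->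
        mu X p j ~_(at_pinfty R)
          (fun t => (normal_moment R (j + 3)
                     - 3 * j%:R * normal_moment R (j - 1))
                    * mu X p 3 t * s X t ^+ (j - 3) / 6)].
Proof.
have dk (k : nat) (x : R) : (k < 4)%N -> 0 < x -> is_derive x 1 (g^`(k)) (g^`(k.+1) x).
  move=> k4 x0; apply: DeriveDef; last by rewrite -derive1E.
  by apply: g_derivable => //; rewrite /Rplus /= in_itv/= x0.
have Rp (x : R) : 0 < x -> x \in Rplus by move=> x0; rewrite inE /Rplus /= in_itv/= x0.
have dg (x : R) : 0 < x -> is_derive x 1 g (g^`() x) by exact: (@dk 0%N).
have dh (x : R) : 0 < x -> is_derive x 1 g^`() (g^`(2) x) by exact: (@dk 1%N).
have dh1 (x : R) : 0 < x -> is_derive x 1 g^`(2) (g^`(3) x) by exact: (@dk 2%N).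
have dh2 (x : R) : 0 < x -> derivable g^`(3) x 1 by move=> x0; have [] := @dk 3%N x isT x0.
have hp (x : R) : 0 < x -> 0 < g^`() x by move=> x0; apply: h_pos; exact: Rp.
have hh (x y : R) : 0 < x -> x <= y -> g^`() x <= g^`() y.
  by move=> x0 xy; apply: h_monotone => //; apply: Rp => //; exact: lt_le_trans xy.
have pE (x : R) : 0 < x -> p x = expR (- (g x - q x)) by move=> x0; apply: p_form; exact: Rp.
have [Q qQ] : exists Q, forall x, 0 < x -> `|q x| <= Q.
  have [M [_ hM]] := q_bounded; exists (M + 1) => x x0.
  by apply: (hM (M + 1)); rewrite ?ltrDl//= /Rplus /= in_itv/= x0.
have mp : measurable_fun [set: R] p by case: X_density.
have [h1_pos regime] : (\forall x \near +oo, 0 < g^`(2) x) /\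
    laplace_regime g g^`() g^`(2) g^`(3) q psi (sigma_at g psi) (skew_at g psi).
  case: h_class_R => [[beta [theta [eta [hc eta_lt hq]]]]|[eta [hc eta_lt hq]]].
    exact: (regular_case_regime dg dh dh2 hp mp pE psi_inverse psi_infty hc eta_lt hq).
  exact: (rapid_case_regime dg dh dh1 hh mp pE psi_inverse psi_infty h_infty hc eta_lt hq).
have h1p := near_psi psi_infty h1_pos.
have sig2 (t : R) : 0 < g^`(2)%classic (psi t) ->
    sigma_at g psi t ^+ 2 = (g^`(2)%classic (psi t))^-1.
  move=> h1t; rewrite /sigma_at -powR_mulrn ?powR_ge0// -powRrM.
  by rewrite (_ : - _ * 2 = -1) ?powR_inv1 ?(ltW h1t)//; field.
split; first exact: (tilted_mean_variance X_density dg dh dh1 hp hh pE qQ regime).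
split.
- exact: (mean_equiv X_density dg dh dh1 hp hh pE qQ regime).
- apply: (variance_equiv X_density dg dh dh1 hp hh pE qQ regime).
  apply: filterS2 h1p (derive1_psi dh psi_infty psi_inverse h1_pos) => t h1t ->.
  by rewrite sig2.
- apply: (third_moment_equiv X_density dg dh dh1 hp hh pE qQ regime).
  apply: filterS2 h1p (derive2_psi dh dh1 psi_infty psi_inverse h1_pos) => t h1t ->.
  rewrite /skew_at -mulrA -exprD -[(3 + 3)%N]/(2 * 3)%N exprM sig2//.
  by rewrite exprVn mulNr.
- by move=> j _; exact: (even_moment_equiv X_density dg dh dh1 hp hh pE qQ regime).
- exact: (odd_moment_equiv X_density dg dh dh1 hp hh pE qQ regime).
Qed.
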